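(* Let $B>0$, and assume $0\le T_b\le\gamma$ and $0\le\psi_b(\mu)\le\gamma^4$ for all $\mu\in(0,1]$, for some constant $\gamma>0$. Then there exists a unique solution $(T^B,\psi^B)\in C^2([0,B])\times C^1([0,B]\times[-1,1])$ of $$\partial_x^2T^B+\langle\psi^B-(T^B)^4\rangle=0,\qquad\mu\,\partial_x\psi^B+\psi^B-(T^B)^4=0,\qquad x\in[0,B],\ \mu\in[-1,1],$$ with boundary conditions $$T^B(0)=T_b,\quad\partial_xT^B(B)=0,\qquad\psi^B(0,\mu)=\psi_b(\mu),\quad\psi^B(B,\mu)=\psi^B(B,-\mu)\quad\text{for all }\mu\in(0,1],$$ and the solution satisfies $0\le T^B(x)\le\gamma$ and $0\le\psi^B(x,\mu)\le\gamma^4$ for all $x\in[0,B]$, $\mu\in[-1,1]$. Furthermore, for every $\alpha\in[0,1)$, $$\int_0^Be^{2\alpha x}4(T^B)^3|\partial_xT^B|^2dx+(1-\alpha)\int_0^B\int_{-1}^1e^{2\alpha x}(\psi^B-(T^B)^4)^2d\mu dx+\frac12\int_{-1}^0|\mu|(\psi^B(0,\cdot)-T_b^4)^2d\mu\le\frac12\int_0^1\mu(\psi_b-T_b^4)^2d\mu,$$ and $\int_{-1}^1\mu(\psi^B(x,\cdot)-(T^B(x))^4)^2d\mu\ge0$ for every $x\in[0,B]$.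
   Context: Here $T^B=T^B(x)$, $\psi^B=\psi^B(x,\mu)$, and $\langle f\rangle:=\int_{-1}^1f(\mu)\,d\mu$. $T_b$ is a given constant and $\psi_b=\psi_b(\mu)$ a given function on $(0,1]$.
   Formalization: ψ_b is assumed measurable; solutions are C¹ in x for each μ, and joint C¹ is shown away from (0,0) if ψ_b is C¹ up to μ=0, everywhere if also ψ_b(0)=T_b⁴, ψ_b'(0)=−4T_b³∂ₓT(0); uniqueness is among solutions with T≥0, since a negative second solution can exist. *)

(* Defs.v *)
From HB Require Import structures.
From mathcomp Require Import all_boot all_order all_algebra.
From mathcomp Require Import all_classical all_reals all_analysis.

Set Implicit Arguments.
Unset Strict Implicit.
Unset Printing Implicit Defensive.

Import Order.TTheory GRing.Theory Num.Theory.
Import numFieldNormedType.Exports.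

Local Open Scope classical_set_scope.
Local Open Scope ring_scope.

(* Derivatives are taken relative to a set D, hence one-sided at the end
   points of an interval, so that C^k spaces on closed sets make sense for
   functions whose values outside of D are irrelevant. *)
Definition derivable_in (R : realType) (D : set R) (f : R -> R) (x : R) : Prop :=
  cvg ((f y - f x) / (y - x) @[y --> within D x^']).

Definition deriv_in (R : realType) (D : set R) (f : R -> R) (x : R) : R :=
  lim ((f y - f x) / (y - x) @[y --> within D x^']).

Definition C1_on (R : realType) (D : set R) (f : R -> R) : Prop :=
  (forall x, D x -> derivable_in D f x) /\ {within D, continuous (deriv_in D f)}.

Definition C2_on (R : realType) (D : set R) (f : R -> R) : Prop :=
  C1_on D f /\ C1_on D (deriv_in D f).

Definition deriv_in1 (R : realType) (A : set (R * R)) (psi : R -> R -> R)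
    (p : R * R) : R :=
  deriv_in [set x | A (x, p.2)] (psi ^~ p.2) p.1.

Definition deriv_in2 (R : realType) (A : set (R * R)) (psi : R -> R -> R)
    (p : R * R) : R :=
  deriv_in [set mu | A (p.1, mu)] (psi p.1) p.2.

Definition C1_on2 (R : realType) (A : set (R * R)) (psi : R -> R -> R) : Prop :=
  [/\ {within A, continuous (fun p : R * R => psi p.1 p.2)},
      forall p, A p -> derivable_in [set x | A (x, p.2)] (psi ^~ p.2) p.1,
      forall p, A p -> derivable_in [set mu | A (p.1, mu)] (psi p.1) p.2,
      {within A, continuous (deriv_in1 A psi)} &
      {within A, continuous (deriv_in2 A psi)}].

Definition phase_rect (R : realType) (B : R) : set (R * R) :=
  `[0, B]%classic `*` `[-1, 1]%classic.

Definition angular_mean (R : realType) (f : R -> R) : R :=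
  \int[@lebesgue_measure R]_(mu in `[-1, 1]) f mu.

(* The transport equation is an ODE in x for each fixed mu: psi(., mu) is
   required to be C^1 in x for every mu, and psi(x, .) to be integrable.
   Regularity in mu is inherited from psi_b and cannot be imposed for
   arbitrary data: at mu = 0 the equation forces psi(0, 0) = T_b^4, whereas
   psi(0, mu) = psi_b(mu) for mu > 0. *)
Record milne_solution (R : realType) (B T_b : R) (psi_b : R -> R)
    (T : R -> R) (psi : R -> R -> R) : Prop := MilneSolution {
  milne_T_C2 : C2_on `[0, B]%classic T ;
  milne_psi_C1 : forall mu, mu \in `[-1, 1] ->
    C1_on `[0, B]%classic (psi ^~ mu) ;
  milne_psi_integrable : forall x, x \in `[0, B] ->
    (@lebesgue_measure R).-integrable `[-1, 1]%classic (EFin \o psi x) ;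
  milne_eq_T : forall x, x \in `[0, B] ->
    deriv_in `[0, B]%classic (deriv_in `[0, B]%classic T) x
      + angular_mean (fun mu => psi x mu - T x ^+ 4) = 0 ;
  milne_eq_psi : forall x mu, x \in `[0, B] -> mu \in `[-1, 1] ->
    mu * deriv_in `[0, B]%classic (psi ^~ mu) x + psi x mu - T x ^+ 4 = 0 ;
  milne_T_left : T 0 = T_b ;
  milne_T_right : deriv_in `[0, B]%classic T B = 0 ;
  milne_psi_left : forall mu, mu \in `]0, 1] -> psi 0 mu = psi_b mu ;
  milne_psi_right : forall mu, mu \in `]0, 1] -> psi B mu = psi B (- mu)
}.

(* Main.v *)
Require Import Defs.
From HB Require Import structures.
From mathcomp Require Import all_boot all_order all_algebra.
From mathcomp Require Import all_classical all_reals all_analysis.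
From mathcomp Require Import measurable_realfun ring lra.
Import Order.TTheory GRing.Theory Num.Theory.
Import numFieldNormedType.Exports.
Local Open Scope classical_set_scope.
Local Open Scope ring_scope.

(* Reflecting the slab [0, B] evenly about B turns psi(x, -mu) into
   psi(2B - x, mu), so the transport equation becomes, for each mu > 0, a linear
   ODE on [0, 2B] started from psi_b(mu), which obeys a maximum principle.
   Existence: with k large, T |-> k^2 T - 2 T^4 + <psi[T^4]> is monotone on
   [0, gamma], hence so is the map sending T to the solution of
   - T'' + k^2 T = (that right-hand side); 0 is a subsolution, gamma a
   supersolution, and the supremum of the Lipschitz subsolutions is a fixed point.
   Energy: the equations give T' = <mu psi>, and J = <mu (psi - T^4)^2> satisfies
   J' = - 2 (4 T^3 T'^2 + <(psi - T^4)^2>) with J(B) = 0; the weighted inequality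
   follows by integrating (e^(2 alpha x) J)' with J <= <(psi - T^4)^2>.
   Uniqueness: an L^1 contraction. The difference of two solutions psi is
   dominated by the solution Psi with zero inflow and source |T1^4 - T2^4|; Kato's
   inequality for T1 - T2 gives - <mu Psi>(0) <= 0, i.e. Psi does not leave through
   x = 0, which forces its source to vanish.
   Regularity at mu = 0: boundary layer correctors and explicit barriers for the
   transport equations solved by the two partial derivatives of psi. *)

Set Implicit Arguments.
Unset Strict Implicit.

(** [psi_b] is merely measurable, so existence, energy and uniqueness use no regularity in [mu]: the
    angle enters through integrals of bounded functions, and the x-derivative of [psi], which
    degenerates like [1 / mu], is integrated only after multiplication by [mu]. One common Lipschitz
    constant for all subsolutions makes their pointwise supremum continuous, so order replaces
    compactness. The constant exists because the Helmholtz solution has zero slope at [B] and a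
    bounded second derivative. The energy inequality compares [psi] with [T^4] for a single solution
    and does not bound a difference of two. The L^1 argument does, because for nonnegative
    temperatures [T1 - T2] and [T1^4 - T2^4] have the same sign. Near [mu = 0+] one has
    [psi = T^4 - mu (T^4)' + ...] up to a layer of size [exp (- x / mu)], which beats every power of
    [1 / mu] for [x > 0]. Only the corner (0, 0) is therefore critical, and there the inflow has to
    match both terms of the expansion. *)

(** * Primitives and monotonicity on the line *)

(** Set integrals carry no orientation, so the primitive vanishing at 0 is a difference of two
    integrals from a common base point to the left of both [x] and 0. By [primE] any such base point
    gives the same value. *)
Definition prim {R : realType} (g : R -> R) (x : R) : R :=
  let a := - (`|x| + 1) in
  \int[@lebesgue_measure R]_(t in `[a, x]) g t
  - \int[@lebesgue_measure R]_(t in `[a, 0]) g t.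

Section primitive.
Context {R : realType}.
Implicit Types (f g : R -> R) (a b x y : R).
Local Notation mu := (@lebesgue_measure R).

Lemma continuous_integrable_itv g a b : continuous g ->
  mu.-integrable `[a, b] (EFin \o g).
Proof.
move=> cg; apply: continuous_compact_integrable; first exact: segment_compact.
exact: continuous_subspaceT.
Qed.

Lemma Rintegral_itv_shift g a b x y : continuous g ->
  a <= x -> a <= y -> b <= x -> b <= y ->
  \int[mu]_(t in `[a, x]) g t - \int[mu]_(t in `[a, y]) g t =
  \int[mu]_(t in `[b, x]) g t - \int[mu]_(t in `[b, y]) g t.
Proof.
move=> cg; wlog ab : a b / a <= b => [H ax ay bx by_|ax ay bx by_].
  by have [/H|/ltW/H] := leP a b; [exact|move=> E; rewrite E].
suff E z : b <= z -> \int[mu]_(t in `[a, z]) g t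
    = \int[mu]_(t in `[a, b]) g t + \int[mu]_(t in `[b, z]) g t.
  by rewrite (E x)// (E y)//; ring.
move=> bz; rewrite -[X in _ + X]Rintegral_itv_obnd_cbnd; last first.
  apply: (@integrableS _ _ _ mu `[b, z]) => //.
    by apply: subset_itvr; rewrite bnd_simp.
  exact: continuous_integrable_itv.
by rewrite -(Rintegral_itvB (continuous_integrable_itv a z cg)) ?bnd_simp//; ring.
Qed.

Lemma primE g a x : continuous g -> a <= x -> a <= 0 ->
  prim g x = \int[mu]_(t in `[a, x]) g t - \int[mu]_(t in `[a, 0]) g t.
Proof.
move=> cg ax a0; apply: Rintegral_itv_shift => //.
by rewrite lerNl (le_trans (ler_norm _))// normrN lerDl.
Qed.

Lemma prim0 g : continuous g -> prim g 0 = 0.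
Proof. by move=> cg; rewrite (@primE g 0)// subrr. Qed.

Lemma is_derive_prim g x : continuous g -> is_derive x (1 : R) (prim g) (g x).
Proof.
(* The base point of [prim] moves with its argument. A fixed [a], below 0 and below all points near
   [x], turns [prim] locally into an ordinary primitive minus a constant. *)
move=> cg; pose a : R := - (`|x| + 2).
have ax1 : a + 1 < x - 1/2.
  by rewrite /a; have := ler_norm (- x); rewrite normrN; lra.
have a0 : a <= 0 by rewrite /a; have := normr_ge0 x; lra.
pose F y := \int[mu]_(t in `[a, y]) g t.
have [dF F'] : derivable F x 1 /\ derive1 F x = g x.
  apply: (@continuous_FTC1 _ g (BLeft a) x (x + 1)) => //.
  - by rewrite ltrDl.
  - exact: continuous_integrable_itv.
  - by rewrite lte_fin; lra.
  - exact: cg.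
have HF : is_derive x (1:R) (F - cst (F 0)) (g x).
  have HF0 : is_derive x (1:R) F (g x) by apply: (DeriveDef dF); rewrite -derive1E.
  by apply: is_derive_eq; rewrite subr0.
apply: near_eq_is_derive HF.
near=> y; rewrite (@primE g a _ cg) //.
have : x - 1/2 < y by near: y; apply: lt_nbhsr; lra.
lra.
Unshelve. all: by end_near. Qed.

Lemma is_derive_continuous f x l : is_derive x (1:R) f l -> {for x, continuous f}.
Proof. by move=> [df _]; exact/differentiable_continuous/derivable1_diffP. Qed.

Lemma ndecr_itv f (df : R -> R) a b :
  (forall x, a < x < b -> is_derive x (1:R) f (df x)) ->
  (forall x, a < x < b -> 0 <= df x) -> {within `[a, b], continuous f} ->
  forall x y, a <= x -> x <= y -> y <= b -> f x <= f y.
Proof.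
move=> Hf Hd cf; apply: ger0_derive1_ndecr => // x; rewrite in_itv/= => xab.
  by case: (Hf _ xab).
by rewrite derive1E; case: (Hf _ xab) => _ ->; exact: Hd.
Qed.

Lemma nincr_itv f (df : R -> R) a b :
  (forall x, a < x < b -> is_derive x (1:R) f (df x)) ->
  (forall x, a < x < b -> df x <= 0) -> {within `[a, b], continuous f} ->
  forall x y, a <= x -> x <= y -> y <= b -> f y <= f x.
Proof.
move=> Hf Hd cf; apply: ler0_derive1_nincr => // x; rewrite in_itv/= => xab.
  by case: (Hf _ xab).
by rewrite derive1E; case: (Hf _ xab) => _ ->; exact: Hd.
Qed.

Lemma continuous_itv_bounded f a b : {within `[a, b], continuous f} ->
  exists M : R, forall x, a <= x <= b -> `|f x| <= M.
Proof.
move=> /continuous_compact/(_ (@segment_compact R a b))/compact_bounded[N [_ HN]].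
exists (N + 1) => y yc.
by apply: (HN (N + 1)); [rewrite ltrDl|exists y; rewrite //= in_itv].
Qed.

End primitive.

(** * The transport equation in one direction *)

(** Duhamel's formula for [mu u' + u = f], [u 0 = b0]. It makes sense on the whole line, so
    derivatives are two-sided even at the ends of the slab. *)
Definition transport {R : realType} (mu b0 : R) (f : R -> R) (x : R) : R :=
  expR (- (x / mu)) * (b0 + prim (fun y => expR (y / mu) * (f y / mu)) x).

Section transport_equation.
Context {R : realType}.
Implicit Types (f g : R -> R) (a b c m x y : R).

Lemma is_derive_expR_scale k x :
  is_derive x (1 : R) (fun y => expR (k * y)) (k * expR (k * x)).
Proof.
have H : is_derive x (1 : R) (fun y : R => k * y) k.
  by apply: is_derive_eq; rewrite /GRing.scale/=; ring.
have := is_derive1_comp (is_derive_expR (k * x)) H.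
by rewrite mulrC.
Qed.

Lemma continuous_expR_scale k : continuous (fun y : R => expR (k * y)).
Proof. by move=> x; exact: (is_derive_continuous (is_derive_expR_scale k x)). Qed.

Lemma continuous_transport_source m f : continuous f ->
  continuous (fun y => expR (y / m) * (f y / m)).
Proof.
move=> cf x; apply: cvgM; last by apply: cvgM; [exact: cf|exact: cvg_cst].
by under eq_fun do rewrite mulrC; rewrite mulrC; exact: continuous_expR_scale.
Qed.

Lemma transport0 m b f : continuous f -> transport m b f 0 = b.
Proof.
move=> cf; rewrite /transport prim0; last exact: continuous_transport_source.
by rewrite mul0r oppr0 expR0; ring.
Qed.

Lemma is_derive_transport m b f x : continuous f ->
  is_derive x (1 : R) (transport m b f) ((f x - transport m b f x) / m).
Proof.
move=> cf; have H := is_derive_prim x (continuous_transport_source (m:=m) cf).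
have He := is_derive_expR_scale (- m^-1) x.
pose E y := expR (- m^-1 * y).
pose P := prim (fun y => expR (y / m) * (f y / m)).
have -> : transport m b f = E * (cst b + P).
  apply/funext => y; rewrite -[RHS]/(expR (- m^-1 * y) * (b + P y)).
  by rewrite mulNr [_^-1 * _]mulrC.
apply: is_derive_eq; rewrite /GRing.scale/= add0r.
have EE : E x * expR (x / m) = 1.
  by rewrite /E -expRD mulNr [_^-1 * _]mulrC addNr expR0.
rewrite [E x * _]mulrA EE -[(E * (cst b + P)) x]/(E x * (b + P x)).
by rewrite -[(cst b + P) x]/(b + P x) -/(E x); ring.
Qed.

Lemma within_continuous_weight k f (A : set R) : {within A, continuous f} ->
  {within A, continuous (fun x => expR (k * x) * f x)}.
Proof.
move=> cf x; apply: cvgM; last exact: cf.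
exact: (continuous_subspaceT (continuous_expR_scale (k:=k))).
Qed.

Lemma is_derive_weight k f df x : is_derive x (1 : R) f df ->
  is_derive x (1 : R) (fun x => expR (k * x) * f x) (expR (k * x) * (k * f x + df)).
Proof.
move=> Hf; have He := is_derive_expR_scale k x.
apply: (@is_derive_eq _ _ _ ((fun x => expR (k * x)) * f)).
by rewrite /GRing.scale/=; ring.
Qed.

(** The integrating factor [exp (x / m)] turns the differential inequality into monotonicity.
    Derivatives are asked only in the open interval because this also serves solutions that are
    one-sidedly regular at the ends. *)
Lemma transport_ge0 m f (df : R -> R) a c : 0 < m ->
  (forall x, a < x < c -> is_derive x (1 : R) f (df x)) ->
  {within `[a, c], continuous f} ->
  (forall x, a < x < c -> 0 <= m * df x + f x) -> 0 <= f a ->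
  forall x, a <= x <= c -> 0 <= f x.
Proof.
move=> m0 Hf cf Hd fa x /andP[ax xc].
rewrite -(pmulr_rge0 _ (expR_gt0 (m^-1 * x))).
apply: (@le_trans _ _ (expR (m^-1 * a) * f a)).
  by rewrite mulr_ge0// expR_ge0.
apply: (ndecr_itv (f := fun x => expR (m^-1 * x) * f x)
  (df := fun x => expR (m^-1 * x) * (m^-1 * f x + df x)) (a := a) (b := c)) => //.
- by move=> y /Hf; exact: is_derive_weight.
- move=> y /Hd; rewrite -(pmulr_rge0 _ (_ : 0 < m^-1)) ?invr_gt0// => H.
  rewrite mulr_ge0 ?expR_ge0//; apply: le_trans H _.
  by rewrite mulrDr mulrA mulVf ?gt_eqF// mul1r addrC.
- exact: within_continuous_weight.
Qed.

(** The same integrating factor, with the information coming from the right end. It serves an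
    arbitrary second solution, whose negative directions are not given by reflection. *)
Lemma transport_backward_ge0 m f (df : R -> R) a c : m < 0 ->
  (forall x, a < x < c -> is_derive x (1 : R) f (df x)) ->
  {within `[a, c], continuous f} ->
  (forall x, a < x < c -> 0 <= m * df x + f x) -> 0 <= f c ->
  forall x, a <= x <= c -> 0 <= f x.
Proof.
move=> m0 Hf cf Hd fa x /andP[ax xc].
rewrite -(pmulr_rge0 _ (expR_gt0 (m^-1 * x))).
apply: (@le_trans _ _ (expR (m^-1 * c) * f c)).
  by rewrite mulr_ge0// expR_ge0.
apply: (nincr_itv (f := fun x => expR (m^-1 * x) * f x)
  (df := fun x => expR (m^-1 * x) * (m^-1 * f x + df x)) (a := a) (b := c)) => //.
- by move=> y /Hf; exact: is_derive_weight.
- move=> y /Hd; rewrite -(nmulr_rle0 _ (_ : m^-1 < 0)) ?invr_lt0// => H.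
  rewrite mulr_ge0_le0 ?expR_ge0//; apply: le_trans H.
  by rewrite mulrDr mulrA mulVf ?lt_eqF// mul1r addrC.
- exact: within_continuous_weight.
Qed.

(** It is [transport_ge0] for [g + f] and [g - f], that is, a barrier principle. The stability and
    boundary layer estimates below are instances with a suitable [g]. *)
Lemma transport_norm_le m f (df : R -> R) g (dg : R -> R) a c : 0 < m ->
  (forall x, is_derive x (1 : R) f (df x)) ->
  (forall x, is_derive x (1 : R) g (dg x)) ->
  (forall x, a <= x <= c -> `|m * df x + f x| <= m * dg x + g x) ->
  `|f a| <= g a ->
  forall x, a <= x <= c -> `|f x| <= g x.
Proof.
move=> m0 Hf Hg Hd fga x xac.
have dfg s y : is_derive y (1 : R) (g + s *: f) (dg y + s *: df y).
  exact: is_deriveD.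
have cfg s : {within `[a, c], continuous (g + s *: f)}.
  by apply: continuous_subspaceT => y; exact: (is_derive_continuous (dfg s y)).
have H (s : R) : `|s| = 1 -> 0 <= (g + s *: f) x.
  move=> s1; apply: (transport_ge0 (df := fun x => dg x + s *: df x) m0 _ (cfg s) _ _ xac).
  - move=> y /andP[ay yc]; have := Hd y; rewrite (ltW ay) (ltW yc) => /(_ isT).
    rewrite -(mul1r `|_|) -s1 -normrM ler_norml => /andP[H _].
    rewrite -[(g + s *: f) y]/(g y + s * f y) /GRing.scale/=; move: H; lra.
  - rewrite -[(g + s *: f) a]/(g a + s * f a); move: fga.
    by rewrite -(mul1r `|_|) -s1 -normrM ler_norml => /andP[H _]; move: H; lra.
have := H 1; have := H (-1); rewrite normrN normr1 => /(_ erefl) H1 /(_ erefl) H2.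
rewrite ler_norml; move: H1 H2.
rewrite -[(g + _ *: f) x]/(g x + _ * f x) -[(g + 1 *: f) x]/(g x + 1 * f x); lra.
Qed.

End transport_equation.

(** * Integration over the angle *)

Section angular_mean.
Context {R : realType}.
Implicit Types (f g h : R -> R) (a b c m x y M : R).
Local Notation mu := (@lebesgue_measure R).
Local Notation I := (`[(-1 : R), 1]%classic).

Lemma bounded_integrable_itv f a b M : measurable_fun `[a, b] f ->
  (forall m, a <= m <= b -> `|f m| <= M) -> mu.-integrable `[a, b] (EFin \o f).
Proof.
move=> mf fM; apply: measurable_bounded_integrable => //.
  rewrite /= lebesgue_measure_itv/=; case: ifP => // _.
  by rewrite -EFinB ltry.
exists M; split; first exact: num_real.
move=> N MN m /=; rewrite in_itv/= => Im; apply: le_trans (ltW MN); exact: fM.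
Qed.

(** Lebesgue measure is its own image under negation, so this is a change of variables for a
    pushforward measure, applied to the extension of [f] by zero. *)
Lemma angular_mean_opp f : mu.-integrable I (EFin \o f) ->
  angular_mean (fun m => f (- m)) = angular_mean f.
Proof.
move=> fi; rewrite /angular_mean Rintegral_mkcond [RHS]Rintegral_mkcond.
have -> : (fun m => f (- m)) \_ I = (f \_ I) \o -%R.
  apply/funext => m; rewrite /= !patchE.
  suff -> : (- m \in I) = (m \in I) by [].
  apply/idP/idP; rewrite !inE/= !in_itv/=; lra.
have fiT : mu.-integrable setT (EFin \o (f \_ I)).
  by rewrite -restrict_EFin; apply/integrable_restrict => //=; rewrite setTI.
have mN : measurable_fun [set: measurableTypeR R]
    (-%R : measurableTypeR R -> measurableTypeR R).
  exact: oppr_measurable.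
have mfI : measurable_fun [set: R] (EFin \o (f \_ I)) by case/integrableP : fiT.
have E1 A : measurable A -> mu A = pushforward mu (-%R : _ -> measurableTypeR R) A.
  by move=> mA; rewrite lebesgue_measureN.
rewrite /Rintegral; congr fine; apply/esym.
rewrite (eq_measure_integral (pushforward mu (-%R : _ -> measurableTypeR R))); last first.
  by move=> A mA _; exact: E1.
rewrite integral_pushforward//; last first.
  apply/integrableP; split; first exact: measurableT_comp.
  rewrite preimage_setT.
  have mab : measurable_fun [set: measurableTypeR R] (abse \o (EFin \o f \_ I)).
    exact: measurableT_comp.
  have := ge0_integral_pushforward mN mu measurableT mab.
  rewrite preimage_setT => <-; last by move=> y _ /=.
  rewrite (eq_measure_integral mu); last by move=> A mA _; exact/esym/E1.
  by case/integrableP : fiT.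
Qed.

(** This makes the fluxes vanish at [x = B], where the reflection condition makes [psi] even in
    [mu]. *)
Lemma angular_mean_odd f : mu.-integrable I (EFin \o f) ->
  (forall m, -1 <= m <= 1 -> f (- m) = - f m) -> angular_mean f = 0.
Proof.
move=> fi fo; have := angular_mean_opp fi.
rewrite [LHS](_ : _ = angular_mean (fun m => -1 * f m)).
  by rewrite /angular_mean RintegralZl//; lra.
apply: eq_Rintegral => m; rewrite inE/= in_itv/= => /fo ->; lra.
Qed.

(** Dominated convergence. The bound is required at every real [x], which is why functions
    controlled only on the slab are composed with [fold] before this is applied. *)
Lemma continuous_angular_mean (h : R -> R -> R) M :
  (forall x, measurable_fun I (h x)) ->
  (forall x m, -1 <= m <= 1 -> `|h x m| <= M) ->
  (forall m, -1 <= m <= 1 -> continuous (h ^~ m)) ->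
  continuous (fun x => angular_mean (h x)).
Proof.
move=> mh hM ch x.
apply: (@continuity_under_integral R _ _ mu h I _ (x - 1) (x + 1) _ _ (cst M)) => //.
- by move=> y _; exact: bounded_integrable_itv (hM y).
- by apply: aeW => m; rewrite /= in_itv/= => /ch cm y _; exact: cm.
- by apply: (@bounded_integrable_itv _ _ _ `|M|).
- move=> y _; apply: aeW => m; rewrite /= in_itv/=; exact: hM.
- by rewrite inE/= in_itv/=; lra.
Qed.

Lemma is_derive_angular_mean (h dh : R -> R -> R) M a b x : a < x < b ->
  (forall y, a < y < b -> mu.-integrable I (EFin \o h y)) ->
  (forall y m, a < y < b -> -1 <= m <= 1 ->
     is_derive y (1 : R) (h ^~ m) (dh y m)) ->
  (forall y m, a < y < b -> -1 <= m <= 1 -> `|dh y m| <= M) ->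
  is_derive x (1 : R) (fun x => angular_mean (h x)) (angular_mean (dh x)).
Proof.
move=> xab ih Hh dhM.
have dE y m : a < y < b -> -1 <= m <= 1 -> partial1of2 h y m = dh y m.
  by move=> yab Im; rewrite partial1of2E; case: (Hh y m yab Im).
have Ix : `]a, b[%classic x by rewrite /= in_itv/=.
have ih' y : `]a, b[%classic y -> mu.-integrable I (EFin \o h y).
  by rewrite /= in_itv/=; exact: ih.
have Hh' y m : `]a, b[%classic y -> I m -> derivable (h ^~ m) y 1.
  by rewrite /= !in_itv/= => yab Im; case: (Hh y m yab Im).
have Mi : mu.-integrable I (EFin \o (fun=> `|M|)).
  by apply: (@bounded_integrable_itv _ _ _ `|M|) => // m _; rewrite normr_id.
have G y m : `]a, b[%classic y -> I m -> `|partial1of2 h y m| <= `|M|.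
  rewrite /= !in_itv/= => yab Im; rewrite dE// (le_trans (dhM _ _ yab Im))//.
  exact: ler_norm.
have G0 (m : R) : 0 <= (fun=> `|M|) m by [].
apply: DeriveDef.
  exact: (@derivable_under_integral R _ _ mu h I _ x a b Ix ih' Hh' _ G0 Mi G).
rewrite -derive1E (@differentiation_under_integral R _ _ mu h I _ x a b Ix ih' Hh' _ G0 Mi G)//.
by apply: eq_Rintegral => m; rewrite inE/= in_itv/= => Im; exact: dE.
Qed.

End angular_mean.

(** * Maximum principle and dependence on the direction *)

Section transport_estimates.
Context {R : realType}.
Implicit Types (f g : R -> R) (a b c m x y M : R).

Lemma continuous_transport m b f : continuous f -> continuous (transport m b f).
Proof. by move=> cf x; exact: (is_derive_continuous (is_derive_transport m b x cf)). Qed.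

Lemma transport_eq m b f x : m != 0 ->
  m * ((f x - transport m b f x) / m) + transport m b f x = f x.
Proof. by move=> m0; field. Qed.

Lemma transport_le m b b' f g c : 0 < m -> continuous f -> continuous g ->
  (forall x, 0 <= x <= c -> f x <= g x) -> b <= b' ->
  forall x, 0 <= x <= c -> transport m b f x <= transport m b' g x.
Proof.
move=> m0 cf cg fg bb x xc; rewrite -subr_ge0.
pose u := transport m b' g - transport m b f.
pose du x := (g x - transport m b' g x) / m - (f x - transport m b f x) / m.
have Hu y : is_derive y (1 : R) u (du y).
  by apply: is_deriveB; exact: is_derive_transport.
apply: (@transport_ge0 _ m u du 0 c) => //.
- by apply: continuous_subspaceT => y; exact: is_derive_continuous (Hu y).
- move=> y /andP[y0 yc]; rewrite /du mulrBr.
  have := fg y; rewrite (ltW y0) (ltW yc) => /(_ isT).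
  have := transport_eq b f y (lt0r_neq0 m0).
  have := transport_eq b' g y (lt0r_neq0 m0).
  by rewrite -[u y]/(transport m b' g y - transport m b f y); lra.
- by rewrite -[u 0]/(transport m b' g 0 - transport m b f 0) !transport0// subr_ge0.
Qed.

Lemma transport_cst m c x : 0 < m -> 0 <= x -> transport m c (cst c) x = c.
Proof.
move=> m0 x0; apply/eqP; rewrite -subr_eq0 -normr_le0.
have cc : continuous (cst c : R -> R) by move=> ?; exact: cvg_cst.
apply: (@transport_norm_le _ m (transport m c (cst c) - cst c)
  (fun x => (c - transport m c (cst c) x) / m - 0) (cst 0) (cst 0) 0 x m0).
- by move=> y; apply: is_deriveB; exact: is_derive_transport.
- move=> y _; have := transport_eq c (cst c) y (lt0r_neq0 m0).
  rewrite -[(_ - cst c) y]/(transport m c (cst c) y - c) /= => H.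
  by rewrite mulr0 addr0 normr_le0; apply/eqP; lra.
- by rewrite -[(_ - cst c) 0]/(transport m c (cst c) 0 - c) transport0// subrr normr0.
- by rewrite x0 lexx.
Qed.

Lemma transport_bounds m b f a a' c : 0 < m -> continuous f ->
  (forall x, 0 <= x <= c -> a <= f x <= a') -> a <= b <= a' ->
  forall x, 0 <= x <= c -> a <= transport m b f x <= a'.
Proof.
move=> m0 cf fa /andP[ab ba'] x xc; have /andP[x0 _] := xc.
rewrite -[X in X <= _ <= _](transport_cst a m0 x0).
rewrite -[X in _ <= _ <= X](transport_cst a' m0 x0).
have cc k : continuous (cst k : R -> R) by move=> ?; exact: cvg_cst.
by apply/andP; split; apply: (transport_le (c := c)) => // y /fa/andP[].
Qed.

Lemma transport_norm_bound m b f M c : 0 < m -> continuous f ->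
  (forall x, 0 <= x <= c -> `|f x| <= M) -> `|b| <= M ->
  forall x, 0 <= x <= c -> `|transport m b f x| <= M.
Proof.
move=> m0 cf fM bM x xc; rewrite ler_norml.
apply: (transport_bounds (c := c)) => //; last by rewrite -ler_norml.
by move=> y /fM; rewrite ler_norml.
Qed.

(** The solution for [m'] solves the equation for [m] up to [m - m'] times its slope [(f - u) / m'],
    and the maximum principle bounds this slope by [2 M / m']. The bound degenerates as [m'] tends
    to 0, where layers form. *)
Lemma transport_dist m m' b b' f M c : 0 < m -> 0 < m' -> continuous f ->
  (forall x, 0 <= x <= c -> `|f x| <= M) -> `|b'| <= M ->
  forall x, 0 <= x <= c -> `|transport m' b' f x - transport m b f x|
     <= `|b' - b| + `|m' - m| * (2 * M / m').
Proof.
move=> m0 m'0 cf fM bM.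
pose u := transport m' b' f - transport m b f.
pose du x := (f x - transport m' b' f x) / m' - (f x - transport m b f x) / m.
have M0 : 0 <= M by apply: le_trans bM.
have K0 : 0 <= `|m' - m| * (2 * M / m').
  by rewrite !mulr_ge0// invr_ge0 ltW.
apply: (@transport_norm_le _ m u du (cst (`|b' - b| + `|m' - m| * (2 * M / m'))) (cst 0) 0 c m0).
- by move=> y; apply: is_deriveB; exact: is_derive_transport.
- move=> y yc; rewrite -[u y]/(transport m' b' f y - transport m b f y).
  have -> : m * du y + (transport m' b' f y - transport m b f y)
      = (m - m') * ((f y - transport m' b' f y) / m').
    by rewrite /du; field; rewrite !gt_eqF.
  rewrite /= mulr0 add0r normrM distrC ler_wpDl// ler_wpM2l// normrM.
  rewrite [`|m'^-1|]gtr0_norm ?invr_gt0// ler_wpM2r ?invr_ge0 ?(ltW m'0)//.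
  apply: le_trans (ler_normB _ _) _.
  by have := fM y yc; have := transport_norm_bound m'0 cf fM bM yc; lra.
- by rewrite -[u 0]/(transport m' b' f 0 - transport m b f 0) !transport0//= lerDl.
Qed.

Lemma transport_linb m b f x :
  transport m b f x = expR (- (x / m)) * b + transport m 0 f x.
Proof. by rewrite /transport; ring. Qed.

Lemma continuous_transport_param f c x m : continuous f -> 0 <= x <= c -> 0 < m ->
  {for m, continuous (fun m => transport m 0 f x)}.
Proof.
move=> cf xc m0.
have [M fM] := continuous_itv_bounded (continuous_subspaceT (A := `[0, c]) cf).
have M0 : 0 <= M by apply: le_trans (fM x xc).
apply/cvgrPdist_le => e e0; near=> m'.
have m'2 : m / 2 < m' by near: m'; apply: lt_nbhsr; lra.
have m'0 : 0 < m' by lra.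
have b0 : `|0 : R| <= M by rewrite normr0.
rewrite distrC (le_trans (transport_dist 0 m0 m'0 cf fM b0 xc))//.
rewrite subr0 normr0 add0r.
(* With [m / 2 < m'] the bound of [transport_dist] becomes [e] times [4 M / (4 M + 1)]. *)
have md : `|m' - m| <= e * m / (4 * M + 1).
  rewrite distrC; near: m'; apply: (@cvgrPdist_le _ R^o _ _ _ id m).1; first exact: cvg_id.
  by rewrite divr_gt0 ?mulr_gt0//; lra.
apply: (@le_trans _ _ (e * m / (4 * M + 1) * (2 * M / (m / 2)))).
  apply: ler_pM => //; first by rewrite !mulr_ge0// invr_ge0 ltW.
  by rewrite ler_wpM2l ?mulr_ge0// lef_pV2 ?posrE//; lra.
rewrite (_ : _ * _ = e * (4 * M / (4 * M + 1))); last by field; lra.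
by rewrite ler_piMr ?(ltW e0)// ler_pdivrMr; lra.
Unshelve. all: by end_near. Qed.

End transport_estimates.

(** * The angular intensity on the reflected slab *)

(** For [m < 0] the ray is followed through [x = B] into the mirror image of the slab, so [f] is
    meant to be even about [B]. At [m = 0] the equation is algebraic and forces the value [f x]. *)
Definition rte_psi {R : realType} (B : R) (b f : R -> R) (x m : R) : R :=
  if 0 < m then transport m (b m) f x
  else if m < 0 then transport (- m) (b (- m)) f (2 * B - x) else f x.

Section rte_psi.
Context {R : realType}.
Variables (B : R) (b f : R -> R).
Hypotheses (f_cont : continuous f)
  (f_even : forall x, f (2 * B - x) = f x).
Implicit Types (g : R -> R) (a c m x y M : R).
Local Notation psi := (rte_psi B b f).

Lemma rte_psi_pos x m : 0 < m -> psi x m = transport m (b m) f x.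
Proof. by rewrite /rte_psi => ->. Qed.

Lemma rte_psi0 x : psi x 0 = f x.
Proof. by rewrite /rte_psi ltxx. Qed.

(** Thanks to this symmetry most statements need proof only for [m >= 0] on the doubled slab
    [[0, 2 B]]; at [x = B] it is the reflection condition. *)
Lemma rte_psiN x m : psi x (- m) = psi (2 * B - x) m.
Proof.
rewrite /rte_psi oppr_gt0 oppr_lt0 opprK.
have -> : 2 * B - (2 * B - x) = x by ring.
by case: (ltgtP m 0) => // _; rewrite f_even.
Qed.

Lemma rte_psi_neg x m : m < 0 ->
  psi x m = transport (- m) (b (- m)) f (2 * B - x).
Proof. by move=> m0; rewrite -{1}(opprK m) rte_psiN rte_psi_pos// oppr_gt0. Qed.

Lemma rte_psi_left m : 0 < m -> psi 0 m = b m.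
Proof. by move=> m0; rewrite rte_psi_pos// transport0. Qed.

Lemma rte_psi_right m : psi B (- m) = psi B m.
Proof. by rewrite rte_psiN; congr rte_psi; lra. Qed.

Lemma is_derive_reflect g x d : is_derive (2 * B - x) (1 : R) g d ->
  is_derive x (1 : R) (fun y => g (2 * B - y)) (- d).
Proof.
move=> Hg; have Hr : is_derive x (1 : R) (fun y => 2 * B - y) (- 1).
  apply: (@is_derive_eq _ _ _ (cst (2 * B) - id)).
  by rewrite sub0r.
have := @is_derive1_comp R g (fun y => 2 * B - y) x d (- 1) Hg Hr.
by rewrite mulrN1.
Qed.

Lemma is_derive_rte_psi x m : m != 0 ->
  is_derive x (1 : R) (psi ^~ m) ((f x - psi x m) / m).
Proof.
case: (ltgtP m 0) => // m0 _.
  have -> : psi ^~ m = fun x => transport (- m) (b (- m)) f (2 * B - x).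
    by apply/funext => y; exact: rte_psi_neg.
  rewrite (rte_psi_neg _ m0).
  apply: (@is_derive_eq _ _ _ _ _ _ _ _ (is_derive_reflect
    (is_derive_transport (- m) (b (- m)) (2 * B - x) f_cont))).
  by rewrite f_even invrN; ring.
have -> : psi ^~ m = transport m (b m) f.
  by apply/funext => y; rewrite rte_psi_pos.
by rewrite (rte_psi_pos _ m0); exact: is_derive_transport.
Qed.

Lemma continuous_rte_psi m : continuous (psi ^~ m).
Proof.
have [->|m0] := eqVneq m 0; last first.
  by move=> x; exact: is_derive_continuous (is_derive_rte_psi x m0).
by under eq_fun do rewrite rte_psi0.
Qed.

Lemma rte_psi_bounds a a' x m :
  (forall y, 0 <= y <= 2 * B -> a <= f y <= a') ->
  (forall m, 0 < m <= 1 -> a <= b m <= a') ->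
  0 <= x <= 2 * B -> -1 <= m <= 1 -> a <= psi x m <= a'.
Proof.
move=> fa ba; wlog m0 : m x / 0 <= m => [H xB mI|xB /andP[_ m1]].
  have [|m0] := leP 0 m; first by move/H; apply.
  by rewrite -(opprK m) rte_psiN; apply: H; lra.
move: m0; rewrite le_eqVlt => /predU1P[<-|m0]; first by rewrite rte_psi0; exact: fa.
rewrite rte_psi_pos//; apply: (transport_bounds (c := 2 * B)) => //.
by apply: ba; rewrite m0.
Qed.

(** By linearity the inflow [b], of which only measurability is known, appears as a single product
    with a continuous factor; what remains is continuous in [m > 0]. Negative [m] follow by
    reflection. *)
Lemma measurable_rte_psi x : measurable_fun (`]0, 1]%classic : set R) b -> 0 <= x <= 2 * B ->
  measurable_fun (`[-1, 1]%classic : set R) (psi x).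
Proof.
move=> mb xB.
have pos y : 0 <= y <= 2 * B -> measurable_fun (`]0, 1]%classic : set R) (psi y).
  move=> yB; apply: (eq_measurable_fun (fun m => expR (- (y / m)) * b m
     + transport m 0 f y)).
    by move=> m; rewrite inE/= in_itv/= => /andP[m0 _]; rewrite rte_psi_pos// -transport_linb.
  have oy : open (`]0, +oo[%classic : set R) by exact: interval_open.
  have mS (g : R -> R) : {in `]0, +oo[%classic, continuous g} ->
      measurable_fun (`]0, 1]%classic : set R) g.
    move=> cg; apply: (@measurable_funS _ _ _ _ (`]0, +oo[%classic : set R)) => //.
      by move=> m; rewrite /= !in_itv/= andbT => /andP[].
    exact: open_continuous_measurable_fun.
  apply: measurable_funD; first apply: measurable_funM => //.
  - apply: mS => m; rewrite inE/= in_itv/= andbT => m0.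
    apply: continuous_comp; last exact: continuous_expR.
    by apply: cvgN; apply: cvgM; [exact: cvg_cst|apply: cvgV; [rewrite gt_eqF|exact: cvg_id]].
  - apply: mS => m; rewrite inE/= in_itv/= andbT => m0.
    exact: continuous_transport_param yB m0.
have -> : `[-1, 1]%classic = (`[(-1 : R), 0[ `|` [set 0] `|` `]0, 1])%classic.
  apply/seteqP; split => m /=; rewrite !in_itv/=.
    by case: (ltgtP m 0) => [m0|m0|->] /andP[? ?]; [left; left; lra|right; lra|left; right].
  by move=> [[|->]|]; lra.
apply/measurable_funU => //; first exact: measurableU.
split; last exact: pos.
apply/measurable_funU => //; split; last exact: measurable_fun_set1.
have xB' : 0 <= 2 * B - x <= 2 * B by lra.
apply: (eq_measurable_fun (psi (2 * B - x) \o -%R)).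
  by move=> m _ /=; rewrite rte_psiN; congr rte_psi; ring.
apply: (@measurable_comp _ _ _ _ _ _ (`]0, 1]%classic : set R)) => //; last exact: pos.
by move=> _ [m + <-]; rewrite /= !in_itv/=; lra.
Qed.

End rte_psi.

(** * The linear problem [- w'' + k^2 w = g] with [w 0 = t] and zero slope at [B] *)

Section helmholtz.
Context {R : realType}.
Variables (B k : R).
Implicit Types (f g w : R -> R) (a b c m x y M t : R).

(** This is [2 cosh (k (x - B))], a positive solution of [w'' = k^2 w] with zero slope at [B];
    [csinh] is its derivative. *)
Definition ccosh x : R := expR (k * (B - x)) + expR (k * (x - B)).
Definition csinh x : R := k * (expR (k * (x - B)) - expR (k * (B - x))).

Lemma ccosh_gt0 x : 0 < ccosh x.
Proof. by rewrite addr_gt0// expR_gt0. Qed.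

Let is_derive_expR_affine a x :
  is_derive x (1 : R) (fun y => expR (a * (y - B))) (a * expR (a * (x - B))).
Proof.
have H : is_derive x (1 : R) (fun y : R => a * (y - B)) a.
  apply: (@is_derive_eq _ _ _ (a *: (id - cst B))).
  by rewrite subr0 /GRing.scale/= mulr1.
have := @is_derive1_comp R expR (fun y => a * (y - B)) x _ a (is_derive_expR _) H.
by rewrite mulrC.
Qed.

Let flip a x : expR (a * (B - x)) = expR (- a * (x - B)).
Proof. by congr expR; ring. Qed.

Lemma is_derive_ccosh x : is_derive x (1 : R) ccosh (csinh x).
Proof.
have -> : ccosh = (fun y => expR (- k * (y - B))) + (fun y => expR (k * (y - B))).
  by apply/funext => y; rewrite /ccosh flip.
have H1 := is_derive_expR_affine k x; have H2 := is_derive_expR_affine (- k) x.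
by apply: is_derive_eq; rewrite /csinh flip; ring.
Qed.

Lemma is_derive_csinh x : is_derive x (1 : R) csinh (k ^+ 2 * ccosh x).
Proof.
have -> : csinh = k *: ((fun y => expR (k * (y - B))) - (fun y => expR (- k * (y - B)))).
  by apply/funext => y; rewrite /csinh flip.
have H1 := is_derive_expR_affine k x; have H2 := is_derive_expR_affine (- k) x.
by apply: is_derive_eq; rewrite /ccosh flip /GRing.scale/=; ring.
Qed.

Lemma csinhB : csinh B = 0.
Proof. by rewrite /csinh !subrr mulr0. Qed.

Lemma ccosh_reflect x : ccosh (2 * B - x) = ccosh x.
Proof. by rewrite /ccosh addrC; congr (expR _ + expR _); ring. Qed.

Lemma continuous_ccosh : continuous ccosh.
Proof. by move=> x; exact: is_derive_continuous (is_derive_ccosh x). Qed.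

(* Writing [w = ccosh * v], the operator [k^2 w - w''] becomes
   [- (ccosh^2 * v')' / ccosh], so that positivity propagates by integrating
   twice, first from [B] and then from [0]. *)
Lemma helmholtz_ge0 w (dw ddw : R -> R) :
  (forall x, is_derive x (1 : R) w (dw x)) ->
  (forall x, is_derive x (1 : R) dw (ddw x)) ->
  (forall x, 0 <= x <= B -> 0 <= k ^+ 2 * w x - ddw x) ->
  0 <= w 0 -> 0 <= dw B -> forall x, 0 <= x <= B -> 0 <= w x.
Proof.
move=> Hw Hdw Hdd w0 dwB x /andP[x0 xB].
pose z := ccosh * dw - csinh * w.
have Hz y : is_derive y (1 : R) z (ccosh y * (ddw y - k ^+ 2 * w y)).
  have H1 := is_derive_ccosh y; have H2 := is_derive_csinh y.
  have H3 := Hw y; have H4 := Hdw y.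
  by apply: is_derive_eq; rewrite /GRing.scale/=; ring.
have z0 y : 0 <= y -> y <= B -> 0 <= z y.
  move=> y0 yB; apply: (@le_trans _ _ (z B)).
    rewrite -[z B]/(ccosh B * dw B - csinh B * w B) csinhB mul0r subr0.
    by rewrite mulr_ge0// ltW// ccosh_gt0.
  apply: (@nincr_itv _ z _ 0 B (fun x _ => Hz x)) => //.
    move=> u /andP[u0 uB]; rewrite mulr_ge0_le0 ?(ltW (ccosh_gt0 u))//.
    by have := Hdd u; rewrite (ltW u0) (ltW uB) => /(_ isT); lra.
  by apply: continuous_subspaceT => u; exact: is_derive_continuous (Hz u).
pose v := w * (fun x => (ccosh x)^-1).
have Hv y : is_derive y (1 : R) v (z y / ccosh y ^+ 2).
  have H1 := is_deriveV (lt0r_neq0 (ccosh_gt0 y)) (is_derive_ccosh y).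
  have H3 := Hw y.
  apply: is_derive_eq; rewrite /GRing.scale/=.
  rewrite -[z y]/(ccosh y * dw y - csinh y * w y).
  by field; rewrite gt_eqF// ccosh_gt0.
have : 0 <= v x.
  apply: (@le_trans _ _ (v 0)).
    by rewrite -[v 0]/(w 0 / ccosh 0) divr_ge0// ltW// ccosh_gt0.
  apply: (@ndecr_itv _ v _ 0 B (fun x _ => Hv x)) => //.
    move=> u /andP[u0 uB]; rewrite mulr_ge0 ?z0 ?(ltW u0) ?(ltW uB)//.
    by rewrite invr_ge0 exprn_ge0// ltW// ccosh_gt0.
  by apply: continuous_subspaceT => u; exact: is_derive_continuous (Hv u).
by rewrite -[v x]/(w x / ccosh x) pmulr_lge0// invr_gt0 ccosh_gt0.
Qed.

Variables (t : R) (g : R -> R).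
Hypothesis g_cont : continuous g.

(** Reduction of order: for [w = ccosh * v] the equation reads [(ccosh^2 v')' = - ccosh g]. Here
    [hflux] is [ccosh^2 v'], normalized to vanish at [B] because of the Neumann condition, and
    [hcoef] is [v]. *)
Definition hflux x : R :=
  prim (fun y => ccosh y * g y) B - prim (fun y => ccosh y * g y) x.

Definition hcoef x : R := t / ccosh 0 + prim (fun y => hflux y / ccosh y ^+ 2) x.

Definition helmholtz x : R := ccosh x * hcoef x.

Definition dhelmholtz x : R := csinh x * hcoef x + hflux x / ccosh x.

Let cg_cont : continuous (fun y => ccosh y * g y).
Proof. by move=> x; apply: cvgM; [exact: continuous_ccosh|exact: g_cont]. Qed.

Lemma is_derive_hflux x : is_derive x (1 : R) hflux (- (ccosh x * g x)).
Proof.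
have H := is_derive_prim x cg_cont.
apply: (@is_derive_eq _ _ _ (cst (prim (fun y => ccosh y * g y) B)
  - prim (fun y => ccosh y * g y))).
by rewrite sub0r.
Qed.

Let is_derive_Vccosh x : is_derive x (1 : R) (fun y => (ccosh y)^-1)
  (- (ccosh x) ^- 2 * csinh x).
Proof. exact: (is_deriveV (lt0r_neq0 (ccosh_gt0 x)) (is_derive_ccosh x)). Qed.

Let hfc_cont : continuous (fun y => hflux y / ccosh y ^+ 2).
Proof.
move=> x; apply: cvgM; first exact: is_derive_continuous (is_derive_hflux x).
apply: cvgV; first by rewrite gt_eqF// exprn_gt0// ccosh_gt0.
by apply: cvgM; exact: continuous_ccosh.
Qed.

Lemma is_derive_hcoef x : is_derive x (1 : R) hcoef (hflux x / ccosh x ^+ 2).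
Proof.
have H := is_derive_prim x hfc_cont.
apply: (@is_derive_eq _ _ _ (cst (t / ccosh 0)
  + prim (fun y => hflux y / ccosh y ^+ 2))).
by rewrite add0r.
Qed.

Lemma is_derive_helmholtz x : is_derive x (1 : R) helmholtz (dhelmholtz x).
Proof.
have H1 := is_derive_ccosh x; have H2 := is_derive_hcoef x.
apply: (@is_derive_eq _ _ _ (ccosh * hcoef)).
rewrite /dhelmholtz /GRing.scale/=; field.
by rewrite gt_eqF// ccosh_gt0.
Qed.

Lemma is_derive_dhelmholtz x :
  is_derive x (1 : R) dhelmholtz (k ^+ 2 * helmholtz x - g x).
Proof.
have H1 := is_derive_csinh x; have H2 := is_derive_hcoef x.
have H3 := is_derive_hflux x; have H4 := is_derive_Vccosh x.
apply: (is_derive_eq (is_deriveD (is_deriveM H1 H2) (is_deriveM H3 H4))).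
rewrite /helmholtz /GRing.scale/=; field.
by rewrite gt_eqF// ccosh_gt0.
Qed.

Lemma helmholtz0 : helmholtz 0 = t.
Proof.
rewrite /helmholtz /hcoef prim0// addr0 mulrC divfK//.
by rewrite gt_eqF// ccosh_gt0.
Qed.

Lemma dhelmholtzB : dhelmholtz B = 0.
Proof. by rewrite /dhelmholtz csinhB /hflux subrr !mul0r addr0. Qed.

(** The flux is odd and the coefficient even about [B]: in each case the relevant combination has
    zero derivative and vanishes at [B]. Evenness is what lets [W^4] act as a source on the doubled
    slab. *)
Lemma helmholtz_reflect : (forall x, g (2 * B - x) = g x) ->
  forall x, helmholtz (2 * B - x) = helmholtz x.
Proof.
move=> g_even.
have BB : 2 * B - B = B by ring.
have hN x : hflux (2 * B - x) = - hflux x.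
  apply/eqP; rewrite -addr_eq0; apply/eqP.
  pose s := (fun x => hflux (2 * B - x)) + hflux.
  have Hs y : is_derive y (1 : R) s 0.
    have H1 := is_derive_reflect (is_derive_hflux (2 * B - y)).
    have H2 := is_derive_hflux y.
    by apply: is_derive_eq; rewrite ccosh_reflect g_even opprK subrr.
  rewrite -[LHS]/(s x) (is_derive_0_is_cst x B Hs).
  by rewrite -[s B]/(hflux (2 * B - B) + hflux B) BB /hflux subrr addr0.
move=> x; rewrite /helmholtz ccosh_reflect; congr (_ * _).
apply/eqP; rewrite -subr_eq0; apply/eqP.
pose s := (fun x => hcoef (2 * B - x)) - hcoef.
have Hs y : is_derive y (1 : R) s 0.
  have H1 := is_derive_reflect (is_derive_hcoef (2 * B - y)).
  have H2 := is_derive_hcoef y.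
  by apply: is_derive_eq; rewrite hN ccosh_reflect; ring.
rewrite -[LHS]/(s x) (is_derive_0_is_cst x B Hs).
by rewrite -[s B]/(hcoef (2 * B - B) - hcoef B) BB subrr.
Qed.

End helmholtz.

Section helmholtz_comparison.
Context {R : realType}.
Variables (B k t : R).
Implicit Types (g h : R -> R) (x c : R).

Lemma helmholtz_le g h x : continuous g -> continuous h ->
  (forall y, g y <= h y) -> 0 <= x <= B ->
  helmholtz B k t g x <= helmholtz B k t h x.
Proof.
move=> cg ch gh xB; rewrite -subr_ge0.
pose G := helmholtz B k t g; pose H := helmholtz B k t h.
apply: (@helmholtz_ge0 _ B k (H - G)
  (fun y => dhelmholtz B k t h y - dhelmholtz B k t g y)
  (fun y => (k ^+ 2 * H y - h y) - (k ^+ 2 * G y - g y))) xB.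
- by move=> y; apply: is_deriveB; exact: is_derive_helmholtz.
- by move=> y; apply: is_deriveB; exact: is_derive_dhelmholtz.
- by move=> y _; have := gh y; rewrite -[(H - G) y]/(H y - G y); lra.
- by rewrite -[(H - G) 0]/(H 0 - G 0) /H /G !helmholtz0// subrr.
- by rewrite !dhelmholtzB subrr.
Qed.

Lemma helmholtz_bounds g c x : continuous g ->
  (forall y, 0 <= g y <= k ^+ 2 * c) -> 0 <= t <= c -> 0 <= x <= B ->
  0 <= helmholtz B k t g x <= c.
Proof.
move=> cg gb /andP[t0 tc] xB; pose G := helmholtz B k t g.
apply/andP; split; [|rewrite -subr_ge0].
  apply: (@helmholtz_ge0 _ B k G (dhelmholtz B k t g)
    (fun y => k ^+ 2 * G y - g y)) xB.
  - by move=> y; exact: is_derive_helmholtz.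
  - by move=> y; exact: is_derive_dhelmholtz.
  - by move=> y _; have /andP[] := gb y; lra.
  - by rewrite /G helmholtz0.
  - by rewrite dhelmholtzB.
apply: (@helmholtz_ge0 _ B k (cst c - G) (fun y => 0 - dhelmholtz B k t g y)
  (fun y => 0 - (k ^+ 2 * G y - g y))) xB.
- by move=> y; apply: is_deriveB; exact: is_derive_helmholtz.
- by move=> y; apply: is_deriveB; exact: is_derive_dhelmholtz.
- by move=> y _; have /andP[] := gb y; rewrite -[(cst c - G) y]/(c - G y); lra.
- by rewrite -[(cst c - G) 0]/(c - G 0) /G helmholtz0// subr_ge0.
- by rewrite dhelmholtzB subrr.
Qed.

(** Mean value theorem starting from [B], where the slope is zero: the second derivative is
    [k^2 w - g], a difference of two numbers in [[0, k^2 c]]. This supplies the common Lipschitz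
    constant of the iteration. *)
Lemma dhelmholtz_norm_le g c x : continuous g ->
  (forall y, 0 <= g y <= k ^+ 2 * c) -> 0 <= t <= c -> 0 <= x <= B ->
  `|dhelmholtz B k t g x| <= B * (k ^+ 2 * c).
Proof.
move=> cg gb tc /andP[x0 xB]; pose G := helmholtz B k t g.
have dH y := is_derive_dhelmholtz B k t cg y.
have [y /[!in_itv]/= /andP[xy yB]] := MVT_segment xB (fun y _ => dH y)
  (continuous_subspaceT (fun y => is_derive_continuous (dH y))).
rewrite dhelmholtzB sub0r => E; rewrite -normrN E normrM mulrC ler_pM//.
  by rewrite ger0_norm; lra.
have /andP[h0 hg] : 0 <= G y <= c.
  by apply: helmholtz_bounds => //; rewrite yB (le_trans x0).
have /andP[s0 sg] := gb y; have k20 : 0 <= k ^+ 2 by exact: exprn_even_ge0.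
rewrite ler_norml -/G.
have := ler_wpM2l k20 h0; have := ler_wpM2l k20 hg; rewrite mulr0.
by lra.
Qed.

End helmholtz_comparison.

Section rte_psi_comparison.
Context {R : realType}.
Variables (B : R) (b f g : R -> R).
Hypotheses (f_cont : continuous f) (g_cont : continuous g)
  (f_even : forall x, f (2 * B - x) = f x) (g_even : forall x, g (2 * B - x) = g x).

Lemma rte_psi_le x m : (forall y, 0 <= y <= 2 * B -> f y <= g y) ->
  0 <= x <= 2 * B -> rte_psi B b f x m <= rte_psi B b g x m.
Proof.
move=> fg; wlog m0 : m x / 0 <= m => [H xB|xB].
  have [m0|m0] := leP 0 m; first exact: H.
  by rewrite -(opprK m) rte_psiN// [X in _ <= X]rte_psiN//; apply: H; lra.
move: m0; rewrite le_eqVlt => /predU1P[<-|m0]; first by rewrite !rte_psi0 fg.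
by rewrite !rte_psi_pos//; apply: (transport_le (c := 2 * B)).
Qed.

End rte_psi_comparison.

(** Used to exchange a source built with [fold] for a smooth one that agrees with it on the doubled
    slab. *)
Lemma rte_psi_ext {R : realType} (B : R) (b f g : R -> R) (x m : R) :
  continuous f -> continuous g ->
  (forall x, f (2 * B - x) = f x) -> (forall x, g (2 * B - x) = g x) ->
  (forall y, 0 <= y <= 2 * B -> f y = g y) -> 0 <= x <= 2 * B ->
  rte_psi B b f x m = rte_psi B b g x m.
Proof.
move=> cf cg ef eg fg xB; apply/eqP; rewrite eq_le.
by apply/andP; split; apply: rte_psi_le => // y /fg ->.
Qed.

(** * Folding the line onto the slab *)

Section fold.
Context {R : realType}.
Variables (B : R).
Hypothesis (B_gt0 : 0 < B).

(** The identity on [[0, B]], the reflection about [B] on [[B, 2 B]], and 0 elsewhere. Composition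
    with it extends a function on [[0, B]] to the line continuously, evenly about [B] and with the
    same range. *)
Definition fold (x : R) : R := Num.max 0 (Num.min x (2 * B - x)).

Lemma fold_bounds x : 0 <= fold x <= B.
Proof.
by rewrite /fold /Order.max /Order.min; case: ifP; case: ifP; have := B_gt0; lra.
Qed.

Lemma fold_id x : 0 <= x <= B -> fold x = x.
Proof.
move=> xB; rewrite /fold (min_idPl _); last lra.
by apply/max_idPr; lra.
Qed.

Lemma fold_reflect x : fold (2 * B - x) = fold x.
Proof. by rewrite /fold minC; congr (Num.max _ (Num.min _ _)); ring. Qed.

Lemma fold_lipschitz x y : `|fold x - fold y| <= `|x - y|.
Proof.
wlog xy : x y / x <= y => [H|].
  by have [/H//|/ltW/H] := leP x y; rewrite distrC [leRHS]distrC.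
rewrite [leRHS]distrC [leRHS]ger0_norm; last lra.
rewrite ler_norml /fold /Order.max /Order.min.
by case: ifP; case: ifP; case: ifP; case: ifP; lra.
Qed.

Lemma lipschitz_continuous (L : R) (f : R -> R) :
  (forall x y, `|f x - f y| <= L * `|x - y|) -> continuous f.
Proof.
move=> fL x; apply/cvgrPdist_le => e e0; near=> y.
apply: le_trans (fL x y) _.
have L0 : 0 < `|L| + 1 by rewrite ltr_wpDl.
apply: (@le_trans _ _ ((`|L| + 1) * `|x - y|)).
  by rewrite ler_wpM2r// (le_trans (ler_norm L))// lerDl.
rewrite mulrC -ler_pdivlMr//; near: y.
by apply: (@cvgrPdist_le _ R^o _ _ _ id x).1; [exact: cvg_id|rewrite divr_gt0].
Unshelve. all: by end_near. Qed.

Lemma continuous_fold : continuous fold.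
Proof.
by apply: (@lipschitz_continuous 1) => x y; rewrite mul1r; exact: fold_lipschitz.
Qed.

Lemma fold_even_id (f : R -> R) x : (forall x, f (2 * B - x) = f x) ->
  0 <= x <= 2 * B -> f (fold x) = f x.
Proof.
move=> fE xB; have [xB'|xB'] := leP x B; first by rewrite fold_id//; lra.
by rewrite -fold_reflect fold_id//; lra.
Qed.

End fold.

(** * Angular mean and flux of the intensity *)

Section angular_mean_rte_psi.
Context {R : realType}.
Variables (B gamma : R) (b : R -> R).
Hypotheses (B_gt0 : 0 < B)
  (b_meas : measurable_fun (`]0, 1]%classic : set R) b)
  (b_bound : forall m, 0 < m <= 1 -> 0 <= b m <= gamma ^+ 4).
Implicit Types (f g T : R -> R) (x y m : R).
Local Notation I := (`[(-1 : R), 1]%classic).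
Local Notation mu := (@lebesgue_measure R).

Definition admissible_source f : Prop :=
  [/\ continuous f, forall x, f (2 * B - x) = f x
    & forall x, 0 <= x <= 2 * B -> 0 <= f x <= gamma ^+ 4].

Lemma admissible_rte_psi_bounds f x m : admissible_source f ->
  0 <= x <= 2 * B -> -1 <= m <= 1 -> 0 <= rte_psi B b f x m <= gamma ^+ 4.
Proof. by move=> [cf ef bf] xB mI; exact: rte_psi_bounds. Qed.

Lemma integrable_rte_psi f x : admissible_source f -> 0 <= x <= 2 * B ->
  mu.-integrable I (EFin \o rte_psi B b f x).
Proof.
move=> af xB; have [cf ef bf] := af.
apply: (@bounded_integrable_itv _ _ _ _ (gamma ^+ 4)).
  exact: measurable_rte_psi.
by move=> m /(admissible_rte_psi_bounds af xB)/andP[? ?]; rewrite ger0_norm.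
Qed.

Lemma angular_mean_cst (c : R) : angular_mean (cst c) = 2 * c.
Proof.
rewrite /angular_mean Rintegral_cst//= lebesgue_measure_itv/= lte_fin.
rewrite ifT; last lra.
by rewrite /=; ring.
Qed.

Lemma integrable_cst_itv (a c d : R) : mu.-integrable `[a, c] (EFin \o cst d).
Proof. by apply: (@bounded_integrable_itv _ _ _ _ `|d|). Qed.

Lemma angular_mean_rte_psi_bounds f x : admissible_source f -> 0 <= x <= 2 * B ->
  0 <= angular_mean (rte_psi B b f x) <= 2 * gamma ^+ 4.
Proof.
move=> af xB; have ib := admissible_rte_psi_bounds af xB.
apply/andP; split.
  by apply: Rintegral_ge0 => m; rewrite /= in_itv/= => /ib/andP[].
rewrite -angular_mean_cst; apply: le_Rintegral => //.
- exact: integrable_rte_psi.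
- exact: integrable_cst_itv.
- by move=> m; rewrite /= in_itv/= => /ib/andP[].
Qed.

Lemma angular_mean_rte_psi_le f g x : admissible_source f -> admissible_source g ->
  (forall y, 0 <= y <= 2 * B -> f y <= g y) -> 0 <= x <= 2 * B ->
  angular_mean (rte_psi B b f x) <= angular_mean (rte_psi B b g x).
Proof.
move=> af ag fg xB; apply: le_Rintegral => //.
- exact: integrable_rte_psi.
- exact: integrable_rte_psi.
- by move=> m _; case: af => cf ef _; case: ag => cg eg _; exact: rte_psi_le.
Qed.

Lemma fold_double x : 0 <= fold B x <= 2 * B.
Proof. by have := fold_bounds B_gt0 x; have := B_gt0; lra. Qed.

Lemma continuous_angular_mean_rte_psi f : admissible_source f ->
  continuous (fun x => angular_mean (rte_psi B b f (fold B x))).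
Proof.
move=> af; have [cf ef _] := af.
apply: (@continuous_angular_mean _ (fun x => rte_psi B b f (fold B x)) (gamma ^+ 4)).
- by move=> x; apply: measurable_rte_psi => //; exact: fold_double.
- move=> x m mI.
  have /andP[? ?] := admissible_rte_psi_bounds af (fold_double x) mI.
  by rewrite ger0_norm.
- move=> m mI x; apply: (@continuous_comp _ _ _ (fold B) (rte_psi B b f ^~ m)).
    exact: continuous_fold.
  exact: continuous_rte_psi.
Qed.

Lemma angular_meanB_cst (g : R -> R) (c : R) : mu.-integrable I (EFin \o g) ->
  angular_mean (fun m => g m - c) = angular_mean g - 2 * c.
Proof.
move=> ig; rewrite -angular_mean_cst /angular_mean -RintegralB//.
exact: integrable_cst_itv.
Qed.

Definition rte_flux f x : R := angular_mean (fun m => m * rte_psi B b f x m).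

Lemma measurable_mul_rte_psi f x : admissible_source f -> 0 <= x <= 2 * B ->
  measurable_fun (I : set R) (fun m => m * rte_psi B b f x m).
Proof.
move=> [cf ef _] xB; apply: measurable_funM; first exact: measurable_id.
exact: measurable_rte_psi.
Qed.

Lemma mul_rte_psi_norm_le f x m : admissible_source f -> 0 <= x <= 2 * B ->
  -1 <= m <= 1 -> `|m * rte_psi B b f x m| <= gamma ^+ 4.
Proof.
move=> af xB mI; rewrite normrM -[leRHS]mul1r ler_pM//; first by rewrite ler_norml.
by have /andP[p0 pg] := admissible_rte_psi_bounds af xB mI; rewrite ger0_norm.
Qed.

Lemma integrable_mul_rte_psi f x : admissible_source f -> 0 <= x <= 2 * B ->
  mu.-integrable I (EFin \o (fun m => m * rte_psi B b f x m)).
Proof.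
move=> af xB; apply: bounded_integrable_itv (measurable_mul_rte_psi af xB) _.
by move=> m; exact: mul_rte_psi_norm_le.
Qed.

Lemma is_derive_mul_rte_psi f x m : admissible_source f ->
  is_derive x (1 : R) (fun y => m * rte_psi B b f y m) (f x - rte_psi B b f x m).
Proof.
move=> [cf ef _]; have [->|m0] := eqVneq m 0.
  rewrite rte_psi0 subrr; under eq_fun do rewrite mul0r.
  exact: is_derive_cst.
have H := is_derive_rte_psi b cf ef x m0.
apply: (@is_derive_eq _ _ _ (m *: (rte_psi B b f ^~ m))).
by rewrite /GRing.scale/= mulrC divfK.
Qed.

(** The weight [m] removes the singularity: [m psi] has slope [f - psi], bounded uniformly in [m],
    whereas the slope of [psi] carries a factor [1 / m]. Hence differentiation under the integral is
    allowed. *)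
Lemma is_derive_rte_flux f x : admissible_source f -> 0 < x < 2 * B ->
  is_derive x (1 : R) (rte_flux f) (2 * f x - angular_mean (rte_psi B b f x)).
Proof.
move=> af xB; have xB' : 0 <= x <= 2 * B by lra.
have [cf ef bf] := af.
have -> : 2 * f x - angular_mean (rte_psi B b f x)
    = angular_mean (fun m => f x - rte_psi B b f x m).
  rewrite -angular_mean_cst /angular_mean RintegralB//.
    exact: integrable_cst_itv.
  exact: integrable_rte_psi.
apply: (@is_derive_angular_mean _ (fun y m => m * rte_psi B b f y m)
  (fun y m => f y - rte_psi B b f y m) (gamma ^+ 4) 0 (2 * B)) => //.
- by move=> z zB; apply: integrable_mul_rte_psi => //; lra.
- by move=> z m _ _; exact: is_derive_mul_rte_psi.
- move=> z m zB mI; have zB' : 0 <= z <= 2 * B by lra.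
  have := admissible_rte_psi_bounds af zB' mI; have := bf z zB'.
  by rewrite ler_norml; lra.
Qed.

Lemma rte_fluxB f : admissible_source f -> rte_flux f B = 0.
Proof.
move=> af; have [cf ef _] := af; apply: angular_mean_odd.
  by apply: integrable_mul_rte_psi => //; have := B_gt0; lra.
by move=> m _; rewrite rte_psi_right// mulNr.
Qed.

Lemma continuous_rte_flux f : admissible_source f ->
  continuous (fun x => rte_flux f (fold B x)).
Proof.
move=> af; have [cf ef _] := af.
apply: (@continuous_angular_mean _ (fun x m => m * rte_psi B b f (fold B x) m) (gamma ^+ 4)).
- by move=> x; apply: measurable_mul_rte_psi => //; exact: fold_double.
- by move=> x m; apply: mul_rte_psi_norm_le => //; exact: fold_double.
- move=> m mI x; apply: cvgM; first exact: cvg_cst.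
  apply: (@continuous_comp _ _ _ (fold B) (rte_psi B b f ^~ m)).
    exact: continuous_fold.
  exact: continuous_rte_psi.
Qed.

End angular_mean_rte_psi.

(** * Existence by monotone iteration *)

(** The problem with [psi] eliminated: a nonlocal scalar equation for the temperature. Derivatives
    are two-sided on the whole line, so that one-sided calculus is needed only when translating to
    [milne_solution]. *)
Record milne_profile {R : realType} (B T_b gamma : R) (b W dW ddW : R -> R) : Prop :=
  MilneProfile {
  profile_deriv : forall x, is_derive x (1 : R) W (dW x) ;
  profile_deriv2 : forall x, is_derive x (1 : R) dW (ddW x) ;
  profile_cont2 : continuous ddW ;
  profile_even : forall x, W (2 * B - x) = W x ;
  profile_left : W 0 = T_b ;
  profile_right : dW B = 0 ;
  profile_bound : forall x, 0 <= x <= 2 * B -> 0 <= W x <= gamma ;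
  profile_eq : forall x, 0 <= x <= B ->
    ddW x = 2 * W x ^+ 4 - angular_mean (rte_psi B b (fun y => W y ^+ 4) x)
}.

Section milne_fixpoint.
Context {R : realType}.
Variables (B T_b gamma : R) (b : R -> R).
Hypotheses (B_gt0 : 0 < B) (gamma_gt0 : 0 < gamma) (T_b_bound : 0 <= T_b <= gamma)
  (b_meas : measurable_fun (`]0, 1]%classic : set R) b)
  (b_bound : forall m, 0 < m <= 1 -> 0 <= b m <= gamma ^+ 4).
Implicit Types (f g T : R -> R) (x y m t u v w c : R).

(** [8 gamma^3] is the Lipschitz constant of [2 t^4] on [[0, gamma]]; the summand 1 ensures
    [k <= k^2]. The constant [L] is the slope bound of [dhelmholtz_norm_le] for sources below
    [k^2 gamma]. *)
Let k : R := 1 + 8 * gamma ^+ 3.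
Let L : R := B * (k ^+ 2 * gamma).

Let k2_ge : 8 * gamma ^+ 3 <= k ^+ 2.
Proof.
have : 0 <= gamma ^+ 3 by rewrite exprn_ge0// ltW.
by rewrite /k; nra.
Qed.

Let L_ge0 : 0 <= L.
Proof. by rewrite mulr_ge0 ?(ltW B_gt0)// mulr_ge0 ?exprn_even_ge0// ltW. Qed.

Let src T x : R := T (fold B x) ^+ 4.

Let psi_mean T x : R := angular_mean (rte_psi B b (src T) (fold B x)).

Let hsrc T x : R :=
  k ^+ 2 * T (fold B x) - 2 * T (fold B x) ^+ 4 + psi_mean T x.

Let step T x : R := helmholtz B k T_b (hsrc T) (fold B x).

Let good T : Prop := continuous T /\ forall x, 0 <= T x <= gamma.

Let continuous_comp_fold T : continuous T -> continuous (fun x => T (fold B x)).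
Proof.
move=> cT x; apply: (@continuous_comp _ _ _ (fold B) T); last exact: cT.
exact: continuous_fold.
Qed.

Let admissible_src T : good T -> admissible_source B gamma (src T).
Proof.
move=> [cT bT]; split.
- by move=> x; exact: (continuous_comp (continuous_comp_fold cT (x := x))
    (@exprn_continuous R 4 _)).
- by move=> x; rewrite /src fold_reflect.
- move=> x _; have /andP[T0 Tg] := bT (fold B x).
  by rewrite exprn_ge0//= lerXn2r// nnegrE// ltW.
Qed.

Let continuous_hsrc T : good T -> continuous (hsrc T).
Proof.
move=> gT; have cT := continuous_comp_fold (proj1 gT) => x.
apply: cvgD; last exact: (continuous_angular_mean_rte_psi B_gt0 b_meas b_bound (admissible_src gT)).
apply: cvgB; apply: cvgM; try exact: cvg_cst; first exact: cT.
by have [] := admissible_src gT => H _ _; exact: H.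
Qed.

Let hsrc_reflect T x : hsrc T (2 * B - x) = hsrc T x.
Proof. by rewrite /hsrc /psi_mean fold_reflect. Qed.

(* [k] is large enough for [k^2 t - 2 t^4] to be increasing on [[0, gamma]]. *)
Let reaction_le t t' : 0 <= t -> t <= t' -> t' <= gamma ->
  k ^+ 2 * t - 2 * t ^+ 4 <= k ^+ 2 * t' - 2 * t' ^+ 4.
Proof.
move=> t0 tt' t'g; rewrite -subr_ge0.
have -> : k ^+ 2 * t' - 2 * t' ^+ 4 - (k ^+ 2 * t - 2 * t ^+ 4)
  = (t' - t) * (k ^+ 2 - 2 * (t' ^+ 3 + t' ^+ 2 * t + t' * t ^+ 2 + t ^+ 3)) by ring.
apply: mulr_ge0; first lra.
have g0 := ltW gamma_gt0; have t'0 := le_trans t0 tt'; have tg := le_trans tt' t'g.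
have le3 u v w : 0 <= u <= gamma -> 0 <= v <= gamma -> 0 <= w <= gamma ->
    u * v * w <= gamma ^+ 3.
  move=> /andP[u0 ug] /andP[v0 vg] /andP[w0 wg].
  by rewrite !exprS expr0 mulr1 mulrA !ler_pM// mulr_ge0.
have tI : 0 <= t <= gamma by rewrite t0.
have t'I : 0 <= t' <= gamma by rewrite t'0.
have H1 := le3 _ _ _ t'I t'I t'I; have H2 := le3 _ _ _ t'I t'I tI.
have H3 := le3 _ _ _ t'I tI tI; have H4 := le3 _ _ _ tI tI tI.
by move: k2_ge H1 H2 H3 H4; rewrite !exprS !expr0 !mulr1 !mulrA; lra.
Qed.

Let hsrc_le T T' x : good T -> good T' -> (forall x, T x <= T' x) ->
  hsrc T x <= hsrc T' x.
Proof.
move=> gT gT' TT'; have [_ bT] := gT; have [_ bT'] := gT'.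
have /andP[T0 _] := bT (fold B x); have /andP[_ Tg] := bT' (fold B x).
apply: lerD; first exact: reaction_le.
rewrite /psi_mean.
apply: (angular_mean_rte_psi_le b_meas b_bound (admissible_src gT) (admissible_src gT')).
- move=> y _; have /andP[u0 _] := bT (fold B y); have /andP[v0 _] := bT' (fold B y).
  by rewrite lerXn2r.
- exact: fold_double.
Qed.

(** The reaction term increases from 0 to [k^2 gamma - 2 gamma^4], and the mean of [psi] is at most
    [2 gamma^4], which exactly refills the loss: this is why [gamma] is a supersolution. *)
Let hsrc_bounds T x : good T -> 0 <= hsrc T x <= k ^+ 2 * gamma.
Proof.
move=> gT; have [_ bT] := gT; have /andP[T0 Tg] := bT (fold B x).
have /andP[P0 Pg] := angular_mean_rte_psi_bounds b_meas b_bound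
  (admissible_src gT) (fold_double B_gt0 x).
have := reaction_le (lexx _) T0 Tg; have := reaction_le T0 Tg (lexx _).
rewrite mulr0 expr0n/= mulr0 subr0 /hsrc /psi_mean => H1 H2; move: P0 Pg H1 H2.
by lra.
Qed.

Let step_le T T' x : good T -> good T' -> (forall x, T x <= T' x) ->
  step T x <= step T' x.
Proof.
move=> gT gT' TT'; apply: helmholtz_le => //.
- exact: continuous_hsrc.
- exact: continuous_hsrc.
- by move=> y; exact: hsrc_le.
- exact: fold_bounds.
Qed.

Let step_lipschitz T x y : good T -> `|step T x - step T y| <= L * `|x - y|.
Proof.
move=> gT; have c1 := continuous_hsrc gT.
suff H u v : 0 <= u -> u <= v -> v <= B ->
    `|helmholtz B k T_b (hsrc T) v - helmholtz B k T_b (hsrc T) u| <= L * (v - u).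
  apply: (@le_trans _ _ (L * `|fold B x - fold B y|)); last first.
    by rewrite ler_wpM2l// fold_lipschitz.
  wlog xy : x y / fold B x <= fold B y => [W|].
    have [/W//|/ltW/W] := leP (fold B x) (fold B y).
    by rewrite distrC [X in _ * X]distrC.
  rewrite distrC [X in _ * X]distrC [X in _ * X]ger0_norm ?subr_ge0//.
  by have := fold_bounds B_gt0 x; have := fold_bounds B_gt0 y => /andP[? ?] /andP[? ?]; apply: H.
move=> u0 uv vB.
have [z /[!in_itv]/= /andP[uz zv] ->] := MVT_segment uv
    (fun y _ => is_derive_helmholtz B k T_b c1 y)
    (continuous_subspaceT (fun y => is_derive_continuous (is_derive_helmholtz B k T_b c1 y))).
rewrite normrM [X in _ * X]ger0_norm ?subr_ge0// ler_wpM2r ?subr_ge0//.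
apply: dhelmholtz_norm_le => //; first by move=> a; exact: hsrc_bounds.
by rewrite (le_trans u0 uz) (le_trans zv vB).
Qed.

(** The constant [L] is one that every [step T] has, so applying [step] does not leave the class,
    and a pointwise supremum of [L]-Lipschitz functions is again [L]-Lipschitz. *)
Let subsolution T : Prop :=
  [/\ forall x y, `|T x - T y| <= L * `|x - y|, forall x, 0 <= T x <= gamma
    & forall x, T x <= step T x].

Let subsolution_good T : subsolution T -> good T.
Proof. by move=> [/lipschitz_continuous cT bT _]. Qed.

Let step_good T : good T -> good (step T).
Proof.
move=> gT; split; first exact: (lipschitz_continuous (fun x y => step_lipschitz x y gT)).
move=> x; apply: helmholtz_bounds => //; last exact: fold_bounds.
  exact: continuous_hsrc.
by move=> y; exact: hsrc_bounds.
Qed.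

Let perron x : R := sup [set T x | T in subsolution].

Let subsolution0 : subsolution (cst 0).
Proof.
have g0 : good (cst 0).
  by split; [move=> x; exact: cvg_cst|move=> x; rewrite lexx/= ltW].
split.
- by move=> x y; rewrite subrr normr0 mulr_ge0.
- by move=> x; rewrite lexx/= ltW.
- by move=> x; have /andP[] := proj2 (step_good g0) x.
Qed.

Let perron_ub T x : subsolution T -> T x <= perron x.
Proof.
move=> sT; apply: ub_le_sup; last by exists T.
by exists gamma => _ [U [_ bU _] <-]; have /andP[] := bU x.
Qed.

Let perron_le x c : (forall T, subsolution T -> T x <= c) -> perron x <= c.
Proof.
move=> H; apply: ge_sup; first by exists 0; exists (cst 0).
by move=> _ [T sT <-]; exact: H.
Qed.

Let perron_lipschitz x y : `|perron x - perron y| <= L * `|x - y|.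
Proof.
suff H u v : perron u <= perron v + L * `|u - v|.
  rewrite ler_norml; have := H x y; have := H y x; rewrite [`|y - x|]distrC; lra.
apply: perron_le => T sT; have := perron_ub v sT; case: sT => LT _ _.
by have := LT u v; rewrite ler_norml => /andP[_]; lra.
Qed.

Let perron_good : good perron.
Proof.
split; first exact: lipschitz_continuous perron_lipschitz.
move=> x; rewrite (perron_ub x subsolution0)/=.
by apply: perron_le => T [_ bT _]; have /andP[] := bT x.
Qed.

(* Knaster-Tarski: the largest Lipschitz subsolution is a fixed point of the
   monotone map [step]. *)
Let perron_fix x : perron x = step perron x.
Proof.
have le1 y : perron y <= step perron y.
  apply: perron_le => T sT; have [_ _ TS] := sT.
  apply: le_trans (TS y) (step_le y (subsolution_good sT) perron_good _) => z.
  exact: perron_ub.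
apply/eqP; rewrite eq_le le1/=; apply: (@perron_ub (step perron)); split.
- by move=> u v; exact: step_lipschitz perron_good.
- exact: (proj2 (step_good perron_good)).
- by move=> y; exact: step_le perron_good (step_good perron_good) le1.
Qed.

Lemma milne_existence :
  exists W dW ddW : R -> R, milne_profile B T_b gamma b W dW ddW.
Proof.
have gP := perron_good; have c1 := continuous_hsrc gP.
(* The fixed point is this function composed with [fold], which may have corners at 0 and [2 B].
   Dropping the outer [fold] keeps the values on the doubled slab and gives a C^2 function on the
   line. *)
pose W := helmholtz B k T_b (hsrc perron).
have dWP x := is_derive_helmholtz B k T_b c1 x.
have W_even x : W (2 * B - x) = W x.
  by apply: helmholtz_reflect => // y; exact: hsrc_reflect.
have WP x : 0 <= x <= 2 * B -> W x = perron x.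
  by move=> xB; rewrite -(fold_even_id W_even xB) perron_fix.
have WPf x : W (fold B x) = perron (fold B x).
  by apply: WP; exact: fold_double.
exists W, (dhelmholtz B k T_b (hsrc perron)), (fun x => k ^+ 2 * W x - hsrc perron x).
split.
- exact: dWP.
- by move=> x; exact: is_derive_dhelmholtz.
- move=> x; apply: cvgB; last exact: c1.
  by apply: cvgM; [exact: cvg_cst|exact: is_derive_continuous (dWP x)].
- exact: W_even.
- exact: helmholtz0.
- exact: dhelmholtzB.
- by move=> x xB; rewrite WP//; exact: (proj2 gP).
move=> x xB; have x2B : 0 <= x <= 2 * B by have := B_gt0; lra.
suff PE : angular_mean (rte_psi B b (src perron) x)
    = angular_mean (rte_psi B b (fun y => W y ^+ 4) x).
  by rewrite /hsrc /psi_mean (fold_id xB) -(WP x x2B) PE; ring.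
congr angular_mean; apply/funext => m; have [cs es _] := admissible_src gP.
apply: rte_psi_ext => //.
- by move=> y; exact: (continuous_comp (is_derive_continuous (dWP y))
    (@exprn_continuous R 4 _)).
- by move=> y; rewrite W_even.
- by move=> y yB; rewrite /src -WPf fold_even_id.
Qed.

End milne_fixpoint.

(** * Derivatives relative to a set *)

Section deriv_in.
Context {R : realType}.
Implicit Types (D : set R) (f g : R -> R) (a b c d e x y l : R).

Lemma cvg_dnbhs_withinP D f x l :
  (f y @[y --> within D x^'] --> l) <->
  (forall e, 0 < e -> exists2 d : R, 0 < d &
     forall y, D y -> y != x -> `|y - x| < d -> `|f y - l| <= e).
Proof.
split=> [/cvgrPdist_le H e e0|H].
  have [d /= d0 Hd] := H e e0; exists d => // y Dy yx yd.
  by rewrite distrC; apply: Hd => //; rewrite /ball_/= distrC.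
apply/cvgrPdist_le => e e0; have [d d0 Hd] := H e e0.
exists d => // y /= yd yx Dy; rewrite distrC; apply: Hd => //.
by rewrite distrC.
Qed.

Definition diff_quotient f x y : R := (f y - f x) / (y - x).

Lemma is_deriveP f x l : is_derive x (1 : R) f l <->
  (diff_quotient f x y @[y --> within setT x^'] --> l).
Proof.
split=> [[df dfl]|/cvg_dnbhs_withinP H].
  apply/cvg_dnbhs_withinP => e e0.
  have : h^-1 *: (f (h *: 1 + x) - f x) @[h --> 0^'] --> l.
    by rewrite -dfl; exact: df.
  move=> /cvgrPdist_le /(_ e e0)[d /= d0 Hd]; exists d => // y _ yx yd.
  have := Hd (y - x); rewrite /ball_/= sub0r normrN subr_eq0 => /(_ yd yx).
  by rewrite /GRing.scale/= mulr1 subrK mulrC distrC.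
have C : h^-1 *: (f (h *: 1 + x) - f x) @[h --> 0^'] --> l.
  apply/cvgrPdist_le => e /H[d d0 Hd]; exists d => // h /=.
  rewrite sub0r normrN => hd h0.
  have := Hd (h + x) I; rewrite /diff_quotient addrK => /(_ _ hd).
  rewrite -subr_eq0 addrK h0 => /(_ isT).
  by rewrite /GRing.scale/= mulr1 mulrC distrC.
apply: DeriveDef; first by apply/cvg_ex; exists l.
exact: (cvg_lim _ C).
Qed.

(** Limits along this filter are unique only if [x] is an accumulation point of [D]. An open
    interval inside [D] whose closure contains [x] is enough, which covers the end points of the
    slab. *)
Lemma dnbhs_within_proper D c d x : c < d -> c <= x <= d -> `]c, d[ `<=` D ->
  ProperFilter (within D x^').
Proof.
move=> cd /andP[cx xd] cdD; apply: Build_ProperFilter_ex => P [e /= e0 He].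
have [xd'|dx] := ltP x d.
  have [m1 m2] : Num.min (x + e / 2) ((x + d) / 2) <= x + e / 2
      /\ Num.min (x + e / 2) ((x + d) / 2) <= (x + d) / 2.
    by rewrite !ge_min !lexx orbT.
  have m3 : x < Num.min (x + e / 2) ((x + d) / 2) by rewrite lt_min; lra.
  exists (Num.min (x + e / 2) ((x + d) / 2)); apply: He.
  - by rewrite /= distrC ger0_norm; lra.
  - by rewrite gt_eqF.
  - by apply: cdD; rewrite /= in_itv/=; lra.
have [m1 m2] : x - e / 2 <= Num.max (x - e / 2) ((c + x) / 2)
    /\ (c + x) / 2 <= Num.max (x - e / 2) ((c + x) / 2).
  by rewrite !le_max !lexx orbT.
have m3 : Num.max (x - e / 2) ((c + x) / 2) < x by rewrite gt_max; lra.
exists (Num.max (x - e / 2) ((c + x) / 2)); apply: He.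
- by rewrite /= ger0_norm; lra.
- by rewrite lt_eqF.
- by apply: cdD; rewrite /= in_itv/=; lra.
Qed.

Lemma deriv_inE D f c d x l : c < d -> c <= x <= d -> `]c, d[ `<=` D ->
  (diff_quotient f x y @[y --> within D x^'] --> l) ->
  derivable_in D f x /\ deriv_in D f x = l.
Proof.
move=> cd xcd cdD H; have PF := dnbhs_within_proper cd xcd cdD.
by split; [apply/cvg_ex; exists l|exact: cvg_lim].
Qed.

Lemma derivable_in_cvg D f x : derivable_in D f x ->
  diff_quotient f x y @[y --> within D x^'] --> deriv_in D f x.
Proof. by []. Qed.

Lemma diff_quotient_subset D D' f x l : D `<=` D' ->
  (diff_quotient f x y @[y --> within D' x^'] --> l) ->
  (diff_quotient f x y @[y --> within D x^'] --> l).
Proof.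
move=> DD' /cvg_dnbhs_withinP H; apply/cvg_dnbhs_withinP => e /H[d d0 Hd].
by exists d => // y /DD' Dy; exact: Hd.
Qed.

Lemma is_derive_deriv_in D f c d x l : c < d -> c <= x <= d -> `]c, d[ `<=` D ->
  is_derive x (1 : R) f l -> derivable_in D f x /\ deriv_in D f x = l.
Proof.
move=> cd xcd cdD /is_deriveP H; apply: (deriv_inE cd xcd cdD).
by apply: diff_quotient_subset H => ? _.
Qed.

Lemma deriv_in_is_derive D f c d x : c < x < d -> `]c, d[ `<=` D ->
  derivable_in D f x -> is_derive x (1 : R) f (deriv_in D f x).
Proof.
move=> /andP[cx xd] cdD /derivable_in_cvg/cvg_dnbhs_withinP H.
apply/is_deriveP/cvg_dnbhs_withinP => e /H[r r0 Hr].
exists (Num.min r (Num.min (x - c) (d - x))) => [|y _ yx].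
  by rewrite !lt_min r0/=; lra.
rewrite !lt_min => /andP[yr]; rewrite !ltr_norml => ycd.
by apply: Hr => //; apply: cdD; rewrite /= in_itv/=; lra.
Qed.

Lemma within_continuousP D f : {within D, continuous f} <->
  (forall x, D x -> forall e, 0 < e -> exists2 d : R, 0 < d &
     forall y, D y -> `|y - x| < d -> `|f y - f x| <= e).
Proof.
split=> [/subspace_continuousP H x Dx e e0|H].
  have /cvgrPdist_le/(_ e e0)[d /= d0 Hd] := H x Dx; exists d => // y Dy yd.
  by rewrite distrC; apply: Hd => //; rewrite /ball_/= distrC.
apply/subspace_continuousP => x Dx; apply/cvgrPdist_le => e /(H x Dx)[d d0 Hd].
exists d => // y /= yd Dy; rewrite distrC; apply: Hd => //.
by rewrite distrC.
Qed.

Lemma derivable_in_continuous D f : (forall x, D x -> derivable_in D f x) ->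
  {within D, continuous f}.
Proof.
move=> df; apply/within_continuousP => x Dx e e0.
have /derivable_in_cvg/cvg_dnbhs_withinP/(_ 1 ltr01)[r r0 Hr] := df x Dx.
pose K := `|deriv_in D f x| + 1.
have K0 : 0 < K by rewrite ltr_wpDl.
exists (Num.min r (e / K)) => [|y Dy]; first by rewrite lt_min r0 divr_gt0.
rewrite lt_min => /andP[yr ye].
have [->|yx] := eqVneq y x; first by rewrite subrr normr0 ltW.
have H := Hr y Dy yx yr.
have qK : `|diff_quotient f x y| <= K.
  by have := ler_normD (diff_quotient f x y - deriv_in D f x) (deriv_in D f x);
    rewrite subrK /K; lra.
have -> : f y - f x = diff_quotient f x y * (y - x).
  by rewrite /diff_quotient divfK// subr_eq0.
rewrite normrM (le_trans (ler_wpM2r _ qK))//.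
by rewrite mulrC -ler_pdivlMr// ltW.
Qed.

Lemma within_continuous_eq D f g : {in D, f =1 g} ->
  {within D, continuous f} -> {within D, continuous g}.
Proof.
move=> fg /within_continuousP H; apply/within_continuousP => x Dx e /(H x Dx)[d d0 Hd].
exists d => // y Dy yd; rewrite -!fg ?inE//; exact: Hd.
Qed.

Lemma deriv_in_itv a b f x l : a < b -> a <= x <= b -> is_derive x (1 : R) f l ->
  derivable_in `[a, b] f x /\ deriv_in `[a, b] f x = l.
Proof.
by move=> ab xab; apply: is_derive_deriv_in ab xab _; exact: subset_itv_oo_cc.
Qed.

Lemma C1_on_itv a b f (df : R -> R) : a < b ->
  (forall x, a <= x <= b -> is_derive x (1 : R) f (df x)) ->
  {within `[a, b], continuous df} -> C1_on `[a, b] f.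
Proof.
move=> ab Hf cdf; split.
  by move=> x; rewrite /= in_itv/= => xab; exact: proj1 (deriv_in_itv ab xab (Hf x xab)).
apply: within_continuous_eq cdf => x; rewrite inE/= in_itv/= => xab.
by rewrite (proj2 (deriv_in_itv ab xab (Hf x xab))).
Qed.

Lemma deriv_in_eq D f g x : D x -> {in D, f =1 g} -> deriv_in D f x = deriv_in D g x.
Proof.
move=> Dx fg; rewrite /deriv_in; congr (lim _); apply/funext => P; apply/propext.
split=> -[d /= d0 Hd]; exists d => // y yd yx Dy /=.
  by rewrite -!fg ?inE//; exact: Hd.
by rewrite !fg ?inE//; exact: Hd.
Qed.

Lemma derivable_in_eq D f g x : D x -> {in D, f =1 g} ->
  derivable_in D f x -> derivable_in D g x.
Proof.
move=> Dx fg /derivable_in_cvg/cvg_dnbhs_withinP H.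
apply/cvg_ex; exists (deriv_in D f x); apply/cvg_dnbhs_withinP => e /H[d d0 Hd].
by exists d => // y Dy yx yd; rewrite -!fg ?inE//; exact: Hd.
Qed.

End deriv_in.

Lemma cvg_exprn {R : realType} (f : R -> R) n x :
  {for x, continuous f} -> {for x, continuous (fun x => f x ^+ n)}.
Proof.
by move=> cf; exact: (@continuous_comp _ _ _ f (fun y => y ^+ n) _ cf (@exprn_continuous R n _)).
Qed.

(** * The energy inequality *)

Section milne_energy.
Context {R : realType}.
Variables (B T_b gamma : R) (b W dW ddW : R -> R).
Hypotheses (B_gt0 : 0 < B) (gamma_gt0 : 0 < gamma)
  (b_meas : measurable_fun (`]0, 1]%classic : set R) b)
  (b_bound : forall m, 0 < m <= 1 -> 0 <= b m <= gamma ^+ 4).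
Hypothesis HW : milne_profile B T_b gamma b W dW ddW.
Implicit Types (x y m e M : R).
Local Notation I := (`[(-1 : R), 1]%classic).
Local Notation mu := (@lebesgue_measure R).
Let f x : R := W x ^+ 4.
Let df x : R := 4 * W x ^+ 3 * dW x.
Let psi := rte_psi B b f.
Local Notation fold := (fold B).

Let W_deriv := profile_deriv HW.
Let dW_deriv := profile_deriv2 HW.
Let W_even := profile_even HW.
Let W_bound := profile_bound HW.

Let W_cont : continuous W.
Proof. by move=> x; exact: is_derive_continuous (W_deriv x). Qed.

Let dW_cont : continuous dW.
Proof. by move=> x; exact: is_derive_continuous (dW_deriv x). Qed.

Lemma source_deriv x : is_derive x (1 : R) f (df x).
Proof.
have H := W_deriv x.
apply: (@is_derive_eq _ _ _ (W ^+ 4)).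
by rewrite /df /GRing.scale/=; ring.
Qed.

Let f_cont : continuous f.
Proof. by move=> x; exact: is_derive_continuous (source_deriv x). Qed.

Let f_even x : f (2 * B - x) = f x.
Proof. by rewrite /f W_even. Qed.

Lemma milne_source_admissible : admissible_source B gamma f.
Proof.
split; [exact: f_cont|exact: f_even|] => x xB.
have /andP[w0 wg] := W_bound xB.
by rewrite exprn_ge0//= lerXn2r// nnegrE// ltW.
Qed.

Let psi_bounds x m : 0 <= x <= 2 * B -> -1 <= m <= 1 -> 0 <= psi x m <= gamma ^+ 4.
Proof. exact: admissible_rte_psi_bounds b_bound _ _ _ milne_source_admissible. Qed.

Let psi_diff x m : 0 <= x <= 2 * B -> -1 <= m <= 1 -> `|psi x m - f x| <= gamma ^+ 4.
Proof.
move=> xB mI; have [_ _ fb] := milne_source_admissible.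
by rewrite ler_norml; have := psi_bounds xB mI; have := fb x xB; lra.
Qed.

Let meas_psi x : 0 <= x <= 2 * B -> measurable_fun I (psi x).
Proof. by move=> xB; exact: measurable_rte_psi. Qed.

Let meas_diff x : 0 <= x <= 2 * B -> measurable_fun I (fun m => psi x m - f x).
Proof. by move=> xB; apply: measurable_funB => //; exact: meas_psi. Qed.

Let meas_sqr x : 0 <= x <= 2 * B -> measurable_fun I (fun m => (psi x m - f x) ^+ 2).
Proof. by move=> xB; apply: measurable_funX; exact: meas_diff. Qed.

Let meas_msqr x : 0 <= x <= 2 * B ->
  measurable_fun I (fun m => m * (psi x m - f x) ^+ 2).
Proof. by move=> xB; apply: measurable_funM => //; exact: meas_sqr. Qed.

Let sqr_bound x m : 0 <= x <= 2 * B -> -1 <= m <= 1 ->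
  `|(psi x m - f x) ^+ 2| <= gamma ^+ 4 ^+ 2.
Proof.
by move=> xB mI; rewrite normrX lerXn2r ?nnegrE ?exprn_ge0 ?(ltW gamma_gt0)// psi_diff.
Qed.

Let msqr_bound x m : 0 <= x <= 2 * B -> -1 <= m <= 1 ->
  `|m * (psi x m - f x) ^+ 2| <= gamma ^+ 4 ^+ 2.
Proof.
move=> xB mI; rewrite normrM -[leRHS]mul1r ler_pM//.
  by rewrite ler_norml.
exact: sqr_bound.
Qed.

Lemma integrable_defect x : 0 <= x <= 2 * B ->
  mu.-integrable I (EFin \o (fun m => (psi x m - f x) ^+ 2)).
Proof.
by move=> xB; apply: bounded_integrable_itv (meas_sqr xB) (fun m => sqr_bound xB).
Qed.

Lemma integrable_flux x : 0 <= x <= 2 * B ->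
  mu.-integrable I (EFin \o (fun m => m * (psi x m - f x) ^+ 2)).
Proof.
by move=> xB; apply: bounded_integrable_itv (meas_msqr xB) (fun m => msqr_bound xB).
Qed.

Let int_mpsi x : 0 <= x <= 2 * B -> mu.-integrable I (EFin \o (fun m => m * psi x m)).
Proof. exact: integrable_mul_rte_psi b_meas b_bound _ _ milne_source_admissible. Qed.

(** Both sides have derivative [ddW] and vanish at [B], the left one by parity in [m], the right one
    by the Neumann condition. The flux has a two-sided derivative only inside the doubled slab,
    hence [0 < x]. *)
Lemma milne_flux x : 0 < x <= B -> angular_mean (fun m => m * psi x m) = dW x.
Proof.
move=> /andP[x0 xB]; pose F := rte_flux B b f.
have HF y : x <= y <= B -> is_derive y (1 : R) F (ddW y).
  move=> /andP[xy yB]; rewrite (profile_eq HW); last by rewrite yB (le_trans (ltW x0)).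
  apply: (is_derive_rte_flux b_meas b_bound milne_source_admissible).
  by have := B_gt0; lra.
pose G := F - dW.
have HG y : x <= y <= B -> is_derive y (1 : R) G 0.
  by move=> /HF H; rewrite -(subrr (ddW y)); exact: is_deriveB.
have cG : {within `[x, B], continuous G}.
  by apply: derivable_within_continuous => y; rewrite in_itv/= => /HG[].
have HG' y : x < y < B -> is_derive y (1 : R) G (cst 0 y).
  by move=> /andP[? ?]; apply: HG; rewrite !ltW.
have FB : F B = 0 := rte_fluxB B_gt0 b_meas b_bound milne_source_admissible.
have GB : G B = 0 by rewrite -[G B]/(F B - dW B) FB (profile_right HW) subrr.
suff : G x = 0 by rewrite -[G x]/(F x - dW x) => /eqP; rewrite subr_eq0 => /eqP.
apply/eqP; rewrite -GB eq_le.
apply/andP; split.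
  by apply: (ndecr_itv HG' (fun _ _ => lexx _) cG).
by apply: (nincr_itv HG' (fun _ _ => lexx _) cG).
Qed.

Let J x : R := angular_mean (fun m => m * (psi x m - f x) ^+ 2).
Let D x : R := angular_mean (fun m => (psi x m - f x) ^+ 2).

Let msqr_deriv x m : is_derive x (1 : R) (fun y => m * (psi y m - f y) ^+ 2)
  (-2 * (psi x m - f x) ^+ 2 - 2 * df x * (m * (psi x m - f x))).
Proof.
have [->|m0] := eqVneq m 0.
  rewrite /psi rte_psi0; under eq_fun do rewrite mul0r.
  by apply: (@is_derive_eq _ _ _ (cst 0)); ring.
have H1 := is_derive_rte_psi b f_cont f_even x m0; have H2 := source_deriv x.
apply: (@is_derive_eq _ _ _ (m *: ((psi ^~ m - f) ^+ 2))).
by rewrite -/psi /GRing.scale/= -[(_ - f) x]/(psi x m - f x); field.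
Qed.

Let df_bounded : exists M : R, forall x, 0 <= x <= 2 * B -> `|df x| <= M.
Proof.
apply: continuous_itv_bounded; apply: continuous_subspaceT => x.
apply: cvgM; last exact: dW_cont.
apply: cvgM; [exact: cvg_cst|exact: (@cvg_exprn _ _ 3 x (@W_cont x))].
Qed.

Let J_deriv x : 0 < x <= B -> is_derive x (1 : R) J (-2 * (D x + df x * dW x)).
Proof.
move=> xB; have [M HM] := df_bounded.
have x2B : 0 < x < 2 * B by have := B_gt0; lra.
have xB' : 0 <= x <= 2 * B by lra.
have imd : mu.-integrable I (EFin \o (fun m => m * (psi x m - f x))).
  apply: (@bounded_integrable_itv _ _ _ _ (gamma ^+ 4)).
    by apply: measurable_funM => //; exact: meas_diff.
  move=> m mI; rewrite normrM -[leRHS]mul1r ler_pM//; first by rewrite ler_norml.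
  exact: psi_diff.
have -> : -2 * (D x + df x * dW x)
    = angular_mean (fun m => -2 * (psi x m - f x) ^+ 2 - 2 * df x * (m * (psi x m - f x))).
  rewrite -milne_flux// /angular_mean RintegralB//=; last 2 first.
  - rewrite (_ : _ \o _ = (fun m => (-2)%:E * ((psi x m - f x) ^+ 2)%:E)%E)//.
    by apply: integrableZl => //; exact: integrable_defect.
  - rewrite (_ : _ \o _ = (fun m => (2 * df x)%:E * (m * (psi x m - f x))%:E)%E)//.
    exact: integrableZl.
  rewrite !RintegralZl//; last exact: integrable_defect.
  (* The part [f x * m] is odd in [m], so the first moment of [psi - f] is that of [psi], which is
     [dW x]. *)
  have -> : \int[mu]_(m in I) (m * (psi x m - f x)) = \int[mu]_(m in I) (m * psi x m).
    have iid : mu.-integrable I (EFin \o (fun m : R => f x * m)).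
      apply: continuous_integrable_itv => m.
      by apply: cvgM; [exact: cvg_cst|exact: cvg_id].
    have := @angular_mean_odd _ (fun m => f x * m) iid.
    rewrite /angular_mean => E; rewrite -[RHS]subr0 -[X in _ = _ - X]E.
      rewrite -RintegralB//; last exact: int_mpsi.
      by apply: eq_Rintegral => m _; ring.
    by move=> m _; rewrite mulrN.
  by rewrite /D /angular_mean; ring.
apply: (@is_derive_angular_mean _ (fun x m => m * (psi x m - f x) ^+ 2)
  (fun x m => -2 * (psi x m - f x) ^+ 2 - 2 * df x * (m * (psi x m - f x)))
  (2 * gamma ^+ 4 ^+ 2 + 2 * M * gamma ^+ 4) 0 (2 * B)) => //.
- by move=> z zB; apply: integrable_flux; lra.
- move=> z m zB mI; have zB' : 0 <= z <= 2 * B by lra.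
  have tri (s a t : R) : `|-2 * s - 2 * a * t| <= 2 * `|s| + 2 * (`|a| * `|t|).
    apply: le_trans (ler_normB _ _) _.
    by rewrite !normrM normrN (@ger0_norm _ 2)// mulrA.
  apply: le_trans (tri _ _ _) _; rewrite -[2 * M * _]mulrA.
  have dz := psi_diff zB' mI; apply: lerD; rewrite ler_pM2l//; first exact: sqr_bound.
  rewrite ler_pM//; first exact: HM.
  by rewrite normrM -[leRHS]mul1r ler_pM// ler_norml.
Qed.

Let J_cont : continuous (fun x => J (fold x)).
Proof.
apply: (@continuous_angular_mean _ (fun x m => m * (psi (fold x) m - f (fold x)) ^+ 2)
  (gamma ^+ 4 ^+ 2)).
- by move=> x; apply: meas_msqr; exact: fold_double.
- by move=> x m; apply: msqr_bound; exact: fold_double.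
move=> m _ x; apply: cvgM; first exact: cvg_cst.
have cp : {for x, continuous (fun x => psi (fold x) m - f (fold x))}.
  apply: cvgB.
    apply: (@continuous_comp _ _ _ fold (psi ^~ m)); first exact: continuous_fold.
    exact: continuous_rte_psi.
  apply: (@continuous_comp _ _ _ fold f); first exact: continuous_fold.
  exact: f_cont.
exact: (@cvg_exprn _ _ 2 x cp).
Qed.

Let D_cont : continuous (fun x => D (fold x)).
Proof.
apply: (@continuous_angular_mean _ (fun x m => (psi (fold x) m - f (fold x)) ^+ 2)
  (gamma ^+ 4 ^+ 2)).
- by move=> x; apply: meas_sqr; exact: fold_double.
- by move=> x m; apply: sqr_bound; exact: fold_double.
move=> m _ x.
have cp : {for x, continuous (fun x => psi (fold x) m - f (fold x))}.
  apply: cvgB.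
    apply: (@continuous_comp _ _ _ fold (psi ^~ m)); first exact: continuous_fold.
    exact: continuous_rte_psi.
  apply: (@continuous_comp _ _ _ fold f); first exact: continuous_fold.
  exact: f_cont.
exact: (@cvg_exprn _ _ 2 x cp).
Qed.

Let J_within : {within `[0, B], continuous J}.
Proof.
apply: (@within_continuous_eq _ _ (fun x => J (fold x))).
  by move=> x; rewrite inE/= in_itv/= => xB; rewrite fold_id.
exact: continuous_subspaceT J_cont.
Qed.

Let JB : J B = 0.
Proof.
apply: angular_mean_odd; first by apply: integrable_flux; have := B_gt0; lra.
by move=> m _; rewrite /psi rte_psi_right// mulNr.
Qed.

Let D_ge0 x : 0 <= D x.
Proof. by apply: Rintegral_ge0 => m _; exact: sqr_ge0. Qed.

Let W_ge0 x : 0 <= x <= B -> 0 <= W x.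
Proof.
move=> xB; have x2B : 0 <= x <= 2 * B by have := B_gt0; lra.
by have /andP[] := W_bound x2B.
Qed.

Lemma milne_flux_ge0 x : 0 <= x <= B ->
  0 <= angular_mean (fun m => m * (psi x m - f x) ^+ 2).
Proof.
move=> /andP[x0 xB]; rewrite -/(J x) -JB.
apply: (@nincr_itv _ J (fun x => -2 * (D x + df x * dW x)) 0 B _ _ J_within) => //.
  by move=> y /andP[y0 yB]; apply: J_deriv; rewrite y0 ltW.
move=> y /andP[y0 yB]; have w0 : 0 <= W y by apply: W_ge0; rewrite !ltW.
have : 0 <= D y + df y * dW y; last by lra.
rewrite addr_ge0// /df -mulrA -expr2 mulr_ge0// ?sqr_ge0// mulr_ge0//.
exact: exprn_ge0.
Qed.

Lemma milne_energy alpha : 0 <= alpha < 1 ->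
  \int[mu]_(x in `[0, B]) (expR (2 * alpha * x) * (4 * W x ^+ 3 * dW x ^+ 2))
  + (1 - alpha) * \int[mu]_(x in `[0, B]) (expR (2 * alpha * x)
      * angular_mean (fun m => (psi x m - f x) ^+ 2))
  <= 2^-1 * angular_mean (fun m => m * (psi 0 m - f 0) ^+ 2).
Proof.
move=> /andP[a0 a1]; pose E x := expR (2 * alpha * x).
pose Z1 x := E x * (4 * W x ^+ 3 * dW x ^+ 2).
pose Z2 x := E x * D (fold x).
have E_cont : continuous E by exact: continuous_expR_scale.
have Z1_cont : continuous Z1.
  move=> x; apply: cvgM; first exact: E_cont.
  apply: cvgM; last exact: (@cvg_exprn _ _ 2 x (@dW_cont x)).
  by apply: cvgM; [exact: cvg_cst|exact: (@cvg_exprn _ _ 3 x (@W_cont x))].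
have Z2_cont : continuous Z2.
  by move=> x; apply: cvgM; [exact: E_cont|exact: D_cont].
have cZ : continuous (fun x => Z1 x + (1 - alpha) * Z2 x).
  move=> x; apply: cvgD; first exact: Z1_cont.
  by apply: cvgM; [exact: cvg_cst|exact: Z2_cont].
pose P := prim (fun x => Z1 x + (1 - alpha) * Z2 x).
(* [Q' = 2 alpha E (J - D)], and [J <= D] because [m <= 1], so [Q] is nonincreasing. As [J B = 0]
   and [P 0 = 0], the inequality [Q B <= Q 0] is the claim. *)
pose Q := (fun x => E x * J x) + 2 *: P.
have PB : P B = \int[mu]_(x in `[0, B]) (E x * (4 * W x ^+ 3 * dW x ^+ 2))
  + (1 - alpha) * \int[mu]_(x in `[0, B]) (E x * D x).
  rewrite /P (@primE _ _ 0)//; last exact: ltW.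
  rewrite set_itv1 Rintegral_set1 subr0.
  have EZ2 : \int[mu]_(x in `[0, B]) (E x * D x) = \int[mu]_(x in `[0, B]) Z2 x.
    apply: eq_Rintegral => x; rewrite inE/= in_itv/= => xB.
    by rewrite /Z2 fold_id.
  have cZ2' : continuous (fun x => (1 - alpha) * Z2 x).
    by move=> x; apply: cvgM; [exact: cvg_cst|exact: Z2_cont].
  rewrite EZ2 -RintegralZl; [|by []|exact: continuous_integrable_itv].
  rewrite -RintegralD; [by []|by []|exact: continuous_integrable_itv|].
  exact: continuous_integrable_itv.
rewrite -/(J 0); suff : Q B <= Q 0.
  rewrite -[Q B]/(E B * J B + 2 * P B) -[Q 0]/(E 0 * J 0 + 2 * P 0).
  have P0 : P 0 = 0 by exact: prim0.
  have E0 : E 0 = 1 by rewrite /E mulr0 expR0.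
  rewrite P0 E0 JB [in X in _ -> X](_ : _ + _ = P B); last by rewrite PB.
  by lra.
have Q_deriv x : 0 < x < B -> is_derive x (1 : R) Q (2 * alpha * E x * (J x - D x)).
  move=> /andP[x0 xB]; have H1 : is_derive x (1 : R) J (-2 * (D x + df x * dW x)).
    by apply: J_deriv; rewrite x0 ltW.
  have H2 := is_derive_weight (2 * alpha) H1; have H3 := is_derive_prim x cZ.
  have H4 : is_derive x (1 : R) (2 *: P) (2 *: (Z1 x + (1 - alpha) * Z2 x)).
    exact: is_deriveZ.
  apply: (is_derive_eq (is_deriveD H2 H4)).
  rewrite /Z1 /Z2 fold_id ?(ltW x0) ?(ltW xB)// -/(E x) /df /GRing.scale/=; ring.
apply: (@nincr_itv _ Q _ 0 B Q_deriv) => //; last exact: ltW.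
  move=> x /andP[x0 xB]; have x2B : 0 <= x <= 2 * B by have := B_gt0; lra.
  apply: mulr_ge0_le0; first by rewrite !mulr_ge0// expR_ge0.
  rewrite subr_le0; apply: le_Rintegral => //; [exact: integrable_flux|exact: integrable_defect|].
  move=> m; rewrite /= in_itv/= => /andP[_ m1].
  by rewrite -[leRHS]mul1r ler_wpM2r// sqr_ge0.
move=> x; apply: cvgD; first by apply: within_continuous_weight; exact: J_within.
apply: cvgM; first exact: cvg_cst.
apply: (@continuous_subspaceT _ _ _ P) => y.
exact: is_derive_continuous (is_derive_prim y cZ).
Qed.

End milne_energy.

Lemma C1_on_eq {R : realType} (D : set R) (f g : R -> R) :
  {in D, f =1 g} -> C1_on D f -> C1_on D g.
Proof.
move=> fg [df cf]; split.
  by move=> x Dx; exact: derivable_in_eq Dx fg (df x Dx).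
apply: within_continuous_eq cf => x; rewrite inE => Dx.
exact: deriv_in_eq.
Qed.

(** * From the scalar profile to a solution of the system *)

Section profile_solution.
Context {R : realType}.
Variables (B T_b gamma : R) (b W dW ddW : R -> R).
Hypotheses (B_gt0 : 0 < B) (gamma_gt0 : 0 < gamma)
  (b_meas : measurable_fun (`]0, 1]%classic : set R) b)
  (b_bound : forall m, 0 < m <= 1 -> 0 <= b m <= gamma ^+ 4).
Hypothesis HW : milne_profile B T_b gamma b W dW ddW.
Implicit Types (x y m e M : R).
Local Notation I := (`[(-1 : R), 1]%classic).
Local Notation mu := (@lebesgue_measure R).
Let f x : R := W x ^+ 4.
Let psi := rte_psi B b f.

Let f_deriv x : is_derive x (1 : R) f (4 * W x ^+ 3 * dW x).
Proof. exact: source_deriv HW x. Qed.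

Let f_cont : continuous f.
Proof. by move=> x; exact: is_derive_continuous (f_deriv x). Qed.

Let f_even x : f (2 * B - x) = f x.
Proof. by rewrite /f (profile_even HW). Qed.

Let dW_cont : continuous dW.
Proof. by move=> x; exact: is_derive_continuous (profile_deriv2 HW x). Qed.

Lemma profile_deriv_in x : 0 <= x <= B -> deriv_in `[0, B] W x = dW x.
Proof. by move=> xB; exact: (proj2 (deriv_in_itv B_gt0 xB (profile_deriv HW x))). Qed.

Lemma rte_psi_C1 m : C1_on `[0, B] (psi ^~ m).
Proof.
have [->|m0] := eqVneq m 0.
  apply: (@C1_on_eq _ _ f); first by move=> x _; rewrite /psi rte_psi0.
  apply: (C1_on_itv B_gt0 (fun x _ => f_deriv x)).
  apply: continuous_subspaceT => x; apply: cvgM; last exact: dW_cont.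
  apply: cvgM; first exact: cvg_cst.
  exact: cvg_exprn (is_derive_continuous (profile_deriv HW x)).
apply: (C1_on_itv B_gt0 (fun x _ => is_derive_rte_psi b f_cont f_even x m0)).
apply: continuous_subspaceT => x; apply: cvgM; last exact: cvg_cst.
by apply: cvgB; [exact: f_cont|exact: continuous_rte_psi].
Qed.

Lemma profile_milne_solution : milne_solution B T_b b W psi.
Proof.
have dW_in x : 0 <= x <= B -> dW x = deriv_in `[0, B] W x.
  by move=> /profile_deriv_in.
have dW_eq : {in `[0, B]%classic, dW =1 deriv_in `[0, B] W}.
  by move=> x; rewrite inE/= in_itv/=; exact: dW_in.
have B0 : 0 <= B <= B by rewrite lexx ltW.
split.
- split.
    by apply: (C1_on_itv B_gt0 (fun x _ => profile_deriv HW x)); exact: continuous_subspaceT.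
  apply: C1_on_eq dW_eq _.
  apply: (C1_on_itv B_gt0 (fun x _ => profile_deriv2 HW x)).
  exact: continuous_subspaceT (profile_cont2 HW).
- by move=> m _; exact: rte_psi_C1.
- move=> x; rewrite in_itv/= => xB.
  by apply: (integrable_rte_psi b_meas b_bound (milne_source_admissible gamma_gt0 HW));
     have := B_gt0; lra.
- move=> x; rewrite in_itv/= => xB; have x2B : 0 <= x <= 2 * B by have := B_gt0; lra.
  have -> : deriv_in `[0, B] (deriv_in `[0, B] W) x = ddW x.
    have Dx : `[0, B]%classic x by rewrite /= in_itv.
    rewrite -(deriv_in_eq Dx dW_eq).
    exact: (proj2 (deriv_in_itv B_gt0 xB (profile_deriv2 HW x))).
  rewrite (profile_eq HW xB).
  rewrite (angular_meanB_cst _ (integrable_rte_psi b_meas b_bound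
     (milne_source_admissible gamma_gt0 HW) x2B)).
  by ring.
- move=> x m; rewrite in_itv/= => xB _.
  have [->|m0] := eqVneq m 0; first by rewrite /psi rte_psi0 /f; ring.
  rewrite (proj2 (deriv_in_itv B_gt0 xB (is_derive_rte_psi b f_cont f_even x m0))).
  by rewrite -/psi /f; field.
- exact: profile_left HW.
- by rewrite -dW_in// (profile_right HW).
- by move=> m; rewrite in_itv/= => /andP[m0 _]; rewrite /psi rte_psi_left.
- by move=> m _; rewrite /psi rte_psi_right.
Qed.

Lemma angular_mean_split (h : R -> R) : mu.-integrable I (EFin \o h) ->
  angular_mean h = \int[mu]_(m in `[(-1)%R, 0]) h m + \int[mu]_(m in `]0, 1]) h m.
Proof.
move=> ih.
have I01 : I = (`[(-1 : R), 0] `|` `]0, 1])%classic.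
  apply/seteqP; split => m /=; rewrite !in_itv/=; last by case; lra.
  by move=> mI; have [m0|m0] := leP m 0; [left|right]; lra.
rewrite /angular_mean I01 Rintegral_setU//; first by rewrite -I01.
by apply/disj_set2P/seteqP; split=> m //= []; rewrite !in_itv/=; lra.
Qed.

(** At [x = 0] the flux splits into incoming directions, where [psi] is the datum [b], and outgoing
    ones, whose contribution is negative and moves to the left-hand side. *)
Lemma profile_energy alpha : 0 <= alpha < 1 ->
  \int[mu]_(x in `[0, B])
    (expR (2 * alpha * x) * (4 * W x ^+ 3) * `|deriv_in `[0, B] W x| ^+ 2)
  + (1 - alpha) * \int[mu]_(x in `[0, B])
      (\int[mu]_(m in `[(-1)%R, 1]) (expR (2 * alpha * x) * (psi x m - W x ^+ 4) ^+ 2))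
  + 2^-1 * \int[mu]_(m in `[(-1)%R, 0]) (`|m| * (psi 0 m - T_b ^+ 4) ^+ 2)
  <= 2^-1 * \int[mu]_(m in `]0, 1]) (m * (b m - T_b ^+ 4) ^+ 2).
Proof.
move=> a01.
have : \int[mu]_(x in `[0, B]) (expR (2 * alpha * x) * (4 * W x ^+ 3 * dW x ^+ 2))
  + (1 - alpha) * \int[mu]_(x in `[0, B]) (expR (2 * alpha * x)
      * angular_mean (fun m => (psi x m - f x) ^+ 2))
  <= 2^-1 * angular_mean (fun m => m * (psi 0 m - f 0) ^+ 2).
  exact (milne_energy B_gt0 gamma_gt0 b_meas b_bound HW a01).
have z2B : (0 : R) <= 0 <= 2 * B by have := B_gt0; lra.
have i0 : mu.-integrable I (EFin \o (fun m => m * (psi 0 m - f 0) ^+ 2)).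
  exact: (integrable_flux gamma_gt0 b_meas b_bound HW z2B).
rewrite (angular_mean_split i0).
have -> : \int[mu]_(m in `[(-1)%R, 0]) (`|m| * (psi 0 m - T_b ^+ 4) ^+ 2)
    = - \int[mu]_(m in `[(-1)%R, 0]) (m * (psi 0 m - f 0) ^+ 2).
  rewrite -[RHS]mulN1r -RintegralZl//; last first.
    apply: (integrableS _ _ _ i0) => //.
    by move=> m; rewrite /= !in_itv/=; lra.
  apply: eq_Rintegral => m; rewrite inE/= in_itv/= => /andP[_ m0].
  by rewrite /f (profile_left HW) ler0_norm//; ring.
have -> : \int[mu]_(m in `]0, 1]) (m * (psi 0 m - f 0) ^+ 2)
    = \int[mu]_(m in `]0, 1]) (m * (b m - T_b ^+ 4) ^+ 2).
  apply: eq_Rintegral => m; rewrite inE/= in_itv/= => /andP[m0 _].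
  by rewrite /psi rte_psi_left// /f (profile_left HW).
have -> : \int[mu]_(x in `[0, B])
    (expR (2 * alpha * x) * (4 * W x ^+ 3) * `|deriv_in `[0, B] W x| ^+ 2)
  = \int[mu]_(x in `[0, B]) (expR (2 * alpha * x) * (4 * W x ^+ 3 * dW x ^+ 2)).
  apply: eq_Rintegral => x; rewrite inE/= in_itv/= => xB.
  by rewrite profile_deriv_in// real_normK ?num_real//; ring.
have -> : \int[mu]_(x in `[0, B]) (\int[mu]_(m in `[(-1)%R, 1])
      (expR (2 * alpha * x) * (psi x m - W x ^+ 4) ^+ 2))
  = \int[mu]_(x in `[0, B]) (expR (2 * alpha * x)
      * angular_mean (fun m => (psi x m - f x) ^+ 2)).
  apply: eq_Rintegral => x; rewrite inE/= in_itv/= => xB.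
  rewrite /angular_mean RintegralZl//.
  by apply: (integrable_defect gamma_gt0 b_meas b_bound HW); have := B_gt0; lra.
lra.
Qed.

End profile_solution.

(** * Uniqueness by L^1 contraction *)

Lemma continuous_fold_within {R : realType} (B : R) (g : R -> R) : 0 < B ->
  {within `[0, B], continuous g} -> continuous (fun x => g (fold B x)).
Proof.
move=> B0 /within_continuousP cg x; apply/cvgrPdist_le => e e0.
have Dx y : `[0, B]%classic (fold B y) by rewrite /= in_itv/= fold_bounds.
have [d d0 Hd] := cg _ (Dx x) e e0; exists d => // y /= xy.
rewrite distrC; apply: Hd => //.
by rewrite distrC (le_lt_trans (fold_lipschitz _ _ _)).
Qed.

(** A nonnegative function with nonpositive mean vanishes almost everywhere, and the negative
    directions have positive measure. A single outgoing direction is all that uniqueness needs. *)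
Lemma angular_mean_le0_zero {R : realType} (g : R -> R) :
  (@lebesgue_measure R).-integrable `[-1, 1] (EFin \o g) ->
  (forall m : R, -1 <= m <= 1 -> 0 <= g m) -> angular_mean g <= 0 ->
  exists2 m : R, -1 <= m < 0 & g m = 0.
Proof.
move=> ig g0 gle; have mg : measurable_fun (`[-1, 1]%classic : set R) (EFin \o g).
  by case/integrableP : ig.
have g0' m : `[(-1 : R), 1]%classic m -> (0 <= (g m)%:E)%E.
  by rewrite /= in_itv/= lee_fin; exact: g0.
have I0 : (\int[@lebesgue_measure R]_(m in `[(-1)%R, 1%R]) `|(EFin \o g) m| = 0)%E.
  have -> : (\int[@lebesgue_measure R]_(m in `[(-1)%R, 1%R]) `|(EFin \o g) m|
      = \int[@lebesgue_measure R]_(m in `[(-1)%R, 1%R]) (g m)%:E)%E.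
    by apply: eq_integral => m; rewrite inE => mI; exact: gee0_abs (g0' _ mI).
  rewrite -[LHS]fineK; last exact: (integrable_fin_num _ ig).
  congr EFin; apply/eqP; rewrite eq_le gle/=.
  by apply: Rintegral_ge0 => m; rewrite /= in_itv/=; exact: g0.
have [A [mA A0 HA]] := (ae_eq_integral_abs (@lebesgue_measure R) (measurable_itv _) mg).1 I0.
apply: contrapT => H.
have sub : `[(-1 : R), 0[%classic `<=` A.
  move=> m mI; apply: HA => /= Hm; apply: H; exists m.
    by move: mI; rewrite /= in_itv/=.
  have mI1 : m \in `[-1, 1] by move: mI; rewrite /= !in_itv/=; lra.
  by case: (Hm mI1).
have : (lebesgue_measure `[(-1)%R : R, 0%R[%classic <= lebesgue_measure A)%E.
  by apply: le_measure; rewrite ?inE.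
rewrite A0 lebesgue_measure_itv/= lte_fin ifT; last lra.
by rewrite lee_fin; lra.
Qed.

Section smooth_sign.
Context {R : realType}.
Variable e : R.
Hypothesis e_gt0 : 0 < e.
Implicit Types (u q C : R).

(** This is [tanh (u / (2 e))], a smooth increasing approximation of the sign as [e] tends to 0. *)
Definition smooth_sign u : R := 1 - 2 * (expR (e^-1 * u) + 1)^-1.

Let t_gt0 u : 0 < expR (e^-1 * u). Proof. exact: expR_gt0. Qed.

Lemma is_derive_smooth_sign u : exists2 d, 0 <= d & is_derive u (1 : R) smooth_sign d.
Proof.
pose t x : R := expR (e^-1 * x) + 1.
have Ht : is_derive u (1 : R) t (e^-1 * expR (e^-1 * u)).
  have H := is_derive_expR_scale e^-1 u.
  apply: (@is_derive_eq _ _ _ ((fun y => expR (e^-1 * y)) + cst 1)).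
  by rewrite addr0.
have t0 : t u != 0 by rewrite gt_eqF// addr_gt0.
have HV := is_deriveV t0 Ht.
exists (0 - 2 * (- t u ^- 2 * (e^-1 * expR (e^-1 * u)))).
  rewrite sub0r mulNr mulrN opprK !mulr_ge0 ?invr_ge0 ?(ltW e_gt0) ?expR_ge0//.
  by rewrite exprn_ge0// addr_ge0 ?expR_ge0.
by apply: (@is_derive_eq _ _ _ (cst 1 - 2 *: (fun y => (t y)^-1))).
Qed.

Lemma smooth_sign0 : smooth_sign 0 = 0.
Proof. by rewrite /smooth_sign mulr0 expR0; field. Qed.

Lemma smooth_sign_norm_le u : `|smooth_sign u| <= 1.
Proof.
have V0 : 0 < (expR (e^-1 * u) + 1)^-1 by rewrite invr_gt0 addr_gt0.
have V1 : (expR (e^-1 * u) + 1)^-1 <= 1.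
  by rewrite invf_le1 ?addr_gt0//; have := t_gt0 u; lra.
by rewrite ler_norml /smooth_sign; lra.
Qed.

(** With [s = |u| / e] the error is [|q|] times [2 / (exp s + 1)], hence at most
    [2 C |u| / (exp s + 1)], and [s <= exp s] turns this into [2 C e]. *)
Lemma smooth_sign_approx u q C : 0 <= C -> `|q| <= C * `|u| -> 0 <= q * u ->
  `|q| - q * smooth_sign u <= 2 * C * e.
Proof.
move=> C0 qC qu; have t0 := t_gt0 u.
have tu := expR_ge1Dx (e^-1 * u).
have tNu := expR_ge1Dx (- (e^-1 * u)); rewrite expRN in tNu.
have sE : smooth_sign u = (expR (e^-1 * u) - 1) / (expR (e^-1 * u) + 1).
  by rewrite /smooth_sign; field; rewrite gt_eqF// addr_gt0.
move: t0 tu tNu; rewrite sE; set t := expR _ => t0 tu tNu.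
have t1 : 0 < t + 1 by lra.
have [u0|u0|u0] := ltgtP u 0.
- have q0 : q <= 0 by rewrite -(nmulr_lge0 _ u0).
  rewrite ler0_norm // ltr0_norm // in qC *.
  have -> : - q - q * ((t - 1) / (t + 1)) = - q * (2 * t / (t + 1)).
    by field; rewrite gt_eqF.
  apply: (@le_trans _ _ (C * - u * (2 * t / (t + 1)))).
    by rewrite ler_wpM2r// divr_ge0 ?(ltW t1)// mulr_ge0// ltW.
  rewrite (_ : _ * _ = 2 * C * (- u * t / (t + 1))); last by field; rewrite gt_eqF.
  rewrite ler_wpM2l ?mulr_ge0// ler_pdivrMr//.
  have : - u <= e * t^-1.
    rewrite -(ler_pM2l (_ : 0 < e^-1)) ?invr_gt0// mulrA mulVf ?gt_eqF//; lra.
  move=> /(ler_wpM2r (ltW t0)); rewrite -mulrA mulVf ?gt_eqF//.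
  by have := mulr_gt0 e_gt0 t0; lra.
- have q0 : 0 <= q by rewrite -(pmulr_lge0 _ u0).
  rewrite ger0_norm // gtr0_norm // in qC *.
  have -> : q - q * ((t - 1) / (t + 1)) = q * (2 / (t + 1)).
    by field; rewrite gt_eqF.
  apply: (@le_trans _ _ (C * u * (2 / (t + 1)))).
    by rewrite ler_wpM2r// divr_ge0 ?(ltW t1).
  rewrite (_ : _ * _ = 2 * C * (u / (t + 1))); last by field; rewrite gt_eqF.
  rewrite ler_wpM2l ?mulr_ge0// ler_pdivrMr//.
  have : u <= e * t.
    rewrite -(ler_pM2l (_ : 0 < e^-1)) ?invr_gt0// mulrA mulVf ?gt_eqF//; lra.
  by have := e_gt0; lra.
- have q0 : q = 0 by apply/eqP; rewrite -normr_le0 (le_trans qC)// u0 normr0 mulr0.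
  by rewrite q0 normr0 mul0r subr0 !mulr_ge0// ltW.
Qed.

End smooth_sign.

Section uniqueness.
Context {R : realType}.
Variables (B T_b gamma : R) (b W dW ddW : R -> R).
Hypotheses (B_gt0 : 0 < B) (gamma_gt0 : 0 < gamma)
  (b_meas : measurable_fun (`]0, 1]%classic : set R) b)
  (b_bound : forall m, 0 < m <= 1 -> 0 <= b m <= gamma ^+ 4).
Hypothesis HW : milne_profile B T_b gamma b W dW ddW.
Variables (T' : R -> R) (psi' : R -> R -> R).
Hypotheses (sol' : milne_solution B T_b b T' psi')
  (T'_ge0 : forall x, x \in `[0, B] -> 0 <= T' x).
Implicit Types (x y m e s M K : R).
Local Notation I := (`[(-1 : R), 1]%classic).
Local Notation mu := (@lebesgue_measure R).
Let psi := rte_psi B b (fun y => W y ^+ 4).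
Let dT := deriv_in `[0, B] T'.
Let ddT := deriv_in `[0, B] dT.
Let q x : R := W x ^+ 4 - T' x ^+ 4.
Let phi x m : R := psi x m - psi' x m.
Let src x : R := `|q (fold B x)|.
Let Psi := rte_psi B (cst 0) src.

Let sub_oo : `]0, B[ `<=` `[0, B].
Proof. exact: subset_itv_oo_cc. Qed.

Let W_cont : continuous W.
Proof. by move=> x; exact: is_derive_continuous (profile_deriv HW x). Qed.

Let T'_cont : {within `[0, B], continuous T'}.
Proof. by apply: derivable_in_continuous; case: (milne_T_C2 sol') => -[]. Qed.

Let dT_cont : {within `[0, B], continuous dT}.
Proof. by case: (milne_T_C2 sol') => -[]. Qed.

Let T'_deriv x : 0 < x < B -> is_derive x (1 : R) T' (dT x).
Proof.
move=> xB; apply: (deriv_in_is_derive xB sub_oo).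
by case: (milne_T_C2 sol') => -[H _] _; apply: H; apply: sub_oo; rewrite /= in_itv.
Qed.

Let dT_deriv x : 0 < x < B -> is_derive x (1 : R) dT (ddT x).
Proof.
move=> xB; apply: (deriv_in_is_derive xB sub_oo).
by case: (milne_T_C2 sol') => _ [H _]; apply: H; apply: sub_oo; rewrite /= in_itv.
Qed.

Let int_psi' x : 0 <= x <= B -> mu.-integrable I (EFin \o psi' x).
Proof. by move=> xB; apply: (milne_psi_integrable sol'); rewrite in_itv. Qed.

Let src_admissible_W : admissible_source B gamma (fun y => W y ^+ 4).
Proof. exact: milne_source_admissible gamma_gt0 HW. Qed.

Let f_cont : continuous (fun y => W y ^+ 4). Proof. by case: src_admissible_W. Qed.
Let f_even x : W (2 * B - x) ^+ 4 = W x ^+ 4. Proof. by case: src_admissible_W. Qed.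

Let within_cont (g : R -> R) : continuous g -> {within `[0, B], continuous g}.
Proof. exact: continuous_subspaceT. Qed.

Let int_psi x : 0 <= x <= B -> mu.-integrable I (EFin \o psi x).
Proof.
by move=> xB; apply: (integrable_rte_psi b_meas b_bound src_admissible_W); have := B_gt0; lra.
Qed.

Let ddTE x : 0 <= x <= B -> ddT x = 2 * T' x ^+ 4 - angular_mean (psi' x).
Proof.
move=> xB; have := milne_eq_T sol' (x := x); rewrite in_itv/= => /(_ xB).
by rewrite (angular_meanB_cst _ (int_psi' xB)) -/dT -/ddT; lra.
Qed.

Let q_bounded : exists2 K : R, 0 <= K & forall x, 0 <= x <= B -> `|q x| <= K * `|W x - T' x|.
Proof.
have [M1 H1] := continuous_itv_bounded (continuous_subspaceT (A := `[0, B]) W_cont).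
have [M2 H2] := continuous_itv_bounded T'_cont.
have [M M0 [HM1 HM2]] : exists2 M : R, 0 <= M & M1 <= M /\ M2 <= M.
  exists (`|M1| + `|M2|); first by rewrite addr_ge0.
  by split; [apply: le_trans (ler_norm M1) _; rewrite lerDl|
    apply: le_trans (ler_norm M2) _; rewrite lerDr].
exists (4 * M ^+ 3) => [|x xB]; first by rewrite mulr_ge0// exprn_ge0.
have wM := le_trans (H1 x xB) HM1; have tM := le_trans (H2 x xB) HM2.
have -> : q x = (W x * W x * W x + W x * W x * T' x + W x * T' x * T' x
    + T' x * T' x * T' x) * (W x - T' x) by rewrite /q; ring.
rewrite normrM ler_wpM2r//.
have le3 (u v w : R) : `|u| <= M -> `|v| <= M -> `|w| <= M -> `|u * v * w| <= M ^+ 3.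
  by move=> uM vM wM'; rewrite !normrM !exprS expr0 mulr1 mulrA !ler_pM// mulr_ge0.
apply: (@le_trans _ _ (M ^+ 3 + M ^+ 3 + M ^+ 3 + M ^+ 3)); last by lra.
by do 3 (apply: le_trans (ler_normD _ _) _; apply: lerD; last exact: le3); exact: le3.
Qed.

(** Nonnegativity of both temperatures enters here: [t^4] is increasing only on the half-line. *)
Let q_sign x : 0 <= x <= B -> 0 <= q x * (W x - T' x).
Proof.
move=> xB; have /andP[w0 _] : 0 <= W x <= gamma.
  by apply: (profile_bound HW); have := B_gt0; lra.
have t0 : 0 <= T' x by apply: T'_ge0; rewrite in_itv.
have -> : q x * (W x - T' x)
    = (W x ^+ 3 + W x ^+ 2 * T' x + W x * T' x ^+ 2 + T' x ^+ 3) * (W x - T' x) ^+ 2.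
  by rewrite /q; ring.
by rewrite mulr_ge0 ?sqr_ge0// !addr_ge0// ?mulr_ge0 ?exprn_ge0.
Qed.

Let q_cont : {within `[0, B], continuous q}.
Proof.
move=> x; apply: cvgB.
  exact: (within_cont f_cont).
exact: (@continuous_comp _ _ _ (from_subspace `[0, B] T') (fun y => y ^+ 4) x (@T'_cont x)
  (@exprn_continuous R 4 _)).
Qed.

Let src_cont : continuous src.
Proof.
move=> x; apply: (@continuous_comp _ _ _ (fun x => q (fold B x)) Num.norm).
  exact: continuous_fold_within.
exact: norm_continuous.
Qed.

Let src_even x : src (2 * B - x) = src x.
Proof. by rewrite /src fold_reflect. Qed.

Let srcE x : 0 <= x <= B -> src x = `|q x|.
Proof. by move=> xB; rewrite /src fold_id. Qed.

Let src_admissible : exists g : R, admissible_source B g src.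
Proof.
have [M HM] := continuous_itv_bounded (continuous_subspaceT (A := `[0, 2 * B]) src_cont).
exists (1 + `|M|); split => // x /HM H; have s0 : 0 <= src x by exact: normr_ge0.
rewrite s0/=; apply: le_trans (ler_norm _) _; apply: le_trans H _; apply: le_trans (ler_norm M) _.
have : 1 <= 1 + `|M| by rewrite lerDl.
move=> /(ler_eXnr (n := 4))-/(_ isT); apply: le_trans.
by rewrite lerDr.
Qed.

Let zero_meas : measurable_fun (`]0, 1]%classic : set R) (cst 0 : R -> R).
Proof. exact: measurable_cst. Qed.

Let zero_bound (g : R) m : 0 < m <= 1 -> 0 <= (cst 0 : R -> R) m <= g ^+ 4.
Proof. by move=> _; rewrite lexx/= exprn_even_ge0. Qed.

Let psi'_cont m : -1 <= m <= 1 -> {within `[0, B], continuous (psi' ^~ m)}.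
Proof.
move=> mI; apply: derivable_in_continuous.
by case: (milne_psi_C1 sol' (mu := m)); rewrite ?in_itv.
Qed.

Let psi'_deriv x m : 0 < x < B -> -1 <= m <= 1 -> m != 0 ->
  is_derive x (1 : R) (psi' ^~ m) ((T' x ^+ 4 - psi' x m) / m).
Proof.
move=> xB mI m0; have xB' : x \in `[0, B] by rewrite in_itv/=; lra.
have mI' : m \in `[-1, 1] by rewrite in_itv.
have -> : (T' x ^+ 4 - psi' x m) / m = deriv_in `[0, B] (psi' ^~ m) x.
  have := milne_eq_psi sol' xB' mI' => E; apply: (mulfI m0).
  by rewrite mulrC divfK//; move: E; lra.
apply: (deriv_in_is_derive xB sub_oo).
by case: (milne_psi_C1 sol' mI') => H _; exact: H.
Qed.

Let Psi_ge0 x m : 0 <= x <= 2 * B -> -1 <= m <= 1 -> 0 <= Psi x m.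
Proof.
have [g ag] := src_admissible => xB mI.
by have /andP[] := admissible_rte_psi_bounds (@zero_bound g) ag xB mI.
Qed.

Let dominated_deriv s x m : 0 < x < B -> -1 <= m <= 1 -> m != 0 ->
  is_derive x (1 : R) (fun y => Psi y m + s * phi y m)
    ((src x - Psi x m) / m + s * ((q x - phi x m) / m)).
Proof.
move=> xB mI m0; have H1 := is_derive_rte_psi (cst 0) src_cont src_even x m0.
have H2 := is_derive_rte_psi b f_cont f_even x m0; have H3 := psi'_deriv xB mI m0.
apply: (is_derive_eq (is_deriveD H1 (is_deriveZ s (is_deriveB H2 H3)))).
by rewrite /GRing.scale/= -/Psi -/psi /phi /q; field.
Qed.

Let dominated_cont s m : -1 <= m <= 1 ->
  {within `[0, B], continuous (fun y => Psi y m + s * phi y m)}.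
Proof.
move=> mI x; apply: cvgD.
  exact: (@within_cont (Psi ^~ m) (@continuous_rte_psi _ _ _ _ src_cont src_even m)).
apply: cvgM; first exact: cvg_cst.
apply: cvgB; last exact: psi'_cont.
exact: (@within_cont (psi ^~ m) (@continuous_rte_psi _ _ _ _ f_cont f_even m)).
Qed.

Let dominated_rhs s x m : `|s| = 1 -> 0 < x < B -> m != 0 ->
  0 <= m * ((src x - Psi x m) / m + s * ((q x - phi x m) / m)) + (Psi x m + s * phi x m).
Proof.
move=> s1 xB m0.
have -> : m * ((src x - Psi x m) / m + s * ((q x - phi x m) / m)) + (Psi x m + s * phi x m)
    = src x + s * q x by field.
have : `|s * q x| <= src x by rewrite normrM s1 mul1r srcE//; lra.
by rewrite ler_norml => /andP[]; lra.
Qed.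

(** For [m > 0] the difference [phi] and [Psi] both start from zero at [x = 0]. At [B] the
    reflection hands the inequality over to [- m], from where it is carried back; [psi'] is not
    known to come from a reflected ray, hence the two sweeps. *)
Let dominated_signed s x m : `|s| = 1 -> 0 <= x <= B -> -1 <= m <= 1 -> m != 0 ->
  0 <= Psi x m + s * phi x m.
Proof.
move=> s1 + + m0.
have pos m1 : 0 < m1 <= 1 -> forall x, 0 <= x <= B -> 0 <= Psi x m1 + s * phi x m1.
  move=> m1I; have m1J : -1 <= m1 <= 1 by lra.
  have m10 : m1 != 0 by rewrite gt_eqF//; lra.
  have /andP[m1_gt0 _] := m1I.
  apply: (@transport_ge0 _ m1 (fun y => Psi y m1 + s * phi y m1)
    (fun x => (src x - Psi x m1) / m1 + s * ((q x - phi x m1) / m1)) 0 B m1_gt0).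
  - by move=> y yB; exact: dominated_deriv.
  - exact: dominated_cont.
  - by move=> y yB; exact: dominated_rhs.
  rewrite /Psi /phi /psi !rte_psi_left// (milne_psi_left sol') ?in_itv//=.
  by rewrite subrr mulr0 addr0.
have [m_lt0|m_gt0|/eqP] := ltgtP m 0; last by rewrite (negbTE m0).
  move=> xB mI; apply: (@transport_backward_ge0 _ m (fun y => Psi y m + s * phi y m)
    (fun x => (src x - Psi x m) / m + s * ((q x - phi x m) / m)) 0 B m_lt0 _ _ _ _ _ xB).
  - by move=> y yB; exact: dominated_deriv.
  - exact: dominated_cont.
  - by move=> y yB; exact: dominated_rhs.
  have mN : 0 < - m <= 1 by lra.
  have BB : 0 <= B <= B by rewrite lexx ltW.
  have := pos _ mN B BB; rewrite /Psi /phi /psi !rte_psi_right//.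
  by rewrite (milne_psi_right sol') ?in_itv//= opprK.
by move=> xB mI; apply: pos => //; lra.
Qed.

Let dominated x m : 0 <= x <= B -> -1 <= m <= 1 -> `|phi x m| <= Psi x m.
Proof.
move=> xB mI; have [->|m0] := eqVneq m 0.
  rewrite /phi /Psi /psi !rte_psi0 srcE// /q.
  have := milne_eq_psi sol' (x := x) (mu := 0); rewrite !in_itv/= => /(_ xB).
  have I0 : -1 <= (0 : R) <= 1 by lra.
  by move=> /(_ I0); rewrite mul0r add0r => /eqP; rewrite subr_eq0 => /eqP ->.
have H1 := dominated_signed (normr1 R) xB mI m0.
have H2 := dominated_signed (_ : `|-1 : R| = 1) xB mI m0.
by rewrite ler_norml; move: H1 H2; rewrite normrN normr1 => ? /(_ erefl) ?; lra.
Qed.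

Let Flux := rte_flux B (cst 0) src.

(* Kato's inequality: testing the difference of the two equations for the
   temperature with a smooth sign of the difference of the temperatures. *)
Let flux0_ge e K : 0 < e -> 0 <= K -> (forall x, 0 <= x <= B -> `|q x| <= K * `|W x - T' x|) ->
  - Flux 0 <= 4 * K * e * B.
Proof.
move=> e0 K0 HK; have [g ag] := src_admissible.
pose u := W - T'; pose du := dW - dT.
have Hu x : 0 < x < B -> is_derive x (1 : R) u (du x).
  by move=> xB; apply: is_deriveB; [exact: profile_deriv HW x|exact: T'_deriv].
have Hdu x : 0 < x < B -> is_derive x (1 : R) du (ddW x - ddT x).
  by move=> xB; apply: is_deriveB; [exact: profile_deriv2 HW x|exact: dT_deriv].
have [ds Hds] := choice (fun v => let: ex_intro2 d d0 Hd := is_derive_smooth_sign e0 v in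
  ex_intro (fun d => 0 <= d /\ is_derive v (1 : R) (smooth_sign e) d) d (conj d0 Hd)).
(* The linear term pays for twice the error [2 K e] of [smooth_sign_approx], so that [N] is
   nondecreasing. The temperatures agree at 0, whence [N 0 = - Flux 0]; slopes and flux vanish at
   [B], whence [N B = 4 K e B]. *)
pose N := (du : R -> R) * (smooth_sign e \o u) - Flux + (4 * K * e) *: id.
have HN x : 0 < x < B -> is_derive x (1 : R) N
    ((ddW x - ddT x) * smooth_sign e (u x) + du x * (ds (u x) * du x)
     - (2 * src x - angular_mean (Psi x)) + 4 * K * e).
  move=> xB; have H1 := Hdu x xB.
  have H2 := is_derive1_comp (proj2 (Hds (u x))) (Hu x xB).
  have H3 : is_derive x (1 : R) Flux (2 * src x - angular_mean (Psi x)).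
    by apply: (is_derive_rte_flux zero_meas (@zero_bound g) ag); lra.
  apply: (is_derive_eq (is_deriveD (is_deriveB (is_deriveM H1 H2) H3)
    (is_deriveZ (4 * K * e) (is_derive_id x 1)))).
  by rewrite /GRing.scale/=; ring.
have HN0 x : 0 < x < B -> 0 <= (ddW x - ddT x) * smooth_sign e (u x) + du x * (ds (u x) * du x)
     - (2 * src x - angular_mean (Psi x)) + 4 * K * e.
  move=> xB; have xB' : 0 <= x <= B by lra.
  have sq : 0 <= du x * (ds (u x) * du x).
    by rewrite mulrCA -expr2 mulr_ge0 ?sqr_ge0//; case: (Hds (u x)).
  have -> : ddW x - ddT x = 2 * q x - angular_mean (phi x).
    rewrite (profile_eq HW xB') ddTE// /q -/psi.
    have -> : angular_mean (phi x) = angular_mean (psi x) - angular_mean (psi' x).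
      by rewrite /angular_mean -RintegralB//; [exact: int_psi|exact: int_psi'].
    by ring.
  have iphi : mu.-integrable I (EFin \o phi x).
    have -> : EFin \o phi x = ((EFin \o psi x) \- (EFin \o psi' x))%E by [].
    by apply: integrableB => //; [exact: int_psi|exact: int_psi'].
  have phiPsi : `|angular_mean (phi x)| <= angular_mean (Psi x).
    apply: le_trans (le_normr_Rintegral _ iphi) _ => //.
    apply: le_Rintegral => //.
    - have -> : EFin \o (fun m => `|phi x m|) = (abse \o (EFin \o phi x)) by [].
      exact: integrable_abse.
    - by apply: (integrable_rte_psi zero_meas (@zero_bound g) ag); lra.
    - by move=> m; rewrite /= in_itv/=; exact: dominated.
  have qs := smooth_sign_approx e0 K0 (HK x xB') (q_sign xB').
  have s1 := smooth_sign_norm_le e (u x).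
  have phis : angular_mean (phi x) * smooth_sign e (u x) <= angular_mean (Psi x).
    apply: le_trans (ler_norm _) _; rewrite normrM -[leRHS]mulr1.
    by rewrite ler_pM.
  rewrite srcE//; move: sq qs phis; rewrite -[u x]/(W x - T' x).
  set A := angular_mean _; set A' := angular_mean _; set S := smooth_sign _ _.
  by lra.
have cN : {within `[0, B], continuous N}.
  have cu : {within `[0, B], continuous u}.
    move=> x; apply: cvgB; last exact: T'_cont.
    exact: (within_cont W_cont).
  have cdu : {within `[0, B], continuous du}.
    move=> x; apply: cvgB; last exact: dT_cont.
    apply: (@within_cont dW) => y.
    exact: is_derive_continuous (profile_deriv2 HW y).
  move=> x; apply: cvgD; last first.
    apply: (@within_cont ((4 * K * e) *: id)) => y.
    by apply: cvgM; [exact: cvg_cst|exact: cvg_id].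
  apply: cvgB; last first.
    have E : {in `[0, B]%classic, (fun x => Flux (fold B x)) =1 Flux}.
      by move=> y; rewrite inE/= in_itv/= => yB; rewrite fold_id.
    apply: (within_continuous_eq E); apply: continuous_subspaceT.
    exact: (continuous_rte_flux B_gt0 zero_meas (@zero_bound g) ag).
  apply: cvgM; first exact: cdu.
  apply: (@continuous_comp _ _ _ (from_subspace `[0, B] u) (smooth_sign e) x (@cu x)).
  exact: is_derive_continuous (proj2 (Hds _)).
have B0 := ltW B_gt0.
have := ndecr_itv HN HN0 cN (lexx 0) B0 (lexx B).
have N0 : N 0 = - Flux 0.
  rewrite -[N 0]/(du 0 * smooth_sign e (u 0) - Flux 0 + 4 * K * e * 0).
  rewrite -[u 0]/(W 0 - T' 0) (profile_left HW) (milne_T_left sol') subrr smooth_sign0.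
  by rewrite !mulr0 addr0 add0r.
have NB : N B = 4 * K * e * B.
  rewrite -[N B]/(du B * smooth_sign e (u B) - Flux B + 4 * K * e * B).
  rewrite -[du B]/(dW B - dT B) (profile_right HW) /dT (milne_T_right sol') subrr mul0r.
  by rewrite /Flux (rte_fluxB B_gt0 zero_meas (@zero_bound g) ag) subrr add0r.
by rewrite N0 NB.
Qed.

(** Letting [e] tend to 0, nothing leaves through [x = 0], so some outgoing ray arrives there with
    the value zero. Along that ray the solution times its integrating factor is nonnegative and
    nondecreasing, hence zero throughout, and then so is its source [|q|]. *)
Let q_eq0 x : 0 <= x <= B -> q x = 0.
Proof.
have [g ag] := src_admissible.
have [K K0 HK] := q_bounded.
have z2B : (0 : R) <= 0 <= 2 * B by have := B_gt0; lra.
have B2 : (0 : R) <= 2 * B <= 2 * B by have := B_gt0; lra.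
have flux0 : - Flux 0 <= 0.
  rewrite leNgt; apply/negP => a0.
  (* With [e = - Flux 0 / (4 K B + 1)], [flux0_ge] would give [- Flux 0 < - Flux 0]. *)
  have KB0 : 0 < 4 * K * B + 1 by rewrite ltr_wpDl// !mulr_ge0// ltW.
  have := flux0_ge (divr_gt0 a0 KB0) K0 HK.
  rewrite (_ : 4 * K * (_ / _) * B = - Flux 0 * (4 * K * B) / (4 * K * B + 1)).
    by rewrite ler_pdivlMr//; move: a0; lra.
  by field; rewrite gt_eqF.
have [m mI Hm] : exists2 m, -1 <= m < 0 & - (m * Psi 0 m) = 0.
  apply: angular_mean_le0_zero.
  - have -> : EFin \o (fun m => - (m * Psi 0 m)) =
         (\- (EFin \o (fun m => (m * Psi 0 m)%R)))%E by [].
    apply: integrableN; exact: (integrable_mul_rte_psi zero_meas (@zero_bound g) ag).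
  - move=> m mI; have [m0|m0] := leP m 0.
      by rewrite -mulNr mulr_ge0 ?oppr_ge0// Psi_ge0.
    by rewrite /Psi rte_psi_left//= mulr0 oppr0.
  - move: flux0; rewrite /Flux /rte_flux -/Psi => flux0.
    rewrite /angular_mean.
    under eq_Rintegral do rewrite -mulN1r.
    rewrite RintegralZl ?mulN1r//.
    exact: (integrable_mul_rte_psi zero_meas (@zero_bound g) ag).
have n0 : 0 < - m by lra.
(* The ray with [m < 0] that leaves at [x = 0], unfolded: [Psi 0 m] is the value at [2 B] of a
   forward solution started from zero. *)
pose S := transport (- m) 0 src.
have S2B : S (2 * B) = 0.
  move: Hm => /eqP; rewrite oppr_eq0 mulf_eq0 lt_eqF /=; last by lra.
  have m_lt0 : m < 0 by lra.
  by rewrite /Psi (rte_psi_neg (cst 0) src_even _ m_lt0) subr0 => /eqP.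
have S0 y : 0 <= y <= 2 * B -> S y = 0.
  move=> yB; apply/eqP; rewrite eq_le; apply/andP; split; last first.
    by have := @Psi_ge0 y (- m) yB; rewrite /Psi rte_psi_pos//; apply; lra.
  have HS z : is_derive z (1 : R) S ((src z - S z) / - m) := is_derive_transport _ _ z src_cont.
  have HE z := is_derive_weight (- m)^-1 (HS z).
  rewrite -(pmulr_rle0 _ (expR_gt0 ((- m)^-1 * y))).
  have -> : 0 = expR ((- m)^-1 * (2 * B)) * S (2 * B) by rewrite S2B mulr0.
  have /andP[y0 y2] := yB.
  apply: (ndecr_itv (a := 0) (b := 2 * B) (fun z _ => HE z)) => //.
    move=> z _; rewrite mulr_ge0 ?expR_ge0//.
    rewrite (_ : _ + _ = src z / - m); last by field; rewrite lt_eqF //; lra.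
    by rewrite divr_ge0 ?(ltW n0)// normr_ge0.
  by apply: continuous_subspaceT => z; exact: is_derive_continuous (HE z).
(* Differentiating [S = 0] takes a neighbourhood inside [[0, 2 B]], which excludes 0; there [q]
   vanishes by the common boundary value [T_b]. *)
have src0 y : 0 < y <= B -> src y = 0.
  move=> yB; have HS : is_derive y (1 : R) S ((src y - S y) / - m) :=
     is_derive_transport _ _ y src_cont.
  have HZ : is_derive y (1 : R) S 0.
    apply: (@near_eq_is_derive _ _ _ (cst 0) S y 1 0).
    near=> z; rewrite S0//; apply/andP; split.
      by apply/ltW; near: z; apply: lt_nbhsr; lra.
    by apply/ltW; near: z; apply: lt_nbhsl; have := B_gt0; lra.
  have := @derive_val _ _ _ _ _ _ _ HS; rewrite (@derive_val _ _ _ _ _ _ _ HZ).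
  rewrite S0 ?subr0; last by have := B_gt0; lra.
  by move=> /esym/eqP; rewrite mulf_eq0 invr_eq0 (gt_eqF n0) orbF => /eqP.
move=> xB; have [->|x0] := eqVneq x 0.
  by rewrite /q (profile_left HW) (milne_T_left sol') subrr.
have xB' : 0 < x <= B by rewrite lt0r x0.
by apply/eqP; rewrite -normr_le0 -srcE// src0.
Unshelve. all: by end_near. Qed.

Lemma milne_uniqueness x : 0 <= x <= B ->
  T' x = W x /\ forall m, -1 <= m <= 1 -> psi' x m = psi x m.
Proof.
move=> xB; split.
  have := q_eq0 xB; rewrite /q => /eqP; rewrite subr_eq0 eqrXn2 //.
  - by move=> /eqP.
  - have /andP[] // : 0 <= W x <= gamma.
    by apply: (profile_bound HW); have := B_gt0; lra.
  - by apply: T'_ge0; rewrite in_itv.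
move=> m mI; apply/esym/eqP; rewrite -subr_eq0 -normr_le0.
apply: le_trans (dominated xB mI) _.
have : (0 : R) <= Psi x m <= 0; last by case/andP.
apply: (rte_psi_bounds src_cont src_even _ _ _ mI).
- by move=> y yB; rewrite /src q_eq0 ?normr0 ?lexx// fold_bounds.
- by move=> ? _; rewrite lexx.
- by have := B_gt0; lra.
Qed.

End uniqueness.

(** * Boundary layers as the direction becomes tangential *)

Section layer_estimates.
Context {R : realType}.
Variables (m b0 b1 c M : R) (f f1 f2 : R -> R).
Hypotheses (m_gt0 : 0 < m) (f_deriv : forall x, is_derive x (1 : R) f (f1 x))
  (f1_deriv : forall x, is_derive x (1 : R) f1 (f2 x))
  (f2_bound : forall x, 0 <= x <= c -> `|f2 x| <= M).
Implicit Types (x y : R).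

Let S := transport m b0 f.
Let q y := (f y - S y) / m.
Let r := transport m b1 (fun y => - q y).
Let u0 := b0 - f 0 + m * f1 0.
Let w0 := b1 + f1 0.
Let E x := expR (- m^-1 * x).

Let f_cont : continuous f.
Proof. by move=> x; exact: is_derive_continuous (f_deriv x). Qed.

Let S_deriv x : is_derive x (1 : R) S (q x).
Proof. exact: is_derive_transport. Qed.

Let Nq_cont : continuous (fun y => - q y).
Proof.
move=> x; apply: cvgN; apply: cvgM; last exact: cvg_cst.
by apply: cvgB; [exact: f_cont|exact: continuous_transport].
Qed.

Let r_deriv x : is_derive x (1 : R) r ((- q x - r x) / m).
Proof. exact: is_derive_transport. Qed.

Let E_deriv x : is_derive x (1 : R) E (- m^-1 * E x).
Proof. exact: is_derive_expR_scale. Qed.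

Let M_ge0 x : 0 <= x <= c -> 0 <= M.
Proof. by move=> /f2_bound; apply: le_trans. Qed.

Let E0 : E 0 = 1.
Proof. by rewrite /E mulr0 expR0. Qed.

(* The corrector [S - f + m f'] solves the transport equation with the source
   [m^2 f'']. *)
Lemma transport_slope_layer x : 0 <= x <= c ->
  `|q x - f1 x| <= E x * (`|u0| / m) + m * M.
Proof.
move=> xc; have M0 := M_ge0 xc.
pose u := S - f + m *: f1.
pose du y := q y - f1 y + m *: f2 y.
have Hu y : is_derive y (1 : R) u (du y).
  exact: (is_deriveD (is_deriveB (S_deriv y) (f_deriv y)) (is_deriveZ m (f1_deriv y))).
pose be := `|u0| *: E + cst (m ^+ 2 * M).
pose dbe y := `|u0| *: (- m^-1 * E y) + 0.
have Hbe y : is_derive y (1 : R) be (dbe y).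
  exact: (is_deriveD (is_deriveZ _ (E_deriv y)) (is_derive_cst _ _ _)).
have main : `|u x| <= be x.
  apply: (transport_norm_le (a := 0) (c := c) m_gt0 Hu Hbe) => //.
    move=> y yc; rewrite -[u y]/(S y - f y + m * f1 y) -[be y]/(`|u0| * E y + m ^+ 2 * M).
    rewrite /du /dbe /q /GRing.scale/=.
    rewrite [X in `|X|](_ : _ = m ^+ 2 * f2 y); last by field; rewrite gt_eqF.
    rewrite [leRHS](_ : _ = m ^+ 2 * M); last by field; rewrite gt_eqF.
    rewrite normrM ger0_norm ?exprn_ge0 ?(ltW m_gt0)//.
     by rewrite ler_wpM2l ?exprn_ge0 ?(ltW m_gt0)// f2_bound.
  rewrite -[u 0]/(S 0 - f 0 + m * f1 0) -[be 0]/(`|u0| * E 0 + m ^+ 2 * M).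
  by rewrite /S transport0// E0 mulr1 lerDl mulr_ge0// exprn_ge0// ltW.
have -> : q x - f1 x = - u x / m.
  by rewrite -[u x]/(S x - f x + m * f1 x) /q; field; rewrite gt_eqF.
rewrite normrM normrN (@ger0_norm _ m^-1) ?invr_ge0 ?(ltW m_gt0)//.
rewrite ler_pdivrMr//; apply: le_trans main _.
rewrite -[be x]/(`|u0| * E x + m ^+ 2 * M).
by rewrite le_eqVlt; apply/orP; left; apply/eqP; field; rewrite gt_eqF.
Qed.

(** [r + f1] solves the transport equation with source [- (q - f1) + m f2], and [q - f1] is itself a
    layer. A source [E] resonates with the homogeneous solution [E], which is why the barrier
    contains [x E]. *)
Lemma transport_param_slope_layer x : 0 <= x <= c ->
  `|r x + f1 x| <= E x * (`|w0| + x / m * (`|u0| / m)) + 2 * m * M.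
Proof.
move=> xc; have M0 := M_ge0 xc.
pose w := r + f1.
pose dw y := (- q y - r y) / m + f2 y.
have Hw y : is_derive y (1 : R) w (dw y).
  exact: (is_deriveD (r_deriv y) (f1_deriv y)).
pose k := `|u0| / m ^+ 2.
pose be := E * (cst `|w0| + k *: id) + cst (2 * m * M).
pose dbe y := E y *: (0 + k *: (1 : R)) + (`|w0| + k * y) *: (- m^-1 * E y) + 0.
have Hbe y : is_derive y (1 : R) be (dbe y).
  exact: (is_deriveD (is_deriveM (E_deriv y) (is_deriveD (is_derive_cst _ _ _)
    (is_deriveZ k (is_derive_id y 1)))) (is_derive_cst _ _ _)).
have main : `|w x| <= be x.
  apply: (transport_norm_le (a := 0) (c := c) m_gt0 Hw Hbe) => //.
    move=> y yc; rewrite -[w y]/(r y + f1 y) -[be y]/(E y * (`|w0| + k * y) + 2 * m * M).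
    rewrite /dw /dbe /GRing.scale/=.
    rewrite [X in `|X|](_ : _ = - (q y - f1 y) + m * f2 y); last by field; rewrite gt_eqF.
    rewrite [leRHS](_ : _ = E y * (`|u0| / m) + m * M + m * M); last first.
      by rewrite /k; field; rewrite gt_eqF.
    apply: le_trans (ler_normD _ _) _; apply: lerD.
      by rewrite normrN; exact: transport_slope_layer.
    by rewrite normrM ger0_norm ?(ltW m_gt0)// ler_wpM2l ?(ltW m_gt0)// f2_bound.
  rewrite -[w 0]/(r 0 + f1 0) -[be 0]/(E 0 * (`|w0| + k * 0) + 2 * m * M).
  by rewrite /r transport0// E0 mul1r mulr0 addr0 lerDl !mulr_ge0// ltW.
apply: le_trans main _; rewrite -[be x]/(E x * (`|w0| + k * x) + 2 * m * M) /k.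
by rewrite le_eqVlt; apply/orP; left; apply/eqP; field; rewrite gt_eqF.
Qed.

End layer_estimates.

Section transport_param.
Context {R : realType}.
Implicit Types (m b c d e x M : R) (f g : R -> R).

Lemma transport_source_dist m b f g c M : 0 < m -> continuous f -> continuous g ->
  (forall x, 0 <= x <= c -> `|f x - g x| <= M) ->
  forall x, 0 <= x <= c -> `|transport m b f x - transport m b g x| <= M.
Proof.
move=> m0 cf cg fg x xc.
pose u := transport m b f - transport m b g.
pose du x := (f x - transport m b f x) / m - (g x - transport m b g x) / m.
have Hu y : is_derive y (1 : R) u (du y).
  exact: (is_deriveB (is_derive_transport m b y cf) (is_derive_transport m b y cg)).
have M0 : 0 <= M by apply: le_trans (fg x xc).
apply: (transport_norm_le (g := cst M) (dg := cst 0) (a := 0) (c := c) m0 Hu _ _ _ xc).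
  move=> y yc; rewrite -[u y]/(transport m b f y - transport m b g y) /du.
  rewrite [X in `|X|](_ : _ = f y - g y); last by field; rewrite gt_eqF.
  by rewrite /= mulr0 add0r fg.
by rewrite -[u 0]/(transport m b f 0 - transport m b g 0) !transport0// subrr normr0.
Qed.

(* The difference quotient in the direction cosine solves the transport
   equation with the source [- q m'], [q] being the derivative in space. *)
Lemma transport_param_diff_quotient m m' b b' d f c e e' : 0 < m -> 0 < m' -> m' != m ->
  continuous f ->
  (forall x, 0 <= x <= c -> `|(f x - transport m' b' f x) / m'
     - (f x - transport m b f x) / m| <= e) ->
  `|(b' - b) / (m' - m) - d| <= e' ->
  forall x, 0 <= x <= c ->
  `|(transport m' b' f x - transport m b f x) / (m' - m)
     - transport m d (fun y => - ((f y - transport m b f y) / m)) x| <= e + e'.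
Proof.
move=> m0 m'0 mm' cf qe de x xc.
have h0 : m' - m != 0 by rewrite subr_eq0.
pose q y := (f y - transport m b f y) / m.
pose q' y := (f y - transport m' b' f y) / m'.
have cq : continuous (fun y => - q y).
  move=> y; apply: cvgN; apply: cvgM; last exact: cvg_cst.
  by apply: cvgB; [exact: cf|exact: continuous_transport].
pose r := transport m d (fun y => - q y).
pose u := (m' - m)^-1 *: (transport m' b' f - transport m b f) - r.
pose du x := (m' - m)^-1 *: (q' x - q x) - (- q x - r x) / m.
have Hu y : is_derive y (1 : R) u (du y).
  exact: (is_deriveB (is_deriveZ (m' - m)^-1 (is_deriveB (is_derive_transport m' b' y cf)
    (is_derive_transport m b y cf))) (is_derive_transport m d y cq)).
have uE y : u y = (transport m' b' f y - transport m b f y) / (m' - m) - r y.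
  by rewrite mulrC.
have e0 : 0 <= e by apply: le_trans (qe x xc).
have e'0 : 0 <= e' by apply: le_trans de.
rewrite -[X in `|X|]uE.
apply: (transport_norm_le (g := cst (e + e')) (dg := cst 0) (a := 0) (c := c) m0 Hu _ _ _ xc).
  move=> y yc; rewrite uE /du /GRing.scale/=.
  rewrite [X in `|X|](_ : _ = - (q' y - q y)).
    by rewrite normrN mulr0 add0r (le_trans (qe y yc))// lerDl.
  rewrite /q' /q; field.
  by rewrite h0 !gt_eqF.
by rewrite uE /r !transport0//= (le_trans de)// lerDr.
Qed.

End transport_param.

(** * Joint continuity in position and direction *)

Section joint_continuity.
Context {R : realType}.
Variables (B : R) (Z : set R).
Hypotheses (B_gt0 : 0 < B) (Z_reflect : forall x : R, 0 <= x <= B -> Z x -> Z (2 * B - x)).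
Implicit Types (x y m d e s : R) (h : R -> R -> R).

(** [Z] lists the positions at which the line [mu = 0] is kept. The positive [x] remove only the
    corner (0, 0), and [setT] removes nothing, so both regularity claims are instances. *)
Definition pointed_rect : set (R * R) :=
  phase_rect B `&` [set p | p.2 = 0 -> Z p.1].

Lemma pointed_rectE x m : pointed_rect (x, m) <->
  [/\ 0 <= x <= B, -1 <= m <= 1 & m = 0 -> Z x].
Proof.
rewrite /pointed_rect /phase_rect /setI /setX/= !in_itv/=.
by split=> [[[? ?] ?]|[? ? ?]].
Qed.

Lemma within_continuous2 (A : set (R * R)) (F : R * R -> R) :
  (forall p, A p -> forall e, 0 < e -> exists2 d : R, 0 < d & forall p', A p' ->
     `|p'.1 - p.1| < d -> `|p'.2 - p.2| < d -> `|F p' - F p| <= e) ->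
  {within A, continuous F}.
Proof.
move=> H; apply/subspace_continuousP => p Ap; apply/cvgrPdist_le => e e0.
have [d d0 Hd] := H p Ap e e0.
exists (ball p.1 d, ball p.2 d) => /=; first by split; exact: nbhsx_ballx.
move=> p' /= [p1 p2] Ap'; rewrite distrC; apply: Hd => //; rewrite distrC.
  exact: p1.
exact: p2.
Qed.

Lemma continuous_dist (g : R -> R) x e : continuous g -> 0 < e ->
  exists2 d : R, 0 < d & forall y, `|y - x| < d -> `|g y - g x| <= e.
Proof.
move=> cg e0; have /cvgrPdist_le/(_ e e0)[d /= d0 Hd] := cg x.
by exists d => // y xy; rewrite distrC; apply: Hd; rewrite /= distrC.
Qed.

Definition half_continuous h : Prop := forall x0 m0,
  0 <= x0 <= 2 * B -> 0 <= m0 <= 1 -> (m0 = 0 -> Z x0) ->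
  forall e, 0 < e -> exists2 d : R, 0 < d & forall x m, 0 <= x <= 2 * B -> 0 <= m <= 1 ->
    `|x - x0| < d -> `|m - m0| < d -> `|h x m - h x0 m0| <= e.

(** Move first in [m] at fixed [x], then in [x] at fixed [m0]. The first move must be uniform in
    [x]: over the whole doubled slab when [m0 > 0], near [x0] when [m0 = 0]. *)
Lemma half_continuousI h :
  (forall m0, 0 < m0 <= 1 -> forall e, 0 < e -> exists2 d : R, 0 < d &
     forall m, 0 < m <= 1 -> `|m - m0| < d -> forall x, 0 <= x <= 2 * B ->
       `|h x m - h x m0| <= e) ->
  (forall x0, 0 <= x0 <= 2 * B -> Z x0 -> forall e, 0 < e -> exists2 d : R, 0 < d &
     forall x m, 0 <= x <= 2 * B -> 0 < m <= 1 -> `|x - x0| < d -> m < d ->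
       `|h x m - h x 0| <= e) ->
  (forall m, 0 <= m <= 1 -> continuous (h ^~ m)) -> half_continuous h.
Proof.
move=> Ha Hb Hc x0 m0 x0B m0I Zx0 e e0.
have e2 : 0 < e / 2 by rewrite divr_gt0.
have [d1 d10 Hd1] := continuous_dist x0 (Hc m0 m0I) e2.
have tri a b c : `|a - b| <= e / 2 -> `|b - c| <= e / 2 -> `|a - c| <= e.
  by move=> H1 H2; rewrite (le_trans (ler_distD b _ _))//; lra.
have [m00|m0n0] := eqVneq m0 0.
  have [d2 d20 Hd2] := Hb x0 x0B (Zx0 m00) (e / 2) e2.
  exists (Num.min d1 d2); first by rewrite lt_min d10.
  move=> x m xB mI; rewrite !lt_min m00 subr0 => /andP[x1 x2] /andP[_ m2].
  rewrite m00 in Hd1; apply: tri (Hd1 x x1).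
  have [->|mn0] := eqVneq m 0; first by rewrite subrr normr0 ltW.
  have m_gt0 : 0 < m by rewrite lt0r mn0; lra.
  by apply: Hd2 => //; [lra|rewrite -(gtr0_norm m_gt0)].
have m0_gt0 : 0 < m0 by rewrite lt0r m0n0; lra.
have m0J : 0 < m0 <= 1 by rewrite m0_gt0; lra.
have [d2 d20 Hd2] := Ha m0 m0J (e / 2) e2.
exists (Num.min d1 (Num.min d2 m0)); first by rewrite !lt_min d10 d20.
move=> x m xB mI; rewrite !lt_min => /and3P[x1 _ _] /and3P[_ m2 m3].
apply: tri (Hd1 x x1); apply: Hd2 => //.
by move: m3; rewrite ltr_norml; lra.
Qed.

(** [s] is the parity under reflection: 1 for [psi], and -1 for both of its partial derivatives. At
    [m = 0] the two half-neighbourhoods are glued. *)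
Lemma half_continuous_within h s (F : R * R -> R) : `|s| = 1 ->
  (forall x m, h x (- m) = s * h (2 * B - x) m) -> half_continuous h ->
  (forall x m, pointed_rect (x, m) -> F (x, m) = h x m) ->
  {within pointed_rect, continuous F}.
Proof.
move=> s1 hN Hh FE; apply: within_continuous2 => -[x0 m0] Ap0 e e0.
have /pointed_rectE[x0B m0I Zx0] := Ap0.
have reflB x : 0 <= x <= B -> 0 <= 2 * B - x <= 2 * B by have := B_gt0; lra.
have x02 : 0 <= x0 <= 2 * B by have := B_gt0; lra.
have refl_dist x : `|2 * B - x - (2 * B - x0)| = `|x - x0|.
  by rewrite [RHS]distrC; congr `|_|; ring.
have dist_N x m n : `|h x (- m) - h x0 (- n)| = `|h (2 * B - x) m - h (2 * B - x0) n|.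
  by rewrite !hN -mulrBr normrM s1 mul1r.
have right_nbhd : 0 <= m0 -> exists2 d : R, 0 < d & forall x m, 0 <= x <= B ->
    0 <= m <= 1 -> `|x - x0| < d -> `|m - m0| < d -> `|h x m - h x0 m0| <= e.
  move=> m00; have m0J : 0 <= m0 <= 1 by lra.
  have [d d0 Hd] := Hh x0 m0 x02 m0J Zx0 e e0; exists d => // x m xB mI.
  by apply: Hd => //; have := B_gt0; lra.
have left_nbhd : m0 <= 0 -> exists2 d : R, 0 < d & forall x m, 0 <= x <= B ->
    -1 <= m <= 0 -> `|x - x0| < d -> `|m - m0| < d -> `|h x m - h x0 m0| <= e.
  move=> m00; have m0J : 0 <= - m0 <= 1 by lra.
  have Z' : - m0 = 0 -> Z (2 * B - x0).
    by move=> /eqP; rewrite oppr_eq0 => /eqP/Zx0; exact: Z_reflect.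
  have [d d0 Hd] := Hh _ _ (reflB _ x0B) m0J Z' e e0; exists d => // x m xB mI xd md.
  rewrite -(opprK m) -(opprK m0) dist_N; apply: Hd; [exact: reflB|lra| |].
    by rewrite refl_dist.
  by rewrite -opprD normrN.
suff [d d0 Hd] : exists2 d : R, 0 < d & forall x m, 0 <= x <= B -> -1 <= m <= 1 ->
    `|x - x0| < d -> `|m - m0| < d -> `|h x m - h x0 m0| <= e.
  exists d => // -[x m] Ap /= xd md; rewrite !FE//.
  by have /pointed_rectE[xB mI _] := Ap; exact: Hd.
have [m0_lt0|m0_gt0|m00] := ltgtP m0 0.
- have [d d0 Hd] := left_nbhd (ltW m0_lt0).
  exists (Num.min d (- m0)); first by rewrite lt_min d0; lra.
  move=> x m xB mI; rewrite !lt_min => /andP[x1 _] /andP[m1 m2].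
  by apply: Hd => //; move: m2; rewrite ltr_norml; lra.
- have [d d0 Hd] := right_nbhd (ltW m0_gt0).
  exists (Num.min d m0); first by rewrite lt_min d0.
  move=> x m xB mI; rewrite !lt_min => /andP[x1 _] /andP[m1 m2].
  by apply: Hd => //; move: m2; rewrite ltr_norml; lra.
have [d1 d10 Hd1] := left_nbhd (eq_ind_r (fun z => z <= 0) (lexx 0) m00).
have [d2 d20 Hd2] := right_nbhd (eq_ind_r (fun z => 0 <= z) (lexx 0) m00).
exists (Num.min d1 d2); first by rewrite lt_min d10.
move=> x m xB mI; rewrite !lt_min => /andP[x1 x2] /andP[m1 m2].
by have [m_ge0|m_lt0] := leP 0 m; [apply: Hd2|apply: Hd1] => //; lra.
Qed.

End joint_continuity.

(** * Joint C^1 regularity of the intensity *)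

Section joint_regularity.
Context {R : realType}.
Variables (B : R) (b c f f1 f2 : R -> R) (Z : set R).
Hypotheses (B_gt0 : 0 < B) (Z_reflect : forall x : R, 0 <= x <= B -> Z x -> Z (2 * B - x))
  (Z_inner : `]0, B[ `<=` Z) (f_deriv : forall x, is_derive x (1 : R) f (f1 x))
  (f1_deriv : forall x, is_derive x (1 : R) f1 (f2 x)) (f2_cont : continuous f2)
  (f_even : forall x, f (2 * B - x) = f x).
Hypotheses (c_b : forall m, 0 < m <= 1 -> c m = b m) (c_C1 : C1_on `[0, 1] c).
Implicit Types (x y m d e s t K M : R).
Let db := deriv_in `[0, 1] c.
Let psi := rte_psi B b f.
Let q x m := (f x - transport m (b m) f x) / m.
Let r x m := transport m (db m) (fun y => - q y m) x.
Let E x m := expR (- m^-1 * x).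
Let u0 m := b m - f 0 + m * f1 0.
Let w0 m := db m + f1 0.

(** One bound for the two layer barriers. [u0] is the mismatch at [x = 0] between the inflow and the
    expansion [f - m f1], and [w0] the mismatch between their slopes in [m]. *)
Definition boundary_layer x m : R :=
  E x m * (`|w0 m| + `|u0 m| / m + x / m * (`|u0 m| / m)).

Hypothesis layer_vanishes : forall x0, 0 <= x0 <= 2 * B -> Z x0 ->
  forall e, 0 < e -> exists2 d : R, 0 < d & forall x m, 0 <= x <= 2 * B ->
    0 < m <= 1 -> `|x - x0| < d -> m < d -> boundary_layer x m <= e.

(** The expansion [psi = f - m f1 + ...] dictates the values at [m = 0]: [f1] for this derivative,
    [- f1] for [psi_dm]. *)
Definition psi_dx x m : R := if m == 0 then f1 x else (f x - psi x m) / m.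

Definition psi_dm x m : R :=
  if 0 < m then r x m else if m < 0 then - r (2 * B - x) (- m) else - f1 x.

Let f_cont : continuous f.
Proof. by move=> x; exact: is_derive_continuous (f_deriv x). Qed.

Let f1_cont : continuous f1.
Proof. by move=> x; exact: is_derive_continuous (f1_deriv x). Qed.

Let q_cont m : continuous (q ^~ m).
Proof.
move=> x; apply: cvgM; last exact: cvg_cst.
by apply: cvgB; [exact: f_cont|exact: continuous_transport].
Qed.

Let Nq_cont m : continuous (fun y => - q y m).
Proof. by move=> x; apply: cvgN; exact: q_cont. Qed.

Let f1_odd x : f1 (2 * B - x) = - f1 x.
Proof.
have E1 : (fun y => f (2 * B - y)) = f by apply/funext.
have H2 : is_derive x (1 : R) f (- f1 (2 * B - x)).
  by rewrite -[X in is_derive _ _ X]E1; exact: is_derive_reflect.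
have := @derive_val _ _ _ _ _ _ _ H2; rewrite (@derive_val _ _ _ _ _ _ _ (f_deriv x)) => ->.
by rewrite opprK.
Qed.

Let psiN x m : psi x (- m) = psi (2 * B - x) m.
Proof. exact: rte_psiN. Qed.

Let psi_dx_pos x m : 0 < m -> psi_dx x m = q x m.
Proof. by move=> m0; rewrite /psi_dx gt_eqF// /psi rte_psi_pos. Qed.

Let psi_dx0 x : psi_dx x 0 = f1 x.
Proof. by rewrite /psi_dx eqxx. Qed.

Let psi_dm_pos x m : 0 < m -> psi_dm x m = r x m.
Proof. by rewrite /psi_dm => ->. Qed.

Let psi_dm0 x : psi_dm x 0 = - f1 x.
Proof. by rewrite /psi_dm ltxx. Qed.

Let psi_dxN x m : psi_dx x (- m) = -1 * psi_dx (2 * B - x) m.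
Proof.
rewrite /psi_dx oppr_eq0; case: ifP => _; first by rewrite f1_odd mulN1r opprK.
by rewrite /psi rte_psiN// f_even invrN; ring.
Qed.

Let psi_dmN x m : psi_dm x (- m) = -1 * psi_dm (2 * B - x) m.
Proof.
rewrite /psi_dm oppr_gt0 oppr_lt0 mulN1r opprK.
case: (ltgtP m 0) => // _; last by rewrite opprK f1_odd.
by rewrite opprK (_ : 2 * B - (2 * B - x) = x)//; ring.
Qed.

Let c_cont : {within `[0, 1], continuous c}.
Proof. by apply: derivable_in_continuous; case: c_C1. Qed.

Let db_cont : {within `[0, 1], continuous db}.
Proof. by case: c_C1. Qed.

Let bounds : exists2 M : R, 0 <= M &
  (forall x, 0 <= x <= 2 * B -> [/\ `|f x| <= M, `|f1 x| <= M & `|f2 x| <= M]) /\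
  (forall m, 0 < m <= 1 -> `|b m| <= M /\ `|db m| <= M).
Proof.
have [M1 H1] := continuous_itv_bounded (continuous_subspaceT (A := `[0, 2 * B]) f_cont).
have [M2 H2] := continuous_itv_bounded (continuous_subspaceT (A := `[0, 2 * B]) f1_cont).
have [M3 H3] := continuous_itv_bounded (continuous_subspaceT (A := `[0, 2 * B]) f2_cont).
have [M4 H4] := continuous_itv_bounded c_cont.
have [M5 H5] := continuous_itv_bounded db_cont.
have n1 := ler_norm M1; have n2 := ler_norm M2; have n3 := ler_norm M3.
have n4 := ler_norm M4; have n5 := ler_norm M5.
have p1 := normr_ge0 M1; have p2 := normr_ge0 M2; have p3 := normr_ge0 M3.
have p4 := normr_ge0 M4; have p5 := normr_ge0 M5.
exists (`|M1| + `|M2| + `|M3| + `|M4| + `|M5|); first by rewrite !addr_ge0.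
split=> [x xB|m mI].
  by have := H1 x xB; have := H2 x xB; have := H3 x xB; split; lra.
have mI' : 0 <= m <= 1 by lra.
by rewrite -c_b//; have := H4 m mI'; have := H5 m mI'; split; lra.
Qed.

Let eps_itv (g : R -> R) m0 e : {within `[0, 1], continuous g} -> 0 <= m0 <= 1 -> 0 < e ->
  exists2 d : R, 0 < d & forall m, 0 <= m <= 1 -> `|m - m0| < d -> `|g m - g m0| <= e.
Proof.
move=> /within_continuousP cg m0I e0.
have [|d d0 Hd] := cg m0 _ e e0; first by rewrite /= in_itv.
by exists d => // m mI; apply: Hd; rewrite /= in_itv.
Qed.

Let transport_bound M m : (forall x, 0 <= x <= 2 * B -> `|f x| <= M) -> `|b m| <= M ->
  0 < m -> forall x, 0 <= x <= 2 * B -> `|transport m (b m) f x| <= M.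
Proof. by move=> fM bM m0; exact: transport_norm_bound. Qed.

Let q_bound M m : (forall x, 0 <= x <= 2 * B -> `|f x| <= M) -> `|b m| <= M ->
  0 < m -> forall x, 0 <= x <= 2 * B -> `|q x m| <= 2 * M / m.
Proof.
move=> fM bM m0 x xB; rewrite normrM (@ger0_norm _ m^-1) ?invr_ge0 ?(ltW m0)//.
rewrite ler_wpM2r ?invr_ge0 ?(ltW m0)//; apply: le_trans (ler_normB _ _) _.
by have := fM x xB; have := transport_bound fM bM m0 xB; lra.
Qed.

Let small_mul K e t : 0 <= K -> 0 < e -> `|t| < e / (K + 1) -> `|t| * K <= e.
Proof.
move=> K0 e0; rewrite ltr_pdivlMr ?ltr_wpDl// => H.
by have := normr_ge0 t; lra.
Qed.

Let away m0 m : 0 < m0 -> `|m - m0| < m0 / 2 -> 0 < m /\ m^-1 <= 2 / m0.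
Proof.
move=> m00; rewrite ltr_norml => H; have m_gt0 : 0 < m by lra.
by split=> //; rewrite -[2 / m0]invf_div lef_pV2 ?posrE//; lra.
Qed.

Let transport_near m0 e : 0 < m0 <= 1 -> 0 < e ->
  exists2 d : R, 0 < d & forall m, 0 < m <= 1 -> `|m - m0| < d ->
    forall x, 0 <= x <= 2 * B ->
    `|transport m (b m) f x - transport m0 (b m0) f x| <= e.
Proof.
move=> m0I e0; have /andP[m0_gt0 m0_le1] := m0I.
have [M M0 [HM Hb]] := bounds.
have fM x : 0 <= x <= 2 * B -> `|f x| <= M by move=> /HM[].
have m0I' : 0 <= m0 <= 1 by lra.
have e2 : 0 < e / 2 by rewrite divr_gt0.
have [d1 d10 Hd1] := eps_itv c_cont m0I' e2.
have K0 : 0 <= 2 * M * (2 / m0) by rewrite !mulr_ge0// invr_ge0 ltW.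
exists (Num.min d1 (Num.min (m0 / 2) (e / 2 / (2 * M * (2 / m0) + 1)))).
  by rewrite !lt_min d10 !divr_gt0// ltr_wpDl.
move=> m mI; rewrite !lt_min => /and3P[md1 md2 md3] x xB.
have [m_gt0 mV] := away m0_gt0 md2; have mI' : 0 <= m <= 1 by lra.
have bM := proj1 (Hb m mI).
apply: le_trans (transport_dist (b m0) m0_gt0 m_gt0 f_cont fM bM xB) _.
have := Hd1 m mI' md1; rewrite !c_b//.
have := small_mul K0 e2 md3.
have : `|m - m0| * (2 * M / m) <= `|m - m0| * (2 * M * (2 / m0)).
  by rewrite ler_wpM2l// ler_wpM2l// mulr_ge0.
by lra.
Qed.

Let dx_near m0 e : 0 < m0 <= 1 -> 0 < e ->
  exists2 d : R, 0 < d & forall m, 0 < m <= 1 -> `|m - m0| < d ->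
    forall x, 0 <= x <= 2 * B -> `|q x m - q x m0| <= e.
Proof.
move=> m0I e0; have /andP[m0_gt0 m0_le1] := m0I.
have [M M0 [HM Hb]] := bounds.
have fM x : 0 <= x <= 2 * B -> `|f x| <= M by move=> /HM[].
have e2 : 0 < e / 2 by rewrite divr_gt0.
have em : 0 < m0 * (e / 2) by rewrite mulr_gt0.
have [d1 d10 Hd1] := transport_near m0I em.
have K0 : 0 <= 2 * M * (2 / m0) / m0.
  by rewrite !mulr_ge0// invr_ge0 ltW.
exists (Num.min d1 (Num.min (m0 / 2) (e / 2 / (2 * M * (2 / m0) / m0 + 1)))).
  by rewrite !lt_min d10 !divr_gt0// ltr_wpDl.
move=> m mI; rewrite !lt_min => /and3P[md1 md2 md3] x xB.
have [m_gt0 mV] := away m0_gt0 md2; have bM := proj1 (Hb m mI).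
have -> : q x m - q x m0 = - (q x m * (m - m0) / m0)
    - (transport m (b m) f x - transport m0 (b m0) f x) / m0.
  by rewrite /q; field; rewrite !gt_eqF.
have qM := q_bound fM bM m_gt0 xB; move: (q x m) qM => Q qM.
apply: le_trans (ler_normB _ _) _; rewrite normrN !normrM.
rewrite !(@ger0_norm _ m0^-1) ?invr_ge0 ?(ltW m0_gt0)//.
have H1 := Hd1 m mI md1 x xB.
have H2 : `|transport m (b m) f x - transport m0 (b m0) f x| / m0 <= e / 2.
  by rewrite ler_pdivrMr// mulrC.
have H3 : `|Q| * `|m - m0| / m0 <= `|m - m0| * (2 * M * (2 / m0) / m0).
  rewrite [leLHS](_ : _ = (`|m - m0| / m0) * `|Q|); last by ring.
  rewrite [leRHS](_ : _ = (`|m - m0| / m0) * (2 * M * (2 / m0))); last by ring.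
  rewrite ler_wpM2l ?mulr_ge0// ?invr_ge0 ?(ltW m0_gt0)//.
  by apply: le_trans qM _; rewrite ler_wpM2l// mulr_ge0.
by have := small_mul K0 e2 md3; lra.
Qed.

Let dm_near m0 e : 0 < m0 <= 1 -> 0 < e ->
  exists2 d : R, 0 < d & forall m, 0 < m <= 1 -> `|m - m0| < d ->
    forall x, 0 <= x <= 2 * B -> `|r x m - r x m0| <= e.
Proof.
move=> m0I e0; have /andP[m0_gt0 m0_le1] := m0I.
have [M M0 [HM Hb]] := bounds.
have fM x : 0 <= x <= 2 * B -> `|f x| <= M by move=> /HM[].
have m0I' : 0 <= m0 <= 1 by lra.
have e3 : 0 < e / 3 by rewrite divr_gt0.
have [d1 d10 Hd1] := eps_itv db_cont m0I' e3.
have [d2 d20 Hd2] := dx_near m0I e3.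
pose Mq := M + 2 * M * (2 / m0).
have K1 : 0 <= 2 * M * (2 / m0) by rewrite !mulr_ge0// invr_ge0 ltW.
have K0 : 0 <= 2 * Mq * (2 / m0).
  by rewrite !mulr_ge0// ?invr_ge0 ?(ltW m0_gt0)// addr_ge0.
exists (Num.min (Num.min d1 d2) (Num.min (m0 / 2) (e / 3 / (2 * Mq * (2 / m0) + 1)))).
  by rewrite !lt_min d10 d20 !divr_gt0// ltr_wpDl.
move=> m mI; rewrite !lt_min => /andP[/andP[md1 md2] /andP[md3 md4]] x xB.
have [m_gt0 mV] := away m0_gt0 md3; have mI' : 0 <= m <= 1 by lra.
have [bM dbM] := Hb m mI.
have qM y : 0 <= y <= 2 * B -> `|- q y m| <= Mq.
  move=> yB; rewrite normrN (le_trans (q_bound fM bM m_gt0 yB))// ler_wpDl//.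
  by rewrite ler_wpM2l// mulr_ge0.
have dbMq : `|db m| <= Mq by rewrite (le_trans dbM)// lerDl.
(* The direction and the inflow are changed first, with the source kept; then the source, at the
   fixed direction [m0]. *)
have H1 := transport_dist (db m0) m0_gt0 m_gt0 (@Nq_cont m) qM dbMq xB.
have H2 : `|transport m0 (db m0) (fun y => - q y m) x - r x m0| <= e / 3.
  apply: (@transport_source_dist _ m0 (db m0) (fun y => - q y m) (fun y => - q y m0)
    (2 * B) (e / 3) m0_gt0 (@Nq_cont m) (@Nq_cont m0) _ x xB) => y yB.
  by rewrite -opprD normrN; exact: Hd2.
have H3 := Hd1 m mI' md1; have H4 := small_mul K0 e3 md4.
have H5 : `|m - m0| * (2 * Mq / m) <= `|m - m0| * (2 * Mq * (2 / m0)).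
  by rewrite ler_wpM2l// ler_wpM2l// mulr_ge0// addr_ge0.
have := ler_distD (transport m0 (db m0) (fun y => - q y m) x) (r x m) (r x m0).
by move: H1 H2 H3 H4 H5; rewrite -/(r x m); lra.
Qed.

Let E_ge0 x m : 0 <= E x m. Proof. exact: expR_ge0. Qed.

Let dx_layer M m x : 0 < m <= 1 -> (forall x, 0 <= x <= 2 * B -> `|f2 x| <= M) ->
  0 <= x <= 2 * B -> `|q x m - f1 x| <= boundary_layer x m + m * M.
Proof.
move=> /andP[m0 m1] f2M xB.
apply: le_trans (transport_slope_layer (b m) m0 f_deriv f1_deriv f2M xB) _.
rewrite lerD2r /boundary_layer ler_wpM2l//.
have u0m : 0 <= `|u0 m| / m by rewrite divr_ge0// ltW.
have xm : 0 <= x / m by rewrite divr_ge0 ?(ltW m0)//; lra.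
have := mulr_ge0 xm u0m; have := normr_ge0 (w0 m); rewrite -/(u0 m).
by lra.
Qed.

Let dm_layer M m x : 0 < m <= 1 -> (forall x, 0 <= x <= 2 * B -> `|f2 x| <= M) ->
  0 <= x <= 2 * B -> `|r x m + f1 x| <= boundary_layer x m + 2 * m * M.
Proof.
move=> /andP[m0 m1] f2M xB.
apply: le_trans (transport_param_slope_layer (b m) (db m) m0 f_deriv f1_deriv f2M xB) _.
rewrite lerD2r /boundary_layer ler_wpM2l//.
by rewrite -/(u0 m) -/(w0 m) addrAC lerDl divr_ge0// ltW.
Qed.

Let layer_near x0 e : 0 <= x0 <= 2 * B -> Z x0 -> 0 < e ->
  exists2 d : R, 0 < d & forall x m, 0 <= x <= 2 * B -> 0 < m <= 1 ->
    `|x - x0| < d -> m < d ->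
    [/\ `|transport m (b m) f x - f x| <= e, `|q x m - f1 x| <= e
      & `|r x m + f1 x| <= e].
Proof.
move=> x0B Zx0 e0; have e2 : 0 < e / 2 by rewrite divr_gt0.
have [M M0 [HM Hb]] := bounds.
have [d1 d10 Hd1] := layer_vanishes x0B Zx0 e2.
have K0 : 0 <= 2 * M by rewrite mulr_ge0.
exists (Num.min d1 (Num.min (e / 2 / (2 * M + 1)) (e / (M + e + 1)))).
  by rewrite !lt_min d10 !divr_gt0// ?ltr_wpDl// addr_ge0// ltW.
move=> x m xB mI; rewrite !lt_min => /and3P[xd1 _ _] /and3P[md1 md2 md3].
have m0 : 0 < m by case/andP: mI.
have f2M y : 0 <= y <= 2 * B -> `|f2 y| <= M by move=> /HM[].
have HL := Hd1 x m xB mI xd1 md1.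
have md2' : `|m| < e / 2 / (2 * M + 1) by rewrite gtr0_norm.
have := small_mul K0 e2 md2'; rewrite gtr0_norm// => HK.
have mM : 0 <= m * M by rewrite mulr_ge0// ltW.
have Hq := dx_layer mI f2M xB; have Hr := dm_layer mI f2M xB.
have Hq' : `|q x m - f1 x| <= e by lra.
split=> //; last by lra.
have [_ f1M _] := HM x xB.
(* [q] is within [e] of [f1], hence bounded by [M + e], and [m] is below [e / (M + e + 1)]. *)
have -> : transport m (b m) f x - f x = - (m * q x m).
  by rewrite /q; field; rewrite gt_eqF.
rewrite normrN normrM gtr0_norm//.
have : `|q x m| <= M + e by have := ler_distD (f1 x) (q x m) 0; rewrite !subr0; lra.
move=> /(ler_wpM2l (ltW m0)) H; apply: le_trans H _.
have Me : 0 < M + e + 1 by have := M0; have := e0; lra.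
by move: md3; rewrite ltr_pdivlMr//; have := m0; lra.
Qed.

Let half_cont_psi : half_continuous B Z psi.
Proof.
apply: half_continuousI.
- move=> m0 m0I e e0; have [d d0 Hd] := transport_near m0I e0.
  exists d => // m mI md x xB; have m0_gt0 : 0 < m0 by case/andP: m0I.
  have m_gt0 : 0 < m by case/andP: mI.
  by rewrite /psi !rte_psi_pos//; exact: Hd.
- move=> x0 x0B Zx0 e e0; have [d d0 Hd] := layer_near x0B Zx0 e0.
  exists d => // x m xB mI xd md; have m_gt0 : 0 < m by case/andP: mI.
  by rewrite /psi rte_psi_pos// rte_psi0; case: (Hd x m xB mI xd md).
- by move=> m _; exact: continuous_rte_psi.
Qed.

Let half_cont_dx : half_continuous B Z psi_dx.
Proof.
apply: half_continuousI.
- move=> m0 m0I e e0; have [d d0 Hd] := dx_near m0I e0.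
  exists d => // m mI md x xB; have m0_gt0 : 0 < m0 by case/andP: m0I.
  have m_gt0 : 0 < m by case/andP: mI.
  by rewrite !psi_dx_pos//; exact: Hd.
- move=> x0 x0B Zx0 e e0; have [d d0 Hd] := layer_near x0B Zx0 e0.
  exists d => // x m xB mI xd md; have m_gt0 : 0 < m by case/andP: mI.
  by rewrite psi_dx_pos// psi_dx0; case: (Hd x m xB mI xd md).
- move=> m /andP[m0 _]; have [->|mn0] := eqVneq m 0.
    by have -> : psi_dx ^~ 0 = f1 by apply/funext => x; rewrite psi_dx0.
  have m_gt0 : 0 < m by rewrite lt0r mn0.
  have -> : psi_dx ^~ m = q ^~ m by apply/funext => x; rewrite psi_dx_pos.
  exact: q_cont.
Qed.

Let half_cont_dm : half_continuous B Z psi_dm.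
Proof.
apply: half_continuousI.
- move=> m0 m0I e e0; have [d d0 Hd] := dm_near m0I e0.
  exists d => // m mI md x xB; have m0_gt0 : 0 < m0 by case/andP: m0I.
  have m_gt0 : 0 < m by case/andP: mI.
  by rewrite !psi_dm_pos//; exact: Hd.
- move=> x0 x0B Zx0 e e0; have [d d0 Hd] := layer_near x0B Zx0 e0.
  exists d => // x m xB mI xd md; have m_gt0 : 0 < m by case/andP: mI.
  by rewrite psi_dm_pos// psi_dm0 opprK; case: (Hd x m xB mI xd md).
- move=> m /andP[m0 _]; have [->|mn0] := eqVneq m 0.
    have -> : psi_dm ^~ 0 = fun x => - f1 x by apply/funext => x; rewrite psi_dm0.
    by move=> x; apply: cvgN; exact: f1_cont.
  have m_gt0 : 0 < m by rewrite lt0r mn0.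
  have -> : psi_dm ^~ m = r ^~ m by apply/funext => x; rewrite psi_dm_pos.
  exact: continuous_transport.
Qed.

Local Notation A := (pointed_rect B Z).

Let psi_dxE x m : A (x, m) ->
  derivable_in [set y | A (y, m)] (psi ^~ m) x /\
  deriv_in1 A psi (x, m) = psi_dx x m.
Proof.
move=> /pointed_rectE[xB mI Zx]; rewrite /deriv_in1/=.
have sub : `]0, B[ `<=` [set y | A (y, m)].
  move=> y yB; apply/pointed_rectE; split => //; last by move=> _; exact: Z_inner.
  by move: yB; rewrite /= in_itv/=; lra.
rewrite /psi_dx; case: ifPn => [/eqP m0|mn0]; apply: (is_derive_deriv_in B_gt0 xB sub).
  have -> : psi ^~ m = f by apply/funext => y; rewrite m0 /psi rte_psi0.
  exact: f_deriv.
exact: is_derive_rte_psi.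
Qed.

Let N1 : `|-1 : R| = 1. Proof. by rewrite normrN normr1. Qed.

Let dx_cont : {within A, continuous (fun p => psi_dx p.1 p.2)}.
Proof. by apply: (half_continuous_within B_gt0 Z_reflect N1 psi_dxN half_cont_dx). Qed.

Let quotient_pos x m0 : 0 <= x <= 2 * B -> 0 < m0 <= 1 ->
  forall e, 0 < e -> exists2 d : R, 0 < d & forall m, 0 < m <= 1 -> m != m0 ->
    `|m - m0| < d -> `|diff_quotient (psi x) m0 m - psi_dm x m0| <= e.
Proof.
move=> xB m0I e e0; have e2 : 0 < e / 2 by rewrite divr_gt0.
have [d1 d10 Hd1] := dx_near m0I e2.
have m0_gt0 : 0 < m0 by case/andP: m0I.
have Dm0 : `[0, 1]%classic m0 by rewrite /= in_itv/=; lra.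
have [/(_ m0 Dm0)/derivable_in_cvg/cvg_dnbhs_withinP/(_ _ e2)[d2 d20 Hd2] _] := c_C1.
exists (Num.min d1 d2); first by rewrite lt_min d10.
move=> m mI mm0; rewrite lt_min => /andP[md1 md2].
have m_gt0 : 0 < m by case/andP: mI.
rewrite /diff_quotient psi_dm_pos// /psi !rte_psi_pos//.
rewrite [e]splitr; apply: (transport_param_diff_quotient m0_gt0 m_gt0 mm0 f_cont _ _ xB).
  by move=> y yB; exact: Hd1.
rewrite -!c_b//; apply: Hd2 => //.
by rewrite /= in_itv/=; lra.
Qed.

Let psi_dmE x m : A (x, m) ->
  derivable_in [set n | A (x, n)] (psi x) m /\
  deriv_in2 A psi (x, m) = psi_dm x m.
Proof.
move=> Axm; have /pointed_rectE[xB mI Zx] := Axm; rewrite /deriv_in2/=.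
have x2B : 0 <= x <= 2 * B by have := B_gt0; lra.
(* When [x] is outside [Z] the section misses 0, so each sign of [m] needs its own interval of
   accumulation. *)
have Apos : `](0 : R), 1[ `<=` [set n | A (x, n)].
  move=> n; rewrite /= in_itv/= => nI; apply/pointed_rectE; split => //; first lra.
  by move=> n0; rewrite n0 ltxx in nI.
have Aneg : `](-1 : R), 0[ `<=` [set n | A (x, n)].
  move=> n; rewrite /= in_itv/= => nI; apply/pointed_rectE; split => //; first lra.
  by move=> n0; rewrite n0 ltxx andbF in nI.
have [m_lt0|m_gt0|m0] := ltgtP m 0.
- have m1 : -1 <= m <= 0 by lra.
  apply: (deriv_inE (ltrN10 R) m1 Aneg); apply/cvg_dnbhs_withinP => e e0.
  have mN : 0 < - m <= 1 by lra.
  have xR : 0 <= 2 * B - x <= 2 * B by lra.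
  have [d d0 Hd] := quotient_pos xR mN e0.
  exists (Num.min d (- m)); first by rewrite lt_min d0; lra.
  move=> n /pointed_rectE[_ nI _] nm; rewrite lt_min => /andP[nd nm'].
  have nN : 0 < - n <= 1 by move: nm'; rewrite ltr_norml; lra.
  have := Hd (- n) nN; rewrite eqr_opp => /(_ nm).
  rewrite -opprD normrN => /(_ nd).
  rewrite /diff_quotient -!psiN !opprK.
  have -> : psi_dm (2 * B - x) (- m) = - psi_dm x m.
    by rewrite psi_dmN (_ : 2 * B - (2 * B - x) = x) ?mulN1r//; ring.
  rewrite opprK (_ : - n + m = - (n - m)); last by ring.
  by rewrite invrN mulrN -[X in - _ + X]opprK -opprD normrN; apply.
- have m1 : 0 <= m <= 1 by lra.
  apply: (deriv_inE ltr01 m1 Apos); apply/cvg_dnbhs_withinP => e e0.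
  have mP : 0 < m <= 1 by lra.
  have [d d0 Hd] := quotient_pos x2B mP e0.
  exists (Num.min d m); first by rewrite lt_min d0.
  move=> n /pointed_rectE[_ nI _] nm; rewrite lt_min => /andP[nd nm'].
  by apply: Hd => //; move: nm'; rewrite ltr_norml; lra.
have m1 : 0 <= m <= 1 by rewrite m0 lexx ler01.
apply: (deriv_inE ltr01 m1 Apos); apply/cvg_dnbhs_withinP => e e0.
(* At [m = 0] the difference quotient in the direction is [- psi_dx x n], by the transport equation
   itself. Its limit is thus the continuity of [psi_dx] already proved. *)
have /subspace_continuousP/(_ _ Axm)/cvgrPdist_le/(_ e e0)[[U V]/= [Ux Vm] HUV] := dx_cont.
have /nbhs_ballP[d /= d0 Hd] := Vm.
exists d => // n An nm nd.
have Un : (U `*` V) (x, n).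
  by split; [exact: nbhs_singleton Ux|apply: Hd; rewrite /ball/= distrC].
have := HUV (x, n) Un An.
rewrite -[X in `|X| <= _ -> _]/(psi_dx x m - psi_dx x n) m0 psi_dx0 psi_dm0.
have n0 : n != 0 by rewrite -m0.
rewrite /diff_quotient subr0 [psi x 0]rte_psi0 {1}/psi_dx (negbTE n0) opprK.
have -> : (psi x n - f x) / n + f1 x = f1 x - (f x - psi x n) / n by ring.
by [].
Qed.

Lemma rte_psi_C1_on2 : C1_on2 A psi.
Proof.
split.
- apply: (half_continuous_within B_gt0 Z_reflect (normr1 R) _ half_cont_psi) => //.
  by move=> x m; rewrite mul1r; exact: rte_psiN.
- by move=> [x m] Ap; exact: (proj1 (psi_dxE Ap)).
- by move=> [x m] Ap; exact: (proj1 (psi_dmE Ap)).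
- apply: (half_continuous_within B_gt0 Z_reflect N1 psi_dxN half_cont_dx).
  by move=> x m Ap; exact: (proj2 (psi_dxE Ap)).
- apply: (half_continuous_within B_gt0 Z_reflect N1 psi_dmN half_cont_dm).
  by move=> x m Ap; exact: (proj2 (psi_dmE Ap)).
Qed.

End joint_regularity.

(** * When the boundary layer vanishes *)

Section boundary_layer.
Context {R : realType}.
Variables (B : R) (b c f f1 : R -> R).
Hypotheses (B_gt0 : 0 < B)
  (c_b : forall m, 0 < m <= 1 -> c m = b m) (c_C1 : C1_on `[0, 1] c).
Implicit Types (x y m d e t K : R).
Let db := deriv_in `[0, 1] c.
Let u0 m := b m - f 0 + m * f1 0.
Let w0 m := db m + f1 0.

Let boundary_layerE x m : boundary_layer b c f f1 x m
  = expR (- m^-1 * x) * (`|w0 m| + `|u0 m| / m + x / m * (`|u0 m| / m)).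
Proof. by []. Qed.

(** The prefactor of the layer grows like [m^-2], so a cubic lower bound of the exponential leaves
    one power of [m] to spare. *)
Let expR_cube t : 0 <= t -> (t / 3) ^+ 3 <= expR t.
Proof.
move=> t0; have -> : expR t = expR (t / 3) ^+ 3.
  by rewrite !exprS expr0 mulr1 -!expRD; congr expR; field.
have := expR_ge1Dx (t / 3) => H.
by rewrite lerXn2r ?nnegrE ?divr_ge0 ?expR_ge0//; lra.
Qed.

Lemma boundary_layer_away x0 : 0 < x0 -> forall e, 0 < e ->
  exists2 d : R, 0 < d & forall x m, 0 <= x <= 2 * B ->
    0 < m <= 1 -> `|x - x0| < d -> m < d -> boundary_layer b c f f1 x m <= e.
Proof.
move=> x00 e e0.
have [K1 H1] : exists K1 : R, forall m, 0 <= m <= 1 -> `|c m| <= K1.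
  by apply: continuous_itv_bounded; apply: derivable_in_continuous; case: c_C1.
have [K2 H2] := continuous_itv_bounded (proj2 c_C1).
pose K := `|K1| + `|K2| + `|f 0| + `|f1 0|.
have K0 : 0 <= K by rewrite !addr_ge0.
have HK m : 0 < m <= 1 -> `|u0 m| <= K /\ `|w0 m| <= K.
  move=> mI; have mI' : 0 <= m <= 1 by lra.
  have n1 := ler_norm K1; have n2 := ler_norm K2.
  have a1 := H1 m mI'; have a2 := H2 m mI'.
  have p1 := normr_ge0 (f 0); have p2 := normr_ge0 K1; have p3 := normr_ge0 K2.
  have mf : `|m * f1 0| <= `|f1 0|.
    by rewrite normrM ger0_norm; [rewrite -[leRHS]mul1r ler_wpM2r//; lra|lra].
  rewrite /u0 /w0 -c_b//; split.
    apply: le_trans (ler_normD _ _) _; have := ler_normB (c m) (f 0).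
    by rewrite /K; lra.
  by apply: le_trans (ler_normD _ _) _; rewrite /K -/db in a2 *; lra.
pose D := x0 / 2.
have D0 : 0 < D by rewrite divr_gt0.
(* [27 / D^3] comes from [expR_cube] at [D / m], and [2 + 2 B] bounds [m^2 + m + 2 B] for
   [m <= 1]. *)
pose C := 27 / D ^+ 3 * K * (2 + 2 * B).
have C0 : 0 <= C.
  rewrite !mulr_ge0// ?invr_ge0 ?exprn_ge0 ?(ltW D0)//.
  by have := B_gt0; lra.
exists (Num.min D (e / (C + 1))); first by rewrite lt_min D0 divr_gt0// ltr_wpDl.
move=> x m xB mI; rewrite !lt_min => /andP[xd _] /andP[_ md].
have [uK wK] := HK m mI; have /andP[m0 m1] := mI.
have Dx : D <= x by move: xd; rewrite ltr_norml /D; lra.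
have Dm0 : 0 <= D / m by rewrite divr_ge0 ?ltW.
have E1 : expR (- m^-1 * x) <= 27 / D ^+ 3 * m ^+ 3.
  have xm : D / m <= m^-1 * x by rewrite mulrC ler_wpM2l// invr_ge0 ltW.
  rewrite mulNr expRN.
  have -> : 27 / D ^+ 3 * m ^+ 3 = ((D / m / 3) ^+ 3)^-1.
    by field; rewrite !gt_eqF.
  rewrite lef_pV2 ?posrE ?expR_gt0 ?exprn_gt0 ?divr_gt0//.
  by apply: le_trans (expR_cube Dm0) _; rewrite ler_expR.
have V0 : 0 <= m^-1 by rewrite invr_ge0 ltW.
rewrite boundary_layerE; apply: (@le_trans _ _ (27 / D ^+ 3 * m ^+ 3
    * (K + K / m + 2 * B / m * (K / m)))).
  have um : `|u0 m| / m <= K / m by rewrite ler_wpM2r.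
  apply: ler_pM => //.
    rewrite !addr_ge0// !mulr_ge0//; lra.
  rewrite !lerD// ler_pM// ?mulr_ge0//; first by lra.
  by rewrite ler_wpM2r//; lra.
apply: (@le_trans _ _ (C * m)).
  have -> : 27 / D ^+ 3 * m ^+ 3 * (K + K / m + 2 * B / m * (K / m))
      = 27 / D ^+ 3 * K * m * (m ^+ 2 + m + 2 * B).
    by field; rewrite !gt_eqF.
  rewrite /C -!mulrA ler_wpM2l// ler_wpM2l ?invr_ge0 ?exprn_ge0 ?(ltW D0)//.
  rewrite ler_wpM2l// [leRHS]mulrC ler_wpM2l ?(ltW m0)// lerD2r.
  have : m ^+ 2 <= 1 by rewrite expr_le1// ltW.
  by lra.
have C1 : 0 < C + 1 by rewrite ltr_wpDl.
by move: md; rewrite ltr_pdivlMr//; have := m0; lra.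
Qed.

(** The hypotheses say that [c m = f 0 - m f1 0 + o(m)], so [u0 / m] and [w0] tend to 0 by
    themselves. The exponential only has to absorb the factor [x / m], which makes the bound uniform
    in [x] down to 0. *)
Lemma boundary_layer_compatible : c 0 = f 0 -> db 0 = - f1 0 ->
  forall e, 0 < e -> exists2 d : R, 0 < d & forall x m, 0 <= x <= 2 * B ->
    0 < m <= 1 -> m < d -> boundary_layer b c f f1 x m <= e.
Proof.
move=> c0 db0 e e0; have e3 : 0 < e / 3 by rewrite divr_gt0.
have I0 : `[(0 : R), 1]%classic 0 by rewrite /= in_itv/= lexx ler01.
have [dc /within_continuousP cdb] := c_C1.
have [d1 d10 Hd1] := cdb 0 I0 _ e3.
have [d2 d20 Hd2] := (cvg_dnbhs_withinP _ _ _ _).1 (derivable_in_cvg (dc 0 I0)) _ e3.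
exists (Num.min d1 d2); first by rewrite lt_min d10.
move=> x m xB mI; rewrite lt_min => /andP[md1 md2]; have /andP[m0 m1] := mI.
have Im : `[(0 : R), 1]%classic m by rewrite /= in_itv/= ltW.
have wE : `|w0 m| <= e / 3.
  have := Hd1 m Im; rewrite subr0 gtr0_norm// => /(_ md1).
  by rewrite -/db db0 opprK.
have uE : `|u0 m| / m <= e / 3.
  have := Hd2 m Im; rewrite gt_eqF// subr0 gtr0_norm// => /(_ isT md2).
  rewrite -/db db0 opprK /diff_quotient subr0 c_b// c0.
  rewrite [X in `|X|](_ : _ = u0 m / m); last by rewrite /u0; field; rewrite gt_eqF.
  by rewrite normrM (@gtr0_norm _ m^-1) ?invr_gt0.
have u_ge0 : 0 <= `|u0 m| / m by rewrite divr_ge0// ltW.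
have xm0 : 0 <= x / m by rewrite divr_ge0 ?(ltW m0)//; lra.
have Ex : - m^-1 * x = - (x / m) by rewrite mulNr mulrC.
have E1 : expR (- m^-1 * x) <= 1 by rewrite Ex -expR0 ler_expR oppr_le0.
have E2 : expR (- m^-1 * x) * (x / m) <= 1.
  rewrite Ex expRN mulrC ler_pdivrMr ?expR_gt0// mul1r.
  by have := expR_ge1Dx (x / m); lra.
rewrite boundary_layerE mulrDr mulrA.
have H1 : expR (- m^-1 * x) * (`|w0 m| + `|u0 m| / m) <= `|w0 m| + `|u0 m| / m.
  by rewrite -[leRHS]mul1r ler_wpM2r// addr_ge0.
have H2 : expR (- m^-1 * x) * (x / m) * (`|u0 m| / m) <= `|u0 m| / m.
  by rewrite -[leRHS]mul1r ler_wpM2r.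
by lra.
Qed.

End boundary_layer.

Unset Implicit Arguments.

Theorem theorem4 (R : realType) (B T_b gamma : R) (psi_b : R -> R)
    (B_gt0 : 0 < B) (gamma_gt0 : 0 < gamma)
    (T_b_bound : 0 <= T_b <= gamma)
    (psi_b_meas : measurable_fun (`]0, 1]%classic : set R) psi_b)
    (psi_b_bound : forall mu, mu \in `]0, 1] -> 0 <= psi_b mu <= gamma ^+ 4) :
  exists (T : R -> R) (psi : R -> R -> R),
    milne_solution B T_b psi_b T psi /\
    (* uniqueness among nonnegative temperatures, up to the values outside of
       the domain *)
    (forall (T' : R -> R) (psi' : R -> R -> R),
       milne_solution B T_b psi_b T' psi' ->
       (forall x, x \in `[0, B] -> 0 <= T' x) ->
       forall x, x \in `[0, B] ->
         T' x = T x /\ forall mu, mu \in `[-1, 1] -> psi' x mu = psi x mu) /\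
    (* joint C^1 regularity in (x, mu), as far as psi_b allows it *)
    (forall b : R -> R,
       (forall mu, mu \in `]0, 1] -> b mu = psi_b mu) ->
       C1_on `[0, 1]%classic b ->
       C1_on2 (phase_rect B `\ (0, 0)) psi /\
       (b 0 = T_b ^+ 4 ->
        deriv_in `[0, 1]%classic b 0
          = - (4 * T_b ^+ 3 * deriv_in `[0, B]%classic T 0) ->
        C1_on2 (phase_rect B) psi)) /\
    (forall x, x \in `[0, B] -> 0 <= T x <= gamma) /\
    (forall x mu, x \in `[0, B] -> mu \in `[-1, 1] ->
       0 <= psi x mu <= gamma ^+ 4) /\
    (forall alpha : R, 0 <= alpha < 1 ->
       \int[@lebesgue_measure R]_(x in `[0%R, B])
          (expR (2 * alpha * x) * (4 * T x ^+ 3)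
             * `|deriv_in `[0, B]%classic T x| ^+ 2)
       + (1 - alpha) * \int[@lebesgue_measure R]_(x in `[0%R, B])
           (\int[@lebesgue_measure R]_(mu in `[(-1)%R, 1%R])
              (expR (2 * alpha * x) * (psi x mu - T x ^+ 4) ^+ 2))
       + 2^-1 * \int[@lebesgue_measure R]_(mu in `[(-1)%R, 0%R])
           (`|mu| * (psi 0 mu - T_b ^+ 4) ^+ 2)
       <= 2^-1 * \int[@lebesgue_measure R]_(mu in `]0%R, 1%R])
           (mu * (psi_b mu - T_b ^+ 4) ^+ 2)) /\
    (forall x, x \in `[0, B] ->
       0 <= angular_mean (fun mu => mu * (psi x mu - T x ^+ 4) ^+ 2)).
Proof.
have b_bound m : 0 < m <= 1 -> 0 <= psi_b m <= gamma ^+ 4.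
  by move=> mI; apply: psi_b_bound; rewrite in_itv.
have [W [dW [ddW HW]]] := milne_existence B_gt0 gamma_gt0 T_b_bound psi_b_meas b_bound.
pose f x := W x ^+ 4.
exists W, (rte_psi B psi_b f).
have dbl x : x \in `[0, B] -> 0 <= x <= 2 * B by rewrite in_itv/=; lra.
split; first exact: profile_milne_solution B_gt0 gamma_gt0 psi_b_meas b_bound HW.
split.
  move=> T' psi' sol' T'0 x; rewrite in_itv/= => xB.
  have [TE psiE] := milne_uniqueness B_gt0 gamma_gt0 psi_b_meas b_bound HW sol' T'0 xB.
  by split=> // m; rewrite in_itv/=; exact: psiE.
split.
  move=> b bE bC1.
  have c_b m : 0 < m <= 1 -> b m = psi_b m by move=> mI; apply: bE; rewrite in_itv.
  pose f1 x := 4 * W x ^+ 3 * dW x.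
  pose f2 x := 12 * W x ^+ 2 * dW x ^+ 2 + 4 * W x ^+ 3 * ddW x.
  have f_deriv x : is_derive x (1 : R) f (f1 x) by exact: source_deriv HW x.
  have f1_deriv x : is_derive x (1 : R) f1 (f2 x).
    have H1 := profile_deriv HW x; have H2 := profile_deriv2 HW x.
    have H3 : is_derive x (1 : R) (4 *: W ^+ 3) (12 * W x ^+ 2 * dW x).
      by apply: is_derive_eq; rewrite /GRing.scale/=; ring.
    apply: (is_derive_eq (is_deriveM H3 H2)).
    by rewrite -[(4 *: W ^+ 3) x]/(4 * W x ^+ 3) /f2 /GRing.scale/=; ring.
  have f2_cont : continuous f2.
    have W_cont x := is_derive_continuous (profile_deriv HW x).
    have dW_cont x := is_derive_continuous (profile_deriv2 HW x).
    move=> x; apply: cvgD; apply: cvgM.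
    - apply: cvgM; [exact: cvg_cst|exact: (@cvg_exprn _ _ 2 x (W_cont x))].
    - exact: (@cvg_exprn _ _ 2 x (dW_cont x)).
    - apply: cvgM; [exact: cvg_cst|exact: (@cvg_exprn _ _ 3 x (W_cont x))].
    - exact: profile_cont2 HW x.
  have f_even x : f (2 * B - x) = f x by rewrite /f (profile_even HW).
  split.
    (* Away from [x = 0] the layer decays whatever the data, so only the corner is removed. *)
    have -> : phase_rect B `\ (0, 0) = pointed_rect B [set x | 0 < x].
      apply/seteqP; split=> -[x m] /=.
        move=> [[xB mI] n00]; split; [split|] => //= m0.
        rewrite lt0r; apply/andP; split; last by move: xB; rewrite /= in_itv/= => /andP[].
        by apply/eqP => x0; apply: n00; rewrite x0 m0.
      by move=> [H n0]; split=> // -[x0 m0]; have := n0 m0; rewrite /= x0 ltxx.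
    apply: (@rte_psi_C1_on2 _ B psi_b b f f1 f2) => //.
    - by move=> x /= xB _; lra.
    - by move=> x; rewrite /= in_itv/= => /andP[].
    - by move=> x0 _ /= x00; exact: boundary_layer_away.
  move=> b0 db0.
  have -> : phase_rect B = pointed_rect B setT.
    by apply/seteqP; split=> p; [split|case].
  apply: (@rte_psi_C1_on2 _ B psi_b b f f1 f2) => //.
  move=> x0 _ _ e e0.
  have [||d d0 Hd] := @boundary_layer_compatible _ B psi_b b f f1 c_b bC1 _ _ e e0.
  - by rewrite b0 /f (profile_left HW).
  - have B0 : (0 : R) <= 0 <= B by rewrite lexx ltW.
    by rewrite db0 /f1 (profile_left HW) (profile_deriv_in B_gt0 HW).
  by exists d => // x m xB mI _ md; exact: Hd.
split; first by move=> x /dbl; exact: profile_bound HW x.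
split.
  move=> x m /dbl xB; rewrite in_itv/= => mI.
  exact: (admissible_rte_psi_bounds b_bound (milne_source_admissible gamma_gt0 HW) xB mI).
split; first by move=> alpha; exact: profile_energy B_gt0 gamma_gt0 psi_b_meas b_bound HW alpha.
move=> x; rewrite in_itv/= => xB.
exact: (milne_flux_ge0 B_gt0 gamma_gt0 psi_b_meas b_bound HW xB).
Qed.
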